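(* Define $u_0^+\equiv0$ and $u_N^-\equiv0$. Then $$\tilde u(x)=-\big(u_{i-1}^+(x)+u_i^-(x)\big)\qquad\text{for any }x\in\Omega_i,\quad i=1,\dots,N .$$
   Context: Data. $k>0$ is the wave number ($k\gtrsim 1$), $f\in L^2(\mathbb{R}^2)$ is supported in $B_l=\{x\in\mathbb{R}^2:|x_1|<l_1,|x_2|<l_2\}$. PML. For $j=1,2$, $\sigma_j\in C^1(\mathbb{R})$ is a piecewise smooth even function with $0\le\sigma_j\le\sigma_0$, $\sigma_j(t)=0$ for $|t|\le l_j$, $\sigma_j(t)=\sigma_0>0$ for $|t|\ge\bar l_j$, where $\bar l_j>l_j$ is fixed. Put $\alpha_j=1+\mathrm{i}\sigma_j$, $A(x)=\mathrm{diag}\big(\alpha_2(x_2)/\alpha_1(x_1),\alpha_1(x_1)/\alpha_2(x_2)\big)$, $J(x)=\alpha_1(x_1)\alpha_2(x_2)$. $\tilde u\in H^1(\mathbb{R}^2)$ is the solution of the PML problem $J^{-1}\nabla\cdot(A\nabla\tilde u)+k^2\tilde u=f$ in $\mathbb{R}^2$, i.e. $(A\nabla\tilde u,\nabla v)-k^2(J\tilde u,v)=-\langle Jf,v\rangle$ for all $v\in H^1(\mathbb{R}^2)$. Equivalently $\tilde u(x)=-\int_{\mathbb{R}^2}f(y)G(\tilde x,\tilde y)\,dy$, where $\tilde x_j=\int_0^{x_j}\alpha_j(t)\,dt$, $\tilde x=(\tilde x_1,\tilde x_2)$, $G(\tilde x,\tilde y)=\frac{\mathrm{i}}4H_0^{(1)}(k\rho(\tilde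 x,\tilde y))$, $\rho(\tilde x,\tilde y)=\big((\tilde x_1-\tilde y_1)^2+(\tilde x_2-\tilde y_2)^2\big)^{1/2}$ (square root in the closed first quadrant). Layers. $\Delta\zeta=2l_1/N$, $\zeta_i=-l_1+(i-1)\Delta\zeta$ for $1\le i\le N+1$. $\Omega_1=\{x_1<\zeta_2\}$, $\Omega_i=\{\zeta_i<x_1<\zeta_{i+1}\}$ for $2\le i\le N-1$, $\Omega_N=\{x_1>\zeta_N\}$. $f_i=f$ in $\Omega_i$ and $f_i=0$ elsewhere. $\beta_i^\pm=\beta_i^\pm(x_1)$ are smooth functions with $\beta_i^+=1$, $\beta_i^-=0$, $(\beta_i^\pm)'=0$ for $x_1\le\zeta_i$; $\beta_i^+=0$, $\beta_i^-=1$, $(\beta_i^\pm)'=0$ for $x_1\ge\zeta_{i+1}$; $|(\beta_i^\pm)'|\le C(\Delta\zeta)^{-1}$ with $C$ independent of $i$. PSTDDM in $\mathbb{R}^2$. Step 1: let $\bar f_1^+=f_1$. For $i=1,\dots,N-2$: let $u_i^+\in H^1(\mathbb{R}^2)$ solve $J^{-1}\nabla\cdot(A\nabla u_i^+)+k^2u_i^+=-\bar f_i^+-f_{i+1}$ in $\mathbb{R}^2$; set $\Psi_{i+1}^+(\bar f_i^+)=J^{-1}\nabla\cdot(A\nabla(\beta_{i+1}^+u_i^+))+k^2\beta_{i+1}^+u_i^+$; set $\bar f_{i+1}^+=f_{i+1}+\Psi_{i+1}^+(\bar f_i^+)$ in $\Omega_{i+1}$, $0$ elsewhere. Let $u_{N-1}^+\in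 H^1(\mathbb{R}^2)$ solve $J^{-1}\nabla\cdot(A\nabla u_{N-1}^+)+k^2u_{N-1}^+=-\bar f_{N-1}^+-f_N$. Step 2: let $\bar f_N^-=f_N$. For $i=N-1,\dots,2$: let $u_i^-\in H^1(\mathbb{R}^2)$ solve $J^{-1}\nabla\cdot(A\nabla u_i^-)+k^2u_i^-=-\bar f_{i+1}^-$ in $\mathbb{R}^2$; set $\Psi_i^-(\bar f_{i+1}^-)=J^{-1}\nabla\cdot(A\nabla(\beta_i^-u_i^-))+k^2\beta_i^-u_i^-$; set $\bar f_i^-=f_i+\Psi_i^-(\bar f_{i+1}^-)$ in $\Omega_i$, $0$ elsewhere. Let $u_1^-\in H^1(\mathbb{R}^2)$ solve $J^{-1}\nabla\cdot(A\nabla u_1^-)+k^2u_1^-=-f_1-\bar f_2^-$. *)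

(* Defs.v *)
From HB Require Import structures.
From mathcomp Require Import all_boot all_order all_algebra.
From mathcomp Require Import all_classical all_reals all_analysis.
From mathcomp Require Import complex.

Set Implicit Arguments.
Unset Strict Implicit.
Unset Printing Implicit Defensive.
Import Order.TTheory GRing.Theory Num.Theory.
Import numFieldNormedType.Exports.

Local Open Scope classical_set_scope.
Local Open Scope ring_scope.
Local Open Scope complex_scope.

Section Plane.
Context {R : realType}.
Implicit Types (phi : R * R -> R) (u v w g h : R * R -> R[i]).

Definition leb2 := (@lebesgue_measure R \x @lebesgue_measure R)%E.

(* Re and Im are qualified because ssrnum has functions of the same name on
   numClosedFieldType. *)
Definition re h (x : R * R) : R := complex.Re (h x).
Definition im h (x : R * R) : R := complex.Im (h x).

Definition cint h : R[i] :=
  (\int[leb2]_x re h x)%R +i* (\int[leb2]_x im h x)%R.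

Definition L2 h : Prop := re h \in Lfun leb2 2%:E /\ im h \in Lfun leb2 2%:E.

(* R[i] carries no topology in the library. *)
Definition continuous_at_point h (x : R * R) : Prop :=
  {for x, continuous (re h)} /\ {for x, continuous (im h)}.

Definition dir1 : R * R := (1, 0).
Definition dir2 : R * R := (0, 1).

Fixpoint Cn (n : nat) phi : Prop :=
  if n is m.+1 then
    [/\ continuous phi,
        forall x, derivable phi x dir1, forall x, derivable phi x dir2,
        Cn m ('D_dir1 phi) & Cn m ('D_dir2 phi)]
  else continuous phi.

Definition test_function phi : Prop :=
  (forall n, Cn n phi) /\ compact (closure [set x | phi x != 0]).

(* d is the distributional derivative of w in the direction e *)
Definition weak_partial (e : R * R) w d : Prop :=
  forall phi, test_function phi ->
    cint (fun x => w x * ('D_e phi x)%:C) = - cint (fun x => d x * (phi x)%:C).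

(* w belongs to H^1(R^2) and its gradient is (d1, d2) *)
Definition H1_grad w d1 d2 : Prop :=
  [/\ L2 w, L2 d1, L2 d2, weak_partial dir1 w d1 & weak_partial dir2 w d2].

End Plane.

Section PML.
Context {R : realType}.
Implicit Types (s : R -> R) (u v w g f : R * R -> R[i]) (x : R * R).

(* "Piecewise smooth" is read as C^oo off a finite set of points. *)
Record pml_profile (l lbar s0 : R) s : Prop := PmlProfile {
  pml_derivable : forall t, derivable s t 1;
  pml_C1 : continuous (derive1 s);
  pml_piecewise : exists bs : seq R,
    forall t, t \notin bs -> forall n, derivable (derive1n n s) t 1;
  pml_even : forall t, s (- t) = s t;
  pml_bounds : forall t, 0 <= s t <= s0;
  pml_inner : forall t, `|t| <= l -> s t = 0;
  pml_outer : forall t, lbar <= `|t| -> s t = s0 }.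

Definition alpha s (t : R) : R[i] := 1 +i* s t.

Definition A11 s1 s2 x : R[i] := alpha s2 x.2 / alpha s1 x.1.
Definition A22 s1 s2 x : R[i] := alpha s1 x.1 / alpha s2 x.2.
Definition J s1 s2 x : R[i] := alpha s1 x.1 * alpha s2 x.2.

(* J^-1 div (A grad w) + k^2 w = g in R^2, with w in H^1 and g in L^2:
   (A grad w, grad v) - k^2 (J w, v) = - (J g, v) for all v in H^1. *)
Definition pml_eq (k : R) s1 s2 w g : Prop :=
  L2 g /\
  exists d1 d2, H1_grad w d1 d2 /\
    forall v e1 e2, H1_grad v e1 e2 ->
      cint (fun x => A11 s1 s2 x * d1 x * (e1 x)^*
                     + A22 s1 s2 x * d2 x * (e2 x)^*)
      - (k ^+ 2)%:C * cint (fun x => J s1 s2 x * w x * (v x)^*)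
      = - cint (fun x => J s1 s2 x * g x * (v x)^*).

End PML.

Section Layers.
Context {R : realType}.
Variables (l1 : R) (N : nat).

Definition dzeta : R := 2 * l1 / N%:R.
Definition zeta (i : nat) : R := - l1 + (i%:R - 1) * dzeta.

(* meant for 1 <= i <= N and 2 <= N *)
Definition Omega (i : nat) : set (R * R) :=
  if i == 1%N then [set x | x.1 < zeta 2]
  else if i == N then [set x | zeta N < x.1]
  else [set x | zeta i < x.1 < zeta i.+1].

Definition on_layer (i : nat) (h : R * R -> R[i]) : R * R -> R[i] :=
  patch (fun=> 0) (Omega i) h.

Record cutoffs (bp bm : nat -> R -> R) (C : R) : Prop := Cutoffs {
  cut_smooth_p : forall i, (1 <= i <= N)%N ->
    forall n t, derivable (derive1n n (bp i)) t 1;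
  cut_smooth_m : forall i, (1 <= i <= N)%N ->
    forall n t, derivable (derive1n n (bm i)) t 1;
  cut_left : forall i, (1 <= i <= N)%N -> forall t, t <= zeta i ->
    [/\ bp i t = 1, bm i t = 0, derive1 (bp i) t = 0 & derive1 (bm i) t = 0];
  cut_right : forall i, (1 <= i <= N)%N -> forall t, zeta i.+1 <= t ->
    [/\ bp i t = 0, bm i t = 1, derive1 (bp i) t = 0 & derive1 (bm i) t = 0];
  cut_bound : forall i, (1 <= i <= N)%N -> forall t,
    `|derive1 (bp i) t| <= C / dzeta /\ `|derive1 (bm i) t| <= C / dzeta }.

Definition cut (b : nat -> R -> R) (i : nat) (u : R * R -> R[i]) :
    R * R -> R[i] :=
  fun x => (b i x.1)%:C * u x.

End Layers.

Section PSTDDM.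
Context {R : realType}.
Variables (k l1 : R) (s1 s2 : R -> R) (N : nat) (f : R * R -> R[i]).
Let F := (R * R -> R[i])%type.

(* The index of psi is that of the layer: psi i.+1 is
   Psi^+_{i+1}(fbar^+_i) in step 1 and psi i is Psi^-_i(fbar^-_{i+1}) in
   step 2.  In both steps Psi is the L^2 function given by the weak form of
   the operator applied to the truncated wave. *)
Record pstddm_step1 (bp : nat -> R -> R) (fbar psi u : nat -> F) : Prop := Step1 {
  step1_init : fbar 1%N = on_layer l1 N 1 f;
  step1_solve : forall i, (1 <= i <= N - 2)%N ->
    pml_eq k s1 s2 (u i) (fun x => - fbar i x - on_layer l1 N i.+1 f x);
  step1_transfer : forall i, (1 <= i <= N - 2)%N ->
    pml_eq k s1 s2 (cut bp i.+1 (u i)) (psi i.+1);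
  step1_source : forall i, (1 <= i <= N - 2)%N ->
    fbar i.+1 = on_layer l1 N i.+1
                  (fun x => on_layer l1 N i.+1 f x + psi i.+1 x);
  step1_last : pml_eq k s1 s2 (u N.-1)
    (fun x => - fbar N.-1 x - on_layer l1 N N f x) }.

Record pstddm_step2 (bm : nat -> R -> R) (fbar psi u : nat -> F) : Prop := Step2 {
  step2_init : fbar N = on_layer l1 N N f;
  step2_solve : forall i, (2 <= i <= N.-1)%N ->
    pml_eq k s1 s2 (u i) (fun x => - fbar i.+1 x);
  step2_transfer : forall i, (2 <= i <= N.-1)%N ->
    pml_eq k s1 s2 (cut bm i (u i)) (psi i);
  step2_source : forall i, (2 <= i <= N.-1)%N ->
    fbar i = on_layer l1 N i (fun x => on_layer l1 N i f x + psi i x);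
  step2_last : pml_eq k s1 s2 (u 1%N)
    (fun x => - on_layer l1 N 1 f x - fbar 2%N x) }.

End PSTDDM.

(* Main.v *)
(** Two facts give the identity: the PML operator is local, and a solution of
    the PML equation with zero source vanishes almost everywhere.

    Locality.  Where the truncated wave vanishes (resp. equals the wave), Psi
    vanishes (resp. equals the source of the wave).  Hence almost everywhere
    in R^2, Psi^+_{i+1} + fbar^+_i = fbar^+_{i+1} - f_{i+1}.
    Summing, u^+_{i-1} + sum_{2 <= j < i} beta^+_j u^+_{j-1} solves the PML
    equation with source -(f_1 + ... + f_i); symmetrically
    u^-_i + sum_{i < j < N} beta^-_j u^-_j has source -(f_{i+1} + ... + f_N).
    These waves plus ut solve the homogeneous equation, so their sum is 0, and
    the truncated terms vanish on Omega_i.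

    Uniqueness.  Let w solve the homogeneous equation.  For z the stretched
    coordinates, test it against the Gaussians
    G_m = exp(-m ((z_1 - z_1(y_1))^2 + (z_2 - z_2(y_2))^2)).  As
    (div_z grad_z + k^2) G_m = (4 m^2 |z - z(y)|^2 - 4 m + k^2) G_m, along the
    path m(r) = 1 / ((1 + i sigma_0) (eps + 4 i r^2)) this is, up to a scalar
    factor, the r-derivative of psi(r) m(r) G_{m(r)} with
    psi(r) = exp(i (1 + i sigma_0) k^2 r^2).  So
    F(r) = int J w psi(r) m(r) G_{m(r)} is constant; it tends to 0 at infinity
    because |psi(r)| = exp(-sigma_0 k^2 r^2), and at r = 0 we get
    int J w G_{m(0)} = 0 for every centre y and every eps > 0.  Superposing
    the centres against test functions and letting eps tend to 0, G_{m(0)}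
    concentrates to a nonvanishing multiple of the Dirac mass, whence w = 0. *)

Require Import Defs.
From HB Require Import structures.
From mathcomp Require Import all_boot all_order all_algebra.
From mathcomp Require Import all_classical all_reals all_analysis.
From mathcomp Require Import complex.
From mathcomp Require Import measurable_realfun ring lra zify.
Set Implicit Arguments.
Unset Strict Implicit.
Unset Printing Implicit Defensive.
Import Order.TTheory GRing.Theory Num.Theory.
Import numFieldNormedType.Exports.
Local Open Scope classical_set_scope.
Local Open Scope ring_scope.
Local Open Scope complex_scope.

(** Up to a constant, [m * G_m] is the planar heat kernel at the complex time [tau = 1 / (4 m)], and
    [psi] is [exp(k^2 (tau - tau(0)))]: uniqueness comes from writing the resolvent as a time
    integral of the heat flow, along a ray on which [exp(k^2 tau)] decays. The same ray must keep
    the Gaussians under control on the contour. Far out, [z - z(y)] is close to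
    [(1 + i sigma_0) (x - y)]; the factor [1 + i sigma_0] in the denominator of [m] removes one of
    the two such factors of the square, and what remains has a positive real part. Where nothing is
    absorbed this sign is lost for large [r], but the contour stays at bounded distance from its
    asymptotic line, and the loss is a factor bounded uniformly in [r]. The profiles being only
    [C^1], the Gaussians are neither smooth nor compactly supported, while weak derivatives are
    tested on smooth functions of compact support. Mollification and truncation bridge this gap,
    with a quadratically decaying envelope as the common dominating function. Sources are known only
    almost everywhere; in the sweeps the interfaces are discarded as null lines. *)

Notation Rec := complex.Re.
Notation Imc := complex.Im.

(** * Complex numbers through real and imaginary parts *)

Section ComplexNorm.
Context {R : realType}.
Implicit Types z w : R[i].

Lemma RecD z w : Rec (z + w) = Rec z + Rec w. Proof. by case: z; case: w. Qed.
Lemma ImcD z w : Imc (z + w) = Imc z + Imc w. Proof. by case: z; case: w. Qed.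
Lemma RecN z : Rec (- z) = - Rec z. Proof. by case: z. Qed.
Lemma ImcN z : Imc (- z) = - Imc z. Proof. by case: z. Qed.
Lemma RecM z w : Rec (z * w) = Rec z * Rec w - Imc z * Imc w.
Proof. by case: z; case: w. Qed.
Lemma ImcM z w : Imc (z * w) = Rec z * Imc w + Imc z * Rec w.
Proof. by case: z => a b; case: w => c d /=; rewrite [b * c]mulrC. Qed.
Lemma Rec_conj z : Rec z^* = Rec z. Proof. by case: z. Qed.
Lemma Imc_conj z : Imc z^* = - Imc z. Proof. by case: z. Qed.

Lemma ReIm_eq z w : Rec z = Rec w -> Imc z = Imc w -> z = w.
Proof. by case: z => a b; case: w => c d /= -> ->. Qed.

Definition ReImE := (RecD, ImcD, RecN, ImcN, RecM, ImcM, Rec_conj, Imc_conj).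

(* A norm equivalent to the modulus that splits into real and imaginary parts. *)
Definition nrm z : R := `|Rec z| + `|Imc z|.

Lemma nrm_ge0 z : 0 <= nrm z. Proof. by rewrite addr_ge0. Qed.
Lemma nrmN z : nrm (- z) = nrm z.
Proof. by rewrite /nrm !ReImE !normrN. Qed.
Lemma nrm_conj z : nrm z^* = nrm z.
Proof. by rewrite /nrm !ReImE normrN. Qed.
Lemma nrmD z w : nrm (z + w) <= nrm z + nrm w.
Proof.
rewrite /nrm !ReImE.
have := ler_normD (Rec z) (Rec w); have := ler_normD (Imc z) (Imc w); lra.
Qed.
Lemma nrmM z w : nrm (z * w) <= nrm z * nrm w.
Proof.
rewrite /nrm !ReImE.
have h1 := ler_normB (Rec z * Rec w) (Imc z * Imc w).
have h2 := ler_normD (Rec z * Imc w) (Imc z * Rec w).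
rewrite !normrM in h1 h2; rewrite mulrDl !mulrDr; lra.
Qed.
Lemma Rec_le_nrm z : `|Rec z| <= nrm z.
Proof. by rewrite lerDl. Qed.
Lemma Imc_le_nrm z : `|Imc z| <= nrm z.
Proof. by rewrite lerDr. Qed.
Lemma nrm_real (a : R) : nrm a%:C = `|a|.
Proof. by rewrite /nrm /= normr0 addr0. Qed.

End ComplexNorm.

(** * Complex-valued integrals *)

Section ComplexIntegral.
Context {R : realType} d {T : measurableType d} (mu : {measure set T -> \bar R}).
Implicit Types (h g : T -> R[i]) (G : T -> R).

Lemma ae_imply (P Q : T -> Prop) : (forall x, P x -> Q x) ->
  {ae mu, forall x, P x} -> {ae mu, forall x, Q x}.
Proof. by move=> PQ; apply: filterS. Qed.

Lemma ae_imply2 (P Q S : T -> Prop) : (forall x, P x -> Q x -> S x) ->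
  {ae mu, forall x, P x} -> {ae mu, forall x, Q x} -> {ae mu, forall x, S x}.
Proof. by move=> PQS aP aQ; near=> x; apply: PQS; near: x. Unshelve. all: by end_near. Qed.

Definition rint G := mu.-integrable setT (fun x => (G x)%:E).

Lemma rintZ c G : rint G -> rint (fun x => c * G x).
Proof.
by move=> iG; exact: (integrableZl measurableT c iG).
Qed.

Lemma rintD G H : rint G -> rint H -> rint (fun x => G x + H x).
Proof.
by move=> iG iH; exact: (integrableD measurableT iG iH).
Qed.

Lemma rintB G H : rint G -> rint H -> rint (fun x => G x - H x).
Proof.
by move=> iG iH; exact: (integrableB measurableT iG iH).
Qed.

Lemma rint_norm G : rint G -> rint (fun x => `|G x|).
Proof. exact: integrable_norm. Qed.

(** Same shape as [cint], over an arbitrary measure: [cint] converts to [cI leb2], and integrals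
    over the line are covered as well. *)
Definition cI h : R[i] := (\int[mu]_x Rec (h x))%R +i* (\int[mu]_x Imc (h x))%R.

Definition cmeas h := measurable_fun setT (fun x => Rec (h x)) /\
  measurable_fun setT (fun x => Imc (h x)).

Definition cable h := rint (fun x => Rec (h x)) /\ rint (fun x => Imc (h x)).

Lemma cable_meas h : cable h -> cmeas h.
Proof.
by case=> /measurable_int/measurable_EFinP h1 /measurable_int/measurable_EFinP.
Qed.

Lemma cmeas_cst c : cmeas (fun=> c).
Proof. by split; exact: measurable_cst. Qed.

Lemma cmeas_real G : measurable_fun setT G -> cmeas (fun x => (G x)%:C).
Proof. by move=> mG; split => //=; exact: measurable_cst. Qed.

Lemma cmeasD h g : cmeas h -> cmeas g -> cmeas (fun x => h x + g x).
Proof.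
move=> [h1 h2] [g1 g2]; split.
  by under eq_fun do rewrite RecD; exact: measurable_funD.
by under eq_fun do rewrite ImcD; exact: measurable_funD.
Qed.

Lemma cmeasN h : cmeas h -> cmeas (fun x => - h x).
Proof.
move=> [h1 h2]; split.
  by under eq_fun do rewrite RecN; exact: measurableT_comp.
by under eq_fun do rewrite ImcN; exact: measurableT_comp.
Qed.

Lemma cmeasM h g : cmeas h -> cmeas g -> cmeas (fun x => h x * g x).
Proof.
move=> [h1 h2] [g1 g2]; split.
  by under eq_fun do rewrite RecM; apply: measurable_funB; exact: measurable_funM.
by under eq_fun do rewrite ImcM; apply: measurable_funD; exact: measurable_funM.
Qed.

Lemma cmeas_conj h : cmeas h -> cmeas (fun x => (h x)^*).
Proof.
move=> [h1 h2]; split.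
  by under eq_fun do rewrite Rec_conj.
by under eq_fun do rewrite Imc_conj; exact: measurableT_comp.
Qed.

Lemma measurable_nrm h : cmeas h -> measurable_fun setT (fun x => nrm (h x)).
Proof.
by move=> [h1 h2]; apply: measurable_funD; exact: measurableT_comp.
Qed.

Lemma cable_dom h G : cmeas h -> (forall x, nrm (h x) <= G x) ->
  rint G -> cable h.
Proof.
move=> [h1 h2] hG iG.
have G0 x : 0 <= G x by apply: le_trans (hG x); exact: nrm_ge0.
split; apply: le_integrable iG => //; try exact/measurable_EFinP.
  move=> x _ /=; rewrite lee_fin [leRHS]ger0_norm//.
  by apply: le_trans (hG x); exact: Rec_le_nrm.
move=> x _ /=; rewrite lee_fin [leRHS]ger0_norm//.
by apply: le_trans (hG x); exact: Imc_le_nrm.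
Qed.

Lemma cableD h g : cable h -> cable g -> cable (fun x => h x + g x).
Proof.
move=> [h1 h2] [g1 g2]; split.
  by rewrite /rint; under eq_fun do rewrite RecD; exact: rintD.
by rewrite /rint; under eq_fun do rewrite ImcD; exact: rintD.
Qed.

Lemma cableZ c h : cable h -> cable (fun x => c * h x).
Proof.
move=> [h1 h2]; split.
  by rewrite /rint; under eq_fun do rewrite RecM; apply: rintB; exact: rintZ.
by rewrite /rint; under eq_fun do rewrite ImcM; apply: rintD; exact: rintZ.
Qed.

Lemma cableN h : cable h -> cable (fun x => - h x).
Proof.
by move=> /(cableZ (-1)); under [X in cable X -> _]eq_fun do rewrite mulN1r.
Qed.

Lemma cID h g : cable h -> cable g -> cI (fun x => h x + g x) = cI h + cI g.
Proof.
move=> [h1 h2] [g1 g2]; apply: ReIm_eq; rewrite !ReImE /=.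
  by under eq_Rintegral do rewrite RecD; rewrite RintegralD.
by under eq_Rintegral do rewrite ImcD; rewrite RintegralD.
Qed.

Lemma cIZ c h : cable h -> cI (fun x => c * h x) = c * cI h.
Proof.
move=> [h1 h2]; apply: ReIm_eq; rewrite !ReImE /=.
  under eq_Rintegral do rewrite RecM.
  by rewrite RintegralB ?RintegralZl//; exact: rintZ.
under eq_Rintegral do rewrite ImcM.
by rewrite RintegralD ?RintegralZl//; exact: rintZ.
Qed.

Lemma cIN h : cable h -> cI (fun x => - h x) = - cI h.
Proof.
move=> ih; rewrite -[RHS]mulN1r -cIZ//.
by congr cI; apply/funext => x; rewrite mulN1r.
Qed.

Lemma cI_eq h g : (forall x, h x = g x) -> cI h = cI g.
Proof. by move=> hg; congr cI; exact/funext. Qed.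

Lemma cI0 : cI (fun=> 0) = 0.
Proof. by apply: ReIm_eq; rewrite /= /Rintegral integral0. Qed.

Lemma cI_ae h g : cmeas h -> cmeas g -> {ae mu, forall x, h x = g x} ->
  cI h = cI g.
Proof.
move=> [h1 h2] [g1 g2] hg; apply: ReIm_eq => /=; congr fine;
  apply: ae_eq_integral => //; try exact/measurable_EFinP.
- by apply: filterS hg => x -> _.
- by apply: filterS hg => x -> _.
Qed.

Lemma cI_ae0 h : cmeas h -> {ae mu, forall x, h x = 0} -> cI h = 0.
Proof. by move=> mh /(cI_ae mh (cmeas_cst 0)) ->; exact: cI0. Qed.

(** The factor 2 comes from bounding the real and the imaginary part separately. *)
Lemma nrm_cI_le h G : cmeas h -> (forall x, nrm (h x) <= G x) ->
  rint G -> nrm (cI h) <= 2 * \int[mu]_x G x.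
Proof.
move=> mh hG iG; have [i1 i2] := cable_dom mh hG iG.
rewrite /nrm /= mulr_natl mulr2n lerD//.
  apply: (le_trans (le_normr_Rintegral _ i1)) => //.
  apply: le_Rintegral => //; first exact: rint_norm.
  by move=> x _; apply: le_trans (hG x); exact: Rec_le_nrm.
apply: (le_trans (le_normr_Rintegral _ i2)) => //.
apply: le_Rintegral => //; first exact: rint_norm.
by move=> x _; apply: le_trans (hG x); exact: Imc_le_nrm.
Qed.

Definition ccvg (u : nat -> R[i]) (l : R[i]) : Prop :=
  (Rec (u n) @[n --> \oo] --> Rec l) /\ (Imc (u n) @[n --> \oo] --> Imc l).

Lemma real_dct (f_ : nat -> T -> R) (f G : T -> R) :
  (forall n, measurable_fun setT (f_ n)) -> measurable_fun setT f ->
  (forall x, f_ n x @[n --> \oo] --> f x) ->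
  (forall n x, `|f_ n x| <= G x) -> rint G ->
  (\int[mu]_x f_ n x)%R @[n --> \oo] --> (\int[mu]_x f x)%R.
Proof.
move=> mf_ mf cf bf iG.
have [|||||fi _ ce] := @dominated_convergence _ _ R mu setT measurableT
  (fun n => EFin \o f_ n) (EFin \o f) (EFin \o G).
- by move=> n; exact/measurable_EFinP.
- exact/measurable_EFinP.
- by apply: aeW => x _; apply: cvg_EFin; [exact: nearW|exact: cf].
- exact: iG.
- by apply: aeW => x n _; rewrite lee_fin.
have fin : (\int[mu]_x (EFin \o f) x)%E \is a fin_num by exact: integrable_fin_num.
rewrite /Rintegral; apply: fine_cvg.
by rewrite fineK.
Qed.

Lemma cI_dct (h_ : nat -> T -> R[i]) h G :
  (forall n, cmeas (h_ n)) -> cmeas h ->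
  (forall x, ccvg (h_ ^~ x) (h x)) ->
  (forall n x, nrm (h_ n x) <= G x) -> rint G ->
  ccvg (fun n => cI (h_ n)) (cI h).
Proof.
move=> mh_ [m1 m2] ch bh iG; split => /=.
  apply: real_dct (iG) => // [n|x|n x].
  - by have [] := mh_ n.
  - by have [] := ch x.
  - by apply: le_trans (bh n x); exact: Rec_le_nrm.
apply: real_dct (iG) => // [n|x|n x].
- by have [] := mh_ n.
- by have [] := ch x.
- by apply: le_trans (bh n x); exact: Imc_le_nrm.
Qed.

Lemma ccvg_unique (u : nat -> R[i]) l l' : ccvg u l -> ccvg u l' -> l = l'.
Proof.
move=> [a b] [a' b']; apply: ReIm_eq; first exact: (cvg_unique _ a a').
exact: (cvg_unique _ b b').
Qed.

Lemma ccvg_cst l : ccvg (fun=> l) l.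
Proof. by split; exact: cvg_cst. Qed.

Lemma ccvgM u v l m : ccvg u l -> ccvg v m -> ccvg (fun n => u n * v n) (l * m).
Proof.
move=> [a b] [a' b']; split.
  under eq_fun do rewrite RecM; rewrite RecM.
  by apply: cvgB; exact: cvgM.
under eq_fun do rewrite ImcM; rewrite ImcM.
by apply: cvgD; exact: cvgM.
Qed.

Lemma ccvgN u l : ccvg u l -> ccvg (fun n => - u n) (- l).
Proof.
by move=> [a b]; split; [under eq_fun do rewrite RecN; rewrite RecN
  |under eq_fun do rewrite ImcN; rewrite ImcN]; exact: cvgN.
Qed.

Lemma ccvg_real (u : nat -> R) (l : R) : u n @[n --> \oo] --> l ->
  ccvg (fun n => (u n)%:C) l%:C.
Proof. by move=> ul; split => //=; exact: cvg_cst. Qed.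

Lemma Lfun2P G : measurable_fun setT G ->
  rint (fun x => G x ^+ 2) -> G \in Lfun mu 2%:E.
Proof.
move=> mG iG; apply/andP; split; rewrite inE//=.
rewrite /finite_norm unlock /Lnorm poweR_lty//.
under eq_integral do rewrite /= powR_mulrn// real_normK ?num_real//.
have /integrableP[_] := iG; apply: le_lt_trans.
apply: ge0_le_integral => //.
- by move=> x _; rewrite lee_fin sqr_ge0.
- by have /measurable_int := iG.
- by apply: measurableT_comp => //; have /measurable_int := iG.
- by move=> x _ /=; rewrite lee_fin ler_norm.
Qed.

Lemma Lfun2_meas G : G \in Lfun mu 2%:E -> measurable_fun setT G.
Proof. by move=> /andP[]; rewrite inE/=. Qed.

Lemma Lfun2_dom G H : measurable_fun setT G -> H \in Lfun mu 2%:E ->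
  (forall x, `|G x| <= H x) -> G \in Lfun mu 2%:E.
Proof.
move=> mG /Lfun2_integrable_sqr iH GH; apply: Lfun2P => //.
apply: le_integrable iH => //.
  by apply/measurable_EFinP; exact: measurable_funX.
move=> x _; rewrite lee_fin !normrX ler_sqr ?nnegrE//.
by apply: le_trans (GH x) _; exact: ler_norm.
Qed.

Definition cL2 h := (fun x => Rec (h x)) \in Lfun mu 2%:E /\
  (fun x => Imc (h x)) \in Lfun mu 2%:E.

Lemma cL2_meas h : cL2 h -> cmeas h.
Proof. by case=> /Lfun2_meas h1 /Lfun2_meas. Qed.

Lemma Lfun2_norm G : G \in Lfun mu 2%:E -> (fun x => `|G x|) \in Lfun mu 2%:E.
Proof.
move=> iG; apply: Lfun2P.
  by apply: measurableT_comp => //; exact: Lfun2_meas.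
rewrite (_ : (fun x => `|G x| ^+ 2) = (fun x => G x ^+ 2)); last first.
  by apply/funext => x; rewrite real_normK ?num_real.
exact: Lfun2_integrable_sqr.
Qed.

Lemma Lfun2D G H : G \in Lfun mu 2%:E -> H \in Lfun mu 2%:E ->
  (fun x => G x + H x) \in Lfun mu 2%:E.
Proof.
move=> iG iH; have p1 : (1 <= 2%:E :> \bar R)%E by rewrite lee1n.
exact: (Lfun_addr_closed mu p1).2 iG iH.
Qed.

Lemma Lfun2_0 : (fun=> 0 : R) \in Lfun mu 2%:E.
Proof.
have p1 : (1 <= 2%:E :> \bar R)%E by rewrite lee1n.
exact: (Lfun_addr_closed mu p1).1.
Qed.

Lemma Lfun2Z c G : G \in Lfun mu 2%:E -> (fun x => c * G x) \in Lfun mu 2%:E.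
Proof.
move=> iG; have h1 : 1 <= 2 :> R by rewrite ler1n.
rewrite (_ : (fun x => _) = (c \o* G)); first exact: Lfun_scale.
by apply/funext => x; rewrite /= mulrC.
Qed.

Lemma cL2_nrm h : cL2 h -> (fun x => nrm (h x)) \in Lfun mu 2%:E.
Proof.
move=> [/Lfun2_norm h1 /Lfun2_norm h2].
exact: (Lfun2D h1 h2).
Qed.

Lemma cL2_dom h G : cmeas h -> G \in Lfun mu 2%:E -> (forall x, nrm (h x) <= G x) ->
  cL2 h.
Proof.
move=> [m1 m2] iG hG; split; apply: (Lfun2_dom _ iG) => // x;
  apply: le_trans (hG x); [exact: Rec_le_nrm|exact: Imc_le_nrm].
Qed.

Lemma cL2D h g : cL2 h -> cL2 g -> cL2 (fun x => h x + g x).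
Proof.
move=> [h1 h2] [g1 g2]; split.
  under eq_fun do rewrite RecD.
  exact: (Lfun2D h1 g1).
under eq_fun do rewrite ImcD.
exact: (Lfun2D h2 g2).
Qed.

Lemma cL2M b c h : cmeas b -> (forall x, nrm (b x) <= c) -> cL2 h ->
  cL2 (fun x => b x * h x).
Proof.
move=> mb bc ih; apply: cL2_dom (Lfun2Z c (cL2_nrm ih)) _.
  by apply: cmeasM => //; exact: cL2_meas.
move=> x; apply: le_trans (nrmM _ _) _.
by apply: ler_wpM2r => //; exact: nrm_ge0.
Qed.

Lemma cL2Z c h : cL2 h -> cL2 (fun x => c * h x).
Proof. exact: (cL2M (cmeas_cst c) (fun=> lexx _)). Qed.

Lemma cL2_conj h : cL2 h -> cL2 (fun x => (h x)^*).
Proof.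
move=> ih; apply: cL2_dom (cL2_nrm ih) _.
  by apply: cmeas_conj; exact: cL2_meas.
by move=> x; rewrite nrm_conj.
Qed.

Lemma cL20 : cL2 (fun=> 0).
Proof. by split; exact: Lfun2_0. Qed.

Lemma Lfun2_mul_integrable G H : G \in Lfun mu 2%:E -> H \in Lfun mu 2%:E ->
  rint (fun x => G x * H x).
Proof. by move=> iG iH; apply/Lfun1_integrable/Lfun2_mul_Lfun1. Qed.

Lemma cL2_mul h g : cL2 h -> cL2 g -> cable (fun x => h x * g x).
Proof.
move=> ih ig; apply: cable_dom (Lfun2_mul_integrable (cL2_nrm ih) (cL2_nrm ig)).
  by apply: cmeasM; exact: cL2_meas.
by move=> x; exact: nrmM.
Qed.

End ComplexIntegral.

(** * Functions whose integrals vanish on a generating class *)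

Section NullClass.
Context {R : realType} d {T : measurableType d} (mu : {measure set T -> \bar R}).
Implicit Types h : T -> R.

Lemma Rintegral_bigcup0 h (F : (set T)^nat) : rint mu h ->
  (forall n, measurable (F n)) -> trivIset setT F ->
  (forall n, \int[mu]_(x in F n) h x = 0) ->
  \int[mu]_(x in \bigcup_n F n) h x = 0.
Proof.
move=> ih mF tF F0; rewrite /Rintegral integral_bigcup//; last first.
  apply: integrableS ih => //; exact: bigcupT_measurable.
rewrite eseries0//= => n _ _.
have := F0 n; rewrite /Rintegral => e.
rewrite -[LHS]fineK ?e//; apply: integrable_fin_num => //.
exact: integrableS ih.
Qed.

(** Dynkin's argument: the sets [B] for which the integral over the part of [E] lying above [B]
    vanishes are stable under complement, since the integral over [E] vanishes, and under disjoint
    unions. Pulling back along [g] allows one coordinate to be treated at a time. *)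
Lemma Rintegral_preimage0 d' (T' : measurableType d') (g : T -> T') (E : set T)
    (G : set (set T')) h : rint mu h ->
  measurable_fun setT g -> measurable E ->
  @measurable _ T' = <<s G >> -> setI_closed G ->
  \int[mu]_(x in E) h x = 0 ->
  (forall A, G A -> \int[mu]_(x in E `&` g @^-1` A) h x = 0) ->
  forall A, measurable A -> \int[mu]_(x in E `&` g @^-1` A) h x = 0.
Proof.
move=> ih mg mE mG GI E0 GP A mA.
have mEg B : measurable B -> measurable (E `&` g @^-1` B).
  by move=> mB; apply: measurableI => //; rewrite -[X in measurable X]setTI; exact: mg.
apply: (dynkin_induction mG GI
  (P := fun B => \int[mu]_(x in E `&` g @^-1` B) h x = 0)) => //.
- by rewrite preimage_setT setIT.
- move=> B mB B0.
  have EE : E = (E `&` g @^-1` B) `|` (E `&` g @^-1` (~` B)).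
    by rewrite -setIUr -preimage_setU setUv preimage_setT setIT.
  have := E0; rewrite {1}EE Rintegral_setU//.
  + by rewrite B0 add0r.
  + exact: mEg.
  + by apply: mEg; exact: measurableC.
  + by rewrite -EE; exact: integrableS ih.
  + rewrite disj_set2E; apply/eqP/seteqP; split => // x [[_ /= Bx] [_ /=]].
    by apply.
- move=> F mF tF F0; rewrite preimage_bigcup setI_bigcupr.
  apply: Rintegral_bigcup0 => //.
  + by move=> n; exact: mEg.
  + apply/trivIsetP => i j _ _ ij; apply/seteqP; split => // x [[_ Fi] [_ Fj]].
    have /trivIsetP/(_ i j Logic.I Logic.I ij) e := tF.
    have : (F i `&` F j) (g x) by [].
    by rewrite e.
- by rewrite -mG.
Qed.

Lemma Rintegral_ae0 h : rint mu h ->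
  (forall A, measurable A -> \int[mu]_(x in A) h x = 0) ->
  {ae mu, forall x, h x = 0}.
Proof.
move=> ih h0.
have := @integral_ae_eq _ _ _ mu setT measurableT (cst 0%E) (fun x => (h x)%:E) ih.
move=> H; suff: ae_eq mu setT (fun x => (h x)%:E) (cst 0%E).
  by apply: filterS => x /(_ Logic.I) [].
apply: H => // E _ mE; rewrite integral0 -[LHS]fineK.
  by have := h0 E mE; rewrite /Rintegral => ->.
by apply: integrable_fin_num => //; exact: integrableS ih.
Qed.

End NullClass.

(** * Open rectangles determine a planar function *)

Section RectangleLemma.
Context {R : realType}.
Implicit Types h : R * R -> R.
Local Notation mu := (@leb2 R).

Definition rect (a b c d : R) : set (R * R) := `]a, b[%classic `*` `]c, d[%classic.

Lemma measurable_rect a b c d : measurable (rect a b c d).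
Proof. by apply: measurableX; exact: measurable_itv. Qed.

Lemma openitv_setI : setI_closed (@RGenOpens.G R).
Proof.
move=> _ _ [a [b ->]] [c [d ->]].
exists (Num.max a c), (Num.min b d); apply/seteqP; split => x /=;
  rewrite !in_itv/= gt_max lt_min.
  by move=> [/andP[-> ->] /andP[-> ->]].
by move=> /andP[/andP[-> ->] /andP[-> ->]].
Qed.

Lemma cvg_itvN (x : R) : \forall n \near \oo, `]- n%:R, n%:R[%classic x.
Proof.
near=> n; rewrite /= in_itv/= -ltr_norml.
by near: n; exact: nbhs_infty_gtr.
Unshelve. all: by end_near. Qed.

Lemma Rintegral_cvg h (A : (set (R * R))^nat) (B : set (R * R)) : rint mu h ->
  (forall n, measurable (A n)) -> measurable B ->
  (forall x, \forall n \near \oo, A n x <-> B x) ->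
  (\int[mu]_(x in A n) h x)%R @[n --> \oo] --> (\int[mu]_(x in B) h x)%R.
Proof.
move=> ih mA mB AB; rewrite Rintegral_mkcond.
under eq_fun do rewrite Rintegral_mkcond.
have mh : measurable_fun setT h by move/measurable_int/measurable_EFinP : ih.
apply: (@real_dct _ _ _ mu _ _ (fun x => `|h x|)).
- by move=> n; apply/(measurable_restrictT h (mA n)); exact: measurable_funS mh.
- by apply/(measurable_restrictT h mB); exact: measurable_funS mh.
- move=> x; apply: cvg_near_cst; near=> n.
  have e : A n x <-> B x by near: n; exact: AB.
  rewrite /patch; suff -> : (x \in A n) = (x \in B) by [].
  by apply/idP/idP; rewrite !inE => /e.
- move=> n x; rewrite /patch; case: ifPn => // _; by rewrite normr0.
- exact: rint_norm.
Unshelve. all: by end_near. Qed.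

(** In each coordinate, exhaustion by []- n, n[] supplies the whole line, as Dynkin's argument
    requires, and open intervals then generate all measurable sets. Measurable rectangles finally
    generate the product sigma-algebra. *)
Lemma rect_ae0 h : rint mu h ->
  (forall a b c d, \int[mu]_(x in rect a b c d) h x = 0) ->
  {ae mu, forall x, h x = 0}.
Proof.
move=> ih h0; apply: Rintegral_ae0 => // A mA.
have mI (a b : R) : measurable `]a, b[%classic by exact: measurable_itv.
have h1 c d : \int[mu]_(x in setT `*` `]c, d[%classic) h x = 0.
  apply: (cvg_unique _ (Rintegral_cvg (A := fun n => rect (- n%:R) n%:R c d) ih _ _ _)).
  - by [].
  - by move=> n; exact: measurable_rect.
  - exact: measurableX.
  - move=> x; near=> n; split => [[]//|[_ cd]]; split => //.
    by near: n; exact: cvg_itvN.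
  - rewrite (_ : (fun n => _) = fun=> 0); first exact: cvg_cst.
    by apply/funext => n; exact: h0.
have h2 c d B : measurable B -> \int[mu]_(x in B `*` `]c, d[%classic) h x = 0.
  move=> mB.
  have /= := @Rintegral_preimage0 _ _ _ mu _ R fst (setT `*` `]c, d[%classic) _ h ih
    measurable_fst _ (RGenOpens.measurableE R) openitv_setI (h1 c d) => H.
  have e C : (setT `*` `]c, d[%classic) `&` fst @^-1` C = C `*` `]c, d[%classic :> set (R * R).
    by apply/seteqP; split => [x [[_ ?] ?]|x [? ?]].
  rewrite -e; apply: H => //; first exact: measurableX.
  by move=> _ [a [b ->]]; rewrite e; exact: h0.
have h3 B : measurable B -> \int[mu]_(x in B `*` setT) h x = 0.
  move=> mB.
  apply: (cvg_unique _ (Rintegral_cvg (A := fun n => B `*` `]- n%:R, n%:R[%classic) ih _ _ _)).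
  - by [].
  - by move=> n; exact: measurableX.
  - exact: measurableX.
  - move=> x; near=> n; split => [[]//|[Bx _]]; split => //.
    by near: n; exact: cvg_itvN.
  - rewrite (_ : (fun n => _) = fun=> 0); first exact: cvg_cst.
    by apply/funext => n; exact: h2.
have h4 B C : measurable B -> measurable C -> \int[mu]_(x in B `*` C) h x = 0.
  move=> mB mC.
  have /= := @Rintegral_preimage0 _ _ _ mu _ R snd (B `*` setT) _ h ih
    measurable_snd _ (RGenOpens.measurableE R) openitv_setI (h3 B mB) => H.
  have e D : (B `*` setT) `&` snd @^-1` D = B `*` D :> set (R * R).
    by apply/seteqP; split => [x [[? _] ?]|x [? ?]].
  rewrite -e; apply: H => //; first exact: measurableX.
  by move=> _ [a [b ->]]; rewrite e; exact: h2.
have := @Rintegral_preimage0 _ _ _ mu _ (R * R)%type id setT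
  [set B `*` C | B in measurable & C in measurable] h ih _ _
  (measurable_prod_measurableType _ _).
move=> H; rewrite -[A in \int[mu]_(x in A) _]setTI; apply: H => //.
- move=> _ _ [B mB [C mC <-]] [B' mB' [C' mC' <-]].
  exists (B `&` B'); first exact: measurableI.
  by exists (C `&` C'); [exact: measurableI|rewrite setXI].
- by rewrite -setXTT; exact: h3.
- by move=> _ [B mB [C mC <-]]; rewrite setTI; exact: h4.
Unshelve. all: by end_near. Qed.

End RectangleLemma.

Lemma continuous_sqr {R : realType} {T : topologicalType} (f : T -> R) :
  continuous f -> continuous (fun x => f x ^+ 2).
Proof.
move=> cf x; apply: (@continuous_comp _ _ _ f (fun y => y ^+ 2)); first exact: cf.
exact: exprn_continuous.
Qed.

(** * Smooth functions and weak derivatives *)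

Section OneVariable.
Context {R : realType}.
Implicit Types f g p q : R -> R.

Lemma der_plus f g (t a b : R) : is_derive t 1 f a -> is_derive t 1 g b ->
  is_derive t 1 (fun t => f t + g t) (a + b).
Proof. exact: is_deriveD. Qed.

Lemma der_neg f (t a : R) : is_derive t 1 f a -> is_derive t 1 (fun t => - f t) (- a).
Proof. exact: is_deriveN. Qed.

Lemma der_sub f g (t a b : R) : is_derive t 1 f a -> is_derive t 1 g b ->
  is_derive t 1 (fun t => f t - g t) (a - b).
Proof. exact: is_deriveB. Qed.

Lemma der_mul f g (t a b : R) : is_derive t 1 f a -> is_derive t 1 g b ->
  is_derive t 1 (fun t => f t * g t) (a * g t + f t * b).
Proof.
move=> fa gb; apply: (is_derive_eq (is_deriveM fa gb)).
by rewrite /GRing.scale/= addrC [g t * a]mulrC.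
Qed.

Lemma der_comp f g (t a b : R) : is_derive (g t) 1 f a -> is_derive t 1 g b ->
  is_derive t 1 (fun t => f (g t)) (a * b).
Proof. exact: is_derive1_comp. Qed.

Lemma der_cst (c t : R) : is_derive t (1:R) (fun=> c) 0.
Proof. exact: is_derive_cst. Qed.

Lemma der_id (t : R) : is_derive t 1 (fun t : R => t) 1.
Proof. exact: is_derive_id. Qed.

Lemma der_derive1 f (t a : R) : is_derive t 1 f a -> (derive1 f) t = a.
Proof. by move=> [_ <-]; rewrite derive1E. Qed.

Lemma derivable_der f (t : R) : derivable f t 1 -> is_derive t 1 f ((derive1 f) t).
Proof. by move=> df; split => //; rewrite derive1E. Qed.

Lemma der_continuous f (t a : R) : is_derive t 1 f a -> {for t, continuous f}.
Proof.
by move=> [df _]; apply: differentiable_continuous; apply/derivable1_diffP.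
Qed.

(** Differentiability of order [n.+1], with derivatives peeled off from the inside, so that the
    product and chain rules follow by induction on [n]. *)
Fixpoint smn n p := (forall t, derivable p t 1) /\
  if n is m.+1 then smn m (derive1 p) else True.

Definition smooth p := forall n, smn n p.

Lemma smooth_derivable p (t : R) : smooth p -> is_derive t 1 p ((derive1 p) t).
Proof. by move=> /(_ 0%N)[/(_ t) dp _]; exact: derivable_der. Qed.

Lemma smooth_derive1 p : smooth p -> smooth (derive1 p).
Proof. by move=> sp n; case: (sp n.+1). Qed.

Lemma smooth_continuous p : smooth p -> continuous p.
Proof. by move=> sp t; exact: der_continuous (smooth_derivable t sp). Qed.

Lemma smoothP p : (forall n t, derivable (derive1n n p) t 1) -> smooth p.
Proof.
move=> sp n; elim: n p sp => [|n IH] p sp; split => //=.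
- exact: (sp 0%N).
- exact: (sp 0%N).
- by apply: IH => m t; rewrite -derive1Sn.
Qed.

Lemma smnW n p : smn n.+1 p -> smn n p.
Proof.
by elim: n p => [p [dp _]|n IH p [dp /IH dp']]; [exact: (conj dp I)|exact: (conj dp dp')].
Qed.

Lemma smn_add n p q : smn n p -> smn n q -> smn n (fun t => p t + q t).
Proof.
elim: n p q => [|n IH] p q [dp p'] [dq q']; split; try exact: I.
- by move=> t; have [] := der_plus (derivable_der (dp t)) (derivable_der (dq t)).
- by move=> t; have [] := der_plus (derivable_der (dp t)) (derivable_der (dq t)).
rewrite (_ : derive1 _ = fun t => (derive1 p) t + (derive1 q) t); first exact: IH.
apply/funext => t; apply: der_derive1.
exact: der_plus (derivable_der (dp t)) (derivable_der (dq t)).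
Qed.

Lemma smn_mul n p q : smn n p -> smn n q -> smn n (fun t => p t * q t).
Proof.
elim: n p q => [|n IH] p q sp sq; have [dp p'] := sp; have [dq q'] := sq; split; try exact: I.
- by move=> t; have [] := der_mul (derivable_der (dp t)) (derivable_der (dq t)).
- by move=> t; have [] := der_mul (derivable_der (dp t)) (derivable_der (dq t)).
rewrite (_ : derive1 _ = fun t => (derive1 p) t * q t + p t * (derive1 q) t).
  by apply: smn_add; apply: IH => //; exact: smnW.
apply/funext => t; apply: der_derive1.
exact: der_mul (derivable_der (dp t)) (derivable_der (dq t)).
Qed.

Lemma smn_cst n (c : R) : smn n (fun=> c).
Proof.
elim: n c => [|n IH] c; split => //.
rewrite (_ : derive1 _ = fun=> 0); first exact: IH.
by apply/funext => t; apply: der_derive1; exact: der_cst.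
Qed.

Lemma smooth_mul p q : smooth p -> smooth q -> smooth (fun t => p t * q t).
Proof. by move=> sp sq n; exact: smn_mul. Qed.

Lemma der_affine (a b t : R) : is_derive t (1 : R) (fun t => a * t + b) a.
Proof.
apply: (is_derive_eq (der_plus (der_mul (der_cst a t) (der_id t)) (der_cst b t))).
by rewrite mul0r mulr1 add0r addr0.
Qed.

Lemma smooth_affine p (a b : R) : smooth p -> smooth (fun t => p (a * t + b)).
Proof.
have daff := der_affine a b.
move=> sp n; elim: n p sp => [|n IH] p sp; split => //.
- by move=> t; have [] := der_comp (f := p) (g := fun t => a * t + b)
    (smooth_derivable (a * t + b) sp) (daff t).
- by move=> t; have [] := der_comp (f := p) (g := fun t => a * t + b)
    (smooth_derivable (a * t + b) sp) (daff t).
rewrite (_ : derive1 _ = fun t => (derive1 p) (a * t + b) * a).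
  by apply: smn_mul; [apply: IH; exact: smooth_derive1|exact: smn_cst].
apply/funext => t; apply: der_derive1.
exact: (der_comp (f := p) (g := fun t => a * t + b)
    (smooth_derivable (a * t + b) sp) (daff t)).
Qed.

End OneVariable.

(** * Partial derivatives, tensor products and compact support *)

Section PlaneCalculus.
Context {R : realType}.
Implicit Types (phi F g : R * R -> R) (p q : R -> R).
Local Notation mu := (@leb2 R).

Lemma is_derive_dir1 phi x (a : R) :
  is_derive x (@dir1 R) phi a <-> is_derive x.1 (1 : R) (fun t => phi (t, x.2)) a.
Proof.
have e : (fun h : R => h^-1 *: (phi (h *: (@dir1 R) + x) - phi x)) =
    (fun h : R => h^-1 *: (phi (h *: (1 : R) + x.1, x.2) - phi (x.1, x.2))).
  apply/funext => h; case: x => x1 x2; congr (_ *: (phi _ - _)).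
  rewrite /dir1. rewrite (_ : h *: (1, 0) + (x1, x2) = (h * 1 + x1, h * 0 + x2)) //. by rewrite mulr0 add0r.
by split => -[h1 h2]; split; move: h1 h2; rewrite /derivable /derive e.
Qed.

Lemma is_derive_dir2 phi x (a : R) :
  is_derive x (@dir2 R) phi a <-> is_derive x.2 (1 : R) (fun t => phi (x.1, t)) a.
Proof.
have e : (fun h : R => h^-1 *: (phi (h *: (@dir2 R) + x) - phi x)) =
    (fun h : R => h^-1 *: (phi (x.1, h *: (1 : R) + x.2) - phi (x.1, x.2))).
  apply/funext => h; case: x => x1 x2; congr (_ *: (phi _ - _)).
  rewrite /dir2. rewrite (_ : h *: (0, 1) + (x1, x2) = (h * 0 + x1, h * 1 + x2)) //. by rewrite mulr0 add0r.
by split => -[h1 h2]; split; move: h1 h2; rewrite /derivable /derive e.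
Qed.

Definition tens p q (x : R * R) : R := p x.1 * q x.2.

Lemma continuous_tens p q : continuous p -> continuous q -> continuous (tens p q).
Proof.
move=> cp cq x; apply: cvgM.
  by apply: continuous_comp; [exact: cvg_fst|exact: cp].
by apply: continuous_comp; [exact: cvg_snd|exact: cq].
Qed.

Lemma tens_derive1 p q x : smooth p ->
  is_derive x (@dir1 R) (tens p q) (tens (derive1 p) q x).
Proof.
move=> sp; apply/is_derive_dir1.
apply: (is_derive_eq (der_mul (smooth_derivable _ sp) (der_cst (q x.2) x.1))).
by rewrite mulr0 addr0.
Qed.

Lemma tens_derive2 p q x : smooth q ->
  is_derive x (@dir2 R) (tens p q) (tens p (derive1 q) x).
Proof.
move=> sp; apply/is_derive_dir2.
apply: (is_derive_eq (der_mul (der_cst (p x.1) x.2) (smooth_derivable _ sp))).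
by rewrite mul0r add0r.
Qed.

Lemma Cn_tens n p q : smooth p -> smooth q -> Cn n (tens p q).
Proof.
have ct p' q' : smooth p' -> smooth q' -> continuous (tens p' q').
  by move=> ? ?; apply: continuous_tens; exact: smooth_continuous.
elim: n p q => [|n IH] p q sp sq /=; first exact: ct.
have e1 : 'D_dir1 (tens p q) = tens (derive1 p) q.
  by apply/funext => x; have [_ ->] := tens_derive1 q x sp.
have e2 : 'D_dir2 (tens p q) = tens p (derive1 q).
  by apply/funext => x; have [_ ->] := tens_derive2 p x sq.
split; rewrite ?e1 ?e2; first exact: ct.
- by move=> x; have [] := tens_derive1 q x sp.
- by move=> x; have [] := tens_derive2 p x sq.
- by apply: IH => //; exact: smooth_derive1.
- by apply: IH => //; exact: smooth_derive1.
Qed.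

(** Vanishing on [offbox M] is the quantitative form of compact support. *)
Definition offbox (M : R) (x : R * R) := M < `|x.1| \/ M < `|x.2|.

Lemma compact_box (M : R) : compact (`[-M, M]%classic `*` `[-M, M]%classic : set (R * R)).
Proof. by apply: compact_setX; exact: segment_compact. Qed.

Lemma not_offbox M x : ~ offbox M x -> (`[-M, M]%classic `*` `[-M, M]%classic) x.
Proof.
move=> h; split; rewrite /= in_itv /= -ler_norml leNgt; apply/negP => h'; apply: h;
  by [left|right].
Qed.

Lemma test_function_tens p q (M : R) : smooth p -> smooth q ->
  (forall t, M < `|t| -> p t = 0) -> (forall t, M < `|t| -> q t = 0) ->
  test_function (tens p q).
Proof.
move=> sp sq p0 q0; split; first by move=> n; exact: Cn_tens.
have cb := @compact_box M.
apply: (subclosed_compact _ cb); first exact: closed_closure.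
have clb : closed (`[-M, M]%classic `*` `[-M, M]%classic : set (R * R)).
  apply: compact_closed => //; exact: norm_hausdorff.
rewrite [X in _ `<=` X]((closure_id _).1 clb).
apply: closure_subset => x /= /eqP h; apply: not_offbox => -[] ob; apply: h.
  by rewrite /tens p0// mul0r.
by rewrite /tens q0// mulr0.
Qed.

Lemma test_function_box phi : test_function phi ->
  exists M : R, forall x, offbox M x -> phi x = 0.
Proof.
move=> [_ /compact_bounded [M [Mr HM]]].
exists (M + 1) => x ob; apply: contrapT => /eqP nz.
have MM : M < M + 1 by rewrite ltrDl.
have cx : closure [set x | phi x != 0] x by exact: subset_closure.
have := HM (M + 1) MM x cx; rewrite /= prod_normE /= ge_max => /andP[h1 h2].
by case: ob; rewrite ltNge ?h1 ?h2.
Qed.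

(** The plane carries the product sigma-algebra, so that an open set is measurable as a countable
    union of squares with rational centres and radii [n.+1^-1]. *)
Lemma open_prod_measurable (U : set (R * R)) : open U -> measurable U.
Proof.
move=> oU.
pose B (i : rat * rat * nat) : set (R * R) :=
  ball (ratr i.1.1 : R) i.2.+1%:R^-1 `*` ball (ratr i.1.2 : R) i.2.+1%:R^-1.
pose D : set (rat * rat * nat) := [set i | B i `<=` U].
have -> : U = \bigcup_(i in D) B i.
  apply/seteqP; split => [x Ux|x [i Di Bi]]; last exact: Di.
  have /nbhs_ballP[e /= e0 eU] : nbhs x U by move: oU; rewrite openE; exact.
  (* Two steps of length at most [e / 2], from [x] to a rational centre and on to [y], stay in the
     [e]-ball around [x]. *)
  have [n /ltW ne] : exists n : nat, n.+1%:R^-1 < e / 2.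
    exists (Num.truncn (e / 2)^-1); rewrite invf_plt ?posrE ?ltr0n//; last by rewrite divr_gt0.
    exact: truncnS_gt.
  have ex_q (t : R) : exists q : rat, ball (ratr q : R) n.+1%:R^-1 t.
    have /rat_in_itvoo[q] : t - n.+1%:R^-1 < t + n.+1%:R^-1.
      by rewrite ltrD2l gtrN// invr_gt0 ltr0n.
    rewrite in_itv /= => /andP[q1 q2]; exists q.
    move: q1 q2; rewrite /ball /= ltr_norml; move: (_^-1) => r q1 q2.
    by apply/andP; split; lra.
  have [q1 h1] := ex_q x.1; have [q2 h2] := ex_q x.2.
  exists (q1, q2, n); last by split.
  move=> y [/= y1 y2]; apply: eU; split => /=.
    by apply: (@le_ball _ _ _ (n.+1%:R^-1 + n.+1%:R^-1)); [by rewrite [leRHS]splitr lerD|apply: ball_triangle y1; exact: ball_sym].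
  by apply: (@le_ball _ _ _ (n.+1%:R^-1 + n.+1%:R^-1)); [by rewrite [leRHS]splitr lerD|apply: ball_triangle y2; exact: ball_sym].
rewrite bigcup_mkcond; apply: countable_bigcupT_measurable => // i.
case: ifP => // _; apply: measurableX; apply: open_measurable; exact: ball_open.
Qed.

Lemma continuous_measurable2 phi : continuous phi -> measurable_fun setT phi.
Proof.
move=> /continuousP cphi; apply: (measurability _ (RGenOInfty.measurableE R)).
move=> _ [_ [a ->] <-]; rewrite setTI.
by apply: open_prod_measurable; apply: cphi; exact: rray_open.
Qed.

Lemma leb2X (A B : set R) : measurable A -> measurable B ->
  (mu (A `*` B) = @lebesgue_measure R A * @lebesgue_measure R B)%E.
Proof.
exact: (@product_measure1E _ _ _ _ R (@lebesgue_measure R) (@lebesgue_measure R) A B).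
Qed.

Lemma lebesgue_measure_itv_lty (a b : R) b0 b1 :
  (@lebesgue_measure R [set` Interval (BSide b0 a) (BSide b1 b)] < +oo)%E.
Proof. by rewrite lebesgue_measure_itv /=; case: ifP => // _; rewrite -EFinB ltry. Qed.

Lemma continuous_offbox_rint phi (M : R) : continuous phi ->
  (forall x, offbox M x -> phi x = 0) -> rint mu phi.
Proof.
move=> cphi phi0.
have mb : measurable (`[-M, M]%classic `*` `[-M, M]%classic : set (R * R)).
  by apply: measurableX; exact: measurable_itv.
have mphi := continuous_measurable2 cphi.
pose K : set (R * R) := `[-M, M]%classic `*` `[-M, M]%classic.
have lt : (mu K < +oo)%E.
  rewrite leb2X//; try exact: measurable_itv.
  by rewrite lte_mul_pinfty// ?ge0_fin_numE//; exact: lebesgue_measure_itv_lty.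
have : mu.-integrable (`[-M, M]%classic `*` `[-M, M]%classic) (EFin \o phi).
  apply: measurable_bounded_integrable => //.
  - exact: measurable_funS mphi.
  - have : compact (phi @` (`[-M, M]%classic `*` `[-M, M]%classic)).
      apply: continuous_compact; last exact: compact_box.
      exact: continuous_subspaceT.
    move=> /compact_bounded [N [Nr HN]]; exists N; split => // n Nn x bx.
    by apply: HN => //; exists x.
move=> ik; have [+ _] := @integrable_mkcond _ _ R mu K (EFin \o phi) mb.
move=> /(_ ik); rewrite /rint; congr (integrable _ _ _).
apply/funext => x; rewrite /patch; case: ifPn => // /negP nx.
by rewrite /= phi0//; apply: contrapT => h; apply: nx; apply/mem_set/not_offbox.
Qed.

Lemma Rintegral_derive0 (f F : R -> R) (M : R) :
  (forall t : R, is_derive t (1 : R) F (f t)) -> continuous f ->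
  (forall t, M < `|t| -> F t = 0) -> (forall t, M < `|t| -> f t = 0) ->
  (\int[lebesgue_measure]_t (f t)%:E = 0)%E.
Proof.
move=> dF cf F0 f0.
(* [M] may be negative, whereas the interval of integration needs a positive radius. *)
have [M' MM' M'0] : exists2 M', M < M' & 0 < M'.
  by exists (`|M| + 1); [have := ler_norm M; lra|have := normr_ge0 M; lra].
have lt' : - M' < M' by lra.
have := @continuous_FTC2 R f F (- M') M' lt' _ _ _.
rewrite (F0 M') ?ger0_norm ?(ltW M'0)// (F0 (- M')) ?normrN ?ger0_norm ?(ltW M'0)//.
rewrite subee// => <-; last first.
- by move=> t _; exact: der_derive1.
- split.
  + by move=> t _; have [] := dF t.
  + by apply: cvg_at_right_filter; exact: der_continuous.
  + by apply: cvg_at_left_filter; exact: der_continuous.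
- exact: continuous_subspaceT.
rewrite [RHS]integral_mkcond; apply: eq_integral => t _.
rewrite /patch; case: ifPn => // /negP nt; rewrite f0//.
rewrite ltNge; apply/negP => h; apply: nt; apply/mem_set; rewrite /= in_itv /= -ler_norml.
by apply: le_trans h _; exact: ltW.
Qed.

Lemma continuous_slice1 phi (b : R) : continuous phi -> continuous (fun t => phi (t, b)).
Proof.
move=> cphi t; apply: (@continuous_comp _ _ _ (fun t : R => (t, b)) phi); last exact: cphi.
by apply: (@cvg_pair _ _ _ _ (nbhs t) (nbhs b)); [exact: cvg_id|exact: cvg_cst].
Qed.

Lemma continuous_slice2 phi (a : R) : continuous phi -> continuous (fun t => phi (a, t)).
Proof.
move=> cphi t; apply: (@continuous_comp _ _ _ (fun t : R => (a, t)) phi); last exact: cphi.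
by apply: (@cvg_pair _ _ _ _ (nbhs a) (nbhs t)); [exact: cvg_cst|exact: cvg_id].
Qed.

(** Fubini with the variable of differentiation innermost: every slice already integrates to 0. *)
Lemma Rintegral_dir1_0 F g (M : R) : continuous g ->
  (forall x, is_derive x (@dir1 R) F (g x)) ->
  (forall x, offbox M x -> F x = 0) -> (forall x, offbox M x -> g x = 0) ->
  \int[mu]_x g x = 0.
Proof.
move=> cg dF F0 g0; have ig := continuous_offbox_rint cg g0.
rewrite /Rintegral /leb2 -(integral21_prod_meas1 ig) /fubini_G.
rewrite integral0_eq// => b _ /=.
apply: (Rintegral_derive0 (F := fun t => F (t, b)) (M := M)).
- by move=> t; exact: (is_derive_dir1 F (t, b) (g (t, b))).1.
- exact: continuous_slice1.
- by move=> t Mt; apply: F0; left.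
- by move=> t Mt; apply: g0; left.
Qed.

Lemma Rintegral_dir2_0 F g (M : R) : continuous g ->
  (forall x, is_derive x (@dir2 R) F (g x)) ->
  (forall x, offbox M x -> F x = 0) -> (forall x, offbox M x -> g x = 0) ->
  \int[mu]_x g x = 0.
Proof.
move=> cg dF F0 g0; have ig := continuous_offbox_rint cg g0.
rewrite /Rintegral /leb2 -(integral12_prod_meas1 ig) /fubini_F.
rewrite integral0_eq// => a _ /=.
apply: (Rintegral_derive0 (F := fun t => F (a, t)) (M := M)).
- by move=> t; exact: (is_derive_dir2 F (a, t) (g (a, t))).1.
- exact: continuous_slice2.
- by move=> t Mt; apply: F0; right.
- by move=> t Mt; apply: g0; right.
Qed.

End PlaneCalculus.

(** * Integration by parts and weak derivatives *)

Section Weak.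
Context {R : realType}.
Implicit Types (phi F g : R * R -> R) (p q : R -> R) (v w d : R * R -> R[i]).
Local Notation mu := (@leb2 R).

Lemma cintE (h : R * R -> R[i]) : cint h = cI mu h. Proof. by []. Qed.

Lemma open_offbox (M : R) : open (offbox M).
Proof.
have -> : offbox M = ((fun x => `|x.1|) @^-1` [set y | M < y]) `|`
   ((fun x => `|x.2|) @^-1` [set y | M < y]) :> set (R * R) by [].
apply: openU; apply: open_comp => [x _|]; try exact: open_gt.
- by apply: continuous_comp; [exact: cvg_fst|exact: norm_continuous].
- by apply: continuous_comp; [exact: cvg_snd|exact: norm_continuous].
Qed.

Lemma derive_offbox (e : R * R) phi (M : R) : (forall x, offbox M x -> phi x = 0) ->
  forall x, offbox M x -> 'D_e phi x = 0.
Proof.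
move=> phi0 x ob; rewrite -(derive_cst (0 : R) x e).
apply: near_eq_derive.
have : nbhs x (offbox M) by apply: open_nbhs_nbhs; split => //; exact: open_offbox.
by apply: filterS => y oy; rewrite phi0.
Qed.

(** The only property of a direction that integration by parts uses; stated abstractly, it serves
    both coordinates at once. *)
Definition zero_flux (e : R * R) := forall F g (M : R), continuous g ->
  (forall x, is_derive x e F (g x)) ->
  (forall x, offbox M x -> F x = 0) -> (forall x, offbox M x -> g x = 0) ->
  \int[mu]_x g x = 0.

Definition ccont v := continuous (fun x => Rec (v x)) /\ continuous (fun x => Imc (v x)).

Definition cpart (e : R * R) v d := forall x,
  is_derive x e (fun x => Rec (v x)) (Rec (d x)) /\
  is_derive x e (fun x => Imc (v x)) (Imc (d x)).

Lemma parts_real (e : R * R) (a a' : R * R -> R) phi (M : R) : zero_flux e ->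
  continuous a -> continuous a' -> (forall x, is_derive x e a (a' x)) ->
  continuous phi -> continuous ('D_e phi) -> (forall x, derivable phi x e) ->
  (forall x, offbox M x -> phi x = 0) ->
  \int[mu]_x (a x * 'D_e phi x) = - \int[mu]_x (a' x * phi x).
Proof.
move=> zf ca ca' da cphi cDphi dphi phi0.
have Dphi0 := derive_offbox e phi0.
have cM (f g : R * R -> R) : continuous f -> continuous g -> continuous (fun x => f x * g x).
  by move=> cf cg x; apply: cvgM; [exact: cf|exact: cg].
have i1 : rint mu (fun x => a x * 'D_e phi x).
  by apply: (@continuous_offbox_rint _ _ M); [exact: cM|move=> x /Dphi0 ->; rewrite mulr0].
have i2 : rint mu (fun x => a' x * phi x).
  by apply: (@continuous_offbox_rint _ _ M); [exact: cM|move=> x /phi0 ->; rewrite mulr0].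
apply/eqP; rewrite -subr_eq0 opprK -RintegralD//; apply/eqP.
apply: (zf (fun x => a x * phi x) _ M).
- by move=> x; apply: cvgD; [apply: (cM _ _ ca cDphi)|apply: (cM _ _ ca' cphi)].
- move=> x; have dp : is_derive x e phi ('D_e phi x) by split.
  apply: (is_derive_eq (is_deriveM (da x) dp)).
  by rewrite /GRing.scale /= [phi x * _]mulrC.
- by move=> x /phi0 ->; rewrite mulr0.
- by move=> x ox; rewrite Dphi0// phi0// !mulr0 addr0.
Qed.

Lemma weak_partial_C1 (e : R * R) v d : zero_flux e ->
  (forall phi, test_function phi ->
    continuous ('D_e phi) /\ (forall x, derivable phi x e)) ->
  ccont v -> ccont d -> cpart e v d -> weak_partial e v d.
Proof.
move=> zf te [cv1 cv2] [cd1 cd2] vd phi tphi.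
have [M phi0] := test_function_box tphi.
have [cD dphi] := te _ tphi.
have cphi : continuous phi by case: tphi => /(_ 0%N).
apply: ReIm_eq; rewrite !ReImE /= /re /im.
  under eq_Rintegral do rewrite RecM /= mulr0 subr0.
  under [in RHS]eq_Rintegral do rewrite RecM /= mulr0 subr0.
  by apply: (parts_real zf cv1 cd1 _ cphi cD dphi phi0) => x; case: (vd x).
under eq_Rintegral do rewrite ImcM /= mulr0 add0r.
under [in RHS]eq_Rintegral do rewrite ImcM /= mulr0 add0r.
by apply: (parts_real zf cv2 cd2 _ cphi cD dphi phi0) => x; case: (vd x).
Qed.

Lemma weak_partial1 v d : ccont v -> ccont d -> cpart (@dir1 R) v d ->
  weak_partial (@dir1 R) v d.
Proof.
apply: weak_partial_C1; first exact: Rintegral_dir1_0.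
by move=> phi [/(_ 1%N)[_ h _ h1 _] _]; split; [exact: h1|exact: h].
Qed.

Lemma weak_partial2 v d : ccont v -> ccont d -> cpart (@dir2 R) v d ->
  weak_partial (@dir2 R) v d.
Proof.
apply: weak_partial_C1; first exact: Rintegral_dir2_0.
by move=> phi [/(_ 1%N)[]].
Qed.

Definition vanish_outside p := exists M : R, forall t, M < `|t| -> p t = 0.

Lemma derive1_vanish p (c : R) (I : set R) : open I -> (forall t, I t -> p t = c) ->
  forall t, I t -> derive1 p t = 0.
Proof.
move=> oI p0 t It; rewrite derive1E -(derive_cst c t (1 : R)).
apply: near_eq_derive; have : nbhs t I by exact: open_nbhs_nbhs.
by apply: filterS => y Iy; rewrite p0.
Qed.

Lemma vanish_derive1 p : vanish_outside p -> vanish_outside (derive1 p).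
Proof.
move=> [M p0]; exists M; apply: (derive1_vanish _ p0).
have -> : (fun t => M < `|t|) = (@Num.norm R R) @^-1` [set y | M < y] :> set R by [].
by apply: open_comp => [x _|]; [exact: norm_continuous|exact: open_gt].
Qed.

Lemma vanish_both p q : vanish_outside p -> vanish_outside q ->
  exists M : R, (forall t, M < `|t| -> p t = 0) /\ (forall t, M < `|t| -> q t = 0).
Proof.
move=> [M p0] [M' q0]; exists (Num.max M M'); split => t; rewrite gt_max => /andP[h h'].
  exact: p0.
exact: q0.
Qed.

Lemma cL2_tens p q : continuous p -> continuous q ->
  vanish_outside p -> vanish_outside q -> cL2 mu (fun x => (tens p q x)%:C).
Proof.
move=> cp cq /vanish_both/[apply] -[M [p0 q0]].
have ct := continuous_tens cp cq.
split; last exact: (cL20 mu).1.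
apply: Lfun2P; first exact: continuous_measurable2.
apply: (@continuous_offbox_rint _ _ M).
  exact: continuous_sqr.
by move=> x [ob|ob]; rewrite /= /tens ?(p0 _ ob) ?(q0 _ ob) ?mul0r ?mulr0 expr0n.
Qed.

Lemma ccont_real phi : continuous phi -> ccont (fun x => (phi x)%:C).
Proof. by move=> cphi; split => //= x; exact: cvg_cst. Qed.

Lemma H1_tens p q : smooth p -> smooth q -> vanish_outside p -> vanish_outside q ->
  H1_grad (fun x => (tens p q x)%:C) (fun x => (tens (derive1 p) q x)%:C)
    (fun x => (tens p (derive1 q) x)%:C).
Proof.
move=> sp sq vp vq.
have cp := smooth_continuous sp; have cq := smooth_continuous sq.
have cp' := smooth_continuous (smooth_derive1 sp).
have cq' := smooth_continuous (smooth_derive1 sq).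
split.
- exact: cL2_tens.
- by apply: cL2_tens => //; exact: vanish_derive1.
- by apply: cL2_tens => //; exact: vanish_derive1.
- apply: weak_partial1; try by apply: ccont_real; exact: continuous_tens.
  by move=> x; split => /=; [exact: tens_derive1|exact: is_derive_cst].
- apply: weak_partial2; try by apply: ccont_real; exact: continuous_tens.
  by move=> x; split => /=; [exact: tens_derive2|exact: is_derive_cst].
Qed.

End Weak.

(* The library has no smooth cutoff; in the end [chi] is a rescaled [beta_1^+],
   and every test function is built from it. *)
Record smooth_step {R : realType} (chi : R -> R) : Prop := SmoothStep {
  step_smooth : smooth chi;
  step_left : forall t, t <= 0 -> chi t = 1;
  step_right : forall t, 1 <= t -> chi t = 0 }.

(** * Smooth bumps and the fundamental lemma on strips *)

Section Bump.
Context {R : realType} (chi : R -> R) (hchi : smooth_step chi).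
Implicit Types (p q : R -> R) (h : R * R -> R).
Local Notation mu := (@leb2 R).

Lemma continuous_bounded_itv p (a b : R) : continuous p ->
  exists2 B : R, 0 <= B & forall t, a <= t <= b -> `|p t| <= B.
Proof.
move=> cp; have : compact (p @` `[a, b]%classic).
  apply: continuous_compact; last exact: segment_compact.
  exact: continuous_subspaceT.
move=> /compact_bounded [N [Nr HN]]; exists (`|N| + 1) => //.
move=> t tab; apply: (HN (`|N| + 1)); first by have := ler_norm N; lra.
by exists t => //; rewrite /= in_itv.
Qed.

(** Between 0 and 1 the values of [chi] are unconstrained, and the bound comes from compactness; it
    need not be 1. *)
Lemma step_bounded : exists2 B : R, 1 <= B & forall t, `|chi t| <= B.
Proof.
have [B B0 HB] := continuous_bounded_itv 0 1 (smooth_continuous (step_smooth hchi)).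
exists (B + 1); first by rewrite lerDr.
move=> t; have [t0|t0] := leP t 0.
  by rewrite (step_left hchi)// normr1 lerDr.
have [t1|t1] := leP 1 t; first by rewrite (step_right hchi)// normr0 addr_ge0.
by rewrite (le_trans (HB _ _))// ?lerDl// (ltW t0) (ltW t1).
Qed.

Lemma step_derive_bounded : exists2 B : R, 0 <= B & forall t, `|derive1 chi t| <= B.
Proof.
have sc := step_smooth hchi.
have [B B0 HB] := continuous_bounded_itv 0 1 (smooth_continuous (smooth_derive1 sc)).
exists B => // t; have [t0|t0] := ltP t 0.
  rewrite (derive1_vanish (c := 1) (I := [set t | t < 0])) ?normr0//.
  by move=> s /= s0; rewrite (step_left hchi)// ltW.
have [t1|t1] := ltP 1 t; last by apply: HB; rewrite t0 t1.
rewrite (derive1_vanish (c := 0) (I := [set t | 1 < t])) ?normr0//.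
by move=> s /= s0; rewrite (step_right hchi)// ltW.
Qed.

(** With [N = n.+1], each factor descends from 1 to 0 between distances [2 / N] and [1 / N] from one
    end. The support keeps a positive distance from both ends, so that derivatives vanish near them
    too. *)
Definition bump (n : nat) (a b t : R) : R :=
  chi (n.+1%:R * t + (2 - n.+1%:R * b)) * chi (- n.+1%:R * t + (2 + n.+1%:R * a)).

Lemma smooth_bump n a b : smooth (bump n a b).
Proof. by apply: smooth_mul; apply: smooth_affine; exact: step_smooth. Qed.

Lemma bump_out n a b t : t <= a + n.+1%:R^-1 \/ b - n.+1%:R^-1 <= t -> bump n a b t = 0.
Proof.
have n0 : 0 < n.+1%:R :> R by rewrite ltr0n.
rewrite /bump => -[h|h].
  rewrite (step_right hchi (t := - _ * _ + _)) ?mulr0//.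
  have : n.+1%:R * t <= n.+1%:R * a + 1.
    by rewrite -[X in _ + X](mulfV (lt0r_neq0 n0)) -mulrDr ler_pM2l.
  by move: (n.+1%:R * a) => u; rewrite mulNr; lra.
rewrite (step_right hchi) ?mul0r//.
have : n.+1%:R * b - 1 <= n.+1%:R * t.
  by rewrite -[X in _ - X](mulfV (lt0r_neq0 n0)) -mulrBr ler_pM2l.
by move: (n.+1%:R * b) => u; lra.
Qed.

Lemma bump_cvg a b t : bump n a b t @[n --> \oo] --> (\1_(`]a, b[%classic) t : R).
Proof.
rewrite indicE; have [tab|tab] := boolP (t \in `]a, b[%classic); last first.
  apply: cvg_near_cst; apply: nearW => n /=; apply: bump_out.
  have n0 : 0 < n.+1%:R^-1 :> R by rewrite invr_gt0 ltr0n.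
  move: n0; move: (n.+1%:R^-1) => r n0.
  apply: contrapT => /not_orP[/negP + /negP]; rewrite -!ltNge => h1 h2.
  by move/negP: tab; apply; apply/mem_set; rewrite /= in_itv/=; apply/andP; split; lra.
move/set_mem: tab; rewrite /= in_itv/= => /andP[ta tb].
apply: cvg_near_cst; near=> n.
rewrite /bump !(step_left hchi) ?mulr1//.
  have : 2 / (t - a) <= n.+1%:R.
    apply: le_trans (_ : n%:R <= _); last by rewrite ler_nat.
    by near: n; exact: nbhs_infty_ger.
  by rewrite ler_pdivrMr ?subr_gt0//; move: (n.+1%:R) => u; lra.
have : 2 / (b - t) <= n.+1%:R.
  apply: le_trans (_ : n%:R <= _); last by rewrite ler_nat.
  by near: n; exact: nbhs_infty_ger.
by rewrite ler_pdivrMr ?subr_gt0//; move: (n.+1%:R) => u; lra.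
Unshelve. all: by end_near. Qed.

Lemma bump_le : exists2 B : R, 1 <= B &
  forall n a b t, `|bump n a b t| <= B * \1_(`]a, b[%classic) t.
Proof.
have [B B1 HB] := step_bounded; exists (B * B).
  by rewrite -[1]mulr1 ler_pM.
move=> n a b t; rewrite indicE; have [tab|tab] := boolP (t \in `]a, b[%classic).
  by rewrite mulr1 /bump normrM ler_pM.
rewrite bump_out ?normr0 ?mulr0//.
have n0 : 0 < n.+1%:R^-1 :> R by rewrite invr_gt0 ltr0n.
move: n0; move: (n.+1%:R^-1) => r n0.
apply: contrapT => /not_orP[/negP + /negP]; rewrite -!ltNge => h1 h2.
by move/negP: tab; apply; apply/mem_set; rewrite /= in_itv/=; apply/andP; split; lra.
Qed.

Lemma bump_vanish n a b : vanish_outside (bump n a b).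
Proof.
exists (`|a| + `|b|) => t ht; apply: bump_out.
have n0 : 0 < n.+1%:R^-1 :> R by rewrite invr_gt0 ltr0n.
move: n0; move: (n.+1%:R^-1) => r n0.
move: ht; have := ler_norm b; have := ler_norm (- a); rewrite normrN.
have := normr_ge0 a; have := normr_ge0 b.
by case: (ger0P t) => t0 *; [right|left]; lra.
Qed.

Lemma Lfun2_indic_rect a b c d :
  (fun x : R * R => \1_(rect a b c d) x) \in Lfun mu 2%:E.
Proof.
have mr := measurable_rect a b c d.
have lt : (mu (rect a b c d) < +oo)%E.
  rewrite leb2X//; try exact: measurable_itv.
  by rewrite lte_mul_pinfty// ?ge0_fin_numE//; exact: lebesgue_measure_itv_lty.
apply: Lfun2P; first exact: measurable_indic.
rewrite (_ : (fun x => _) = \1_(rect a b c d)).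
  apply/integrableP; split; first exact/measurable_EFinP/measurable_indic.
  apply: le_lt_trans lt; rewrite le_eqVlt; apply/orP; left; apply/eqP.
  transitivity (\int[mu]_x (\1_(rect a b c d) x)%:E)%E.
    by apply: eq_integral => x _; rewrite gee0_abs// lee_fin indicE.
  by rewrite integral_indic// setIT.
by apply/funext => x; rewrite indicE; case: (_ \in _); rewrite ?expr1n ?expr0n.
Qed.

Lemma indic_rect (a b c d : R) x :
  \1_(rect a b c d) x = \1_(`]a, b[%classic) x.1 * \1_(`]c, d[%classic) x.2 :> R.
Proof.
rewrite !indicE; have -> : (x \in rect a b c d) = (x.1 \in `]a, b[%classic) && (x.2 \in `]c, d[%classic).
  by apply/idP/andP => [|[]]; rewrite !inE => // -[].
by rewrite -natrM mulnb.
Qed.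

(** The bumps converge pointwise to the indicator of the rectangle and are dominated by a multiple
    of it, which pairs with [h] in L^2. *)
Lemma fund_rect h (a b c d : R) : h \in Lfun mu 2%:E ->
  (forall n, \int[mu]_x (h x * tens (bump n a b) (bump n c d) x) = 0) ->
  \int[mu]_(x in rect a b c d) h x = 0.
Proof.
move=> ih h0; have mr := measurable_rect a b c d.
have [B B1 HB] := bump_le.
have mh := Lfun2_meas ih.
have cv : (\int[mu]_x (h x * tens (bump n a b) (bump n c d) x))%R @[n --> \oo] -->
    \int[mu]_x (h x * \1_(rect a b c d) x).
  apply: (@real_dct _ _ _ mu _ _ (fun x => B * B * (`|h x| * \1_(rect a b c d) x))).
  - move=> n; apply: measurable_funM => //; apply: continuous_measurable2.
    by apply: continuous_tens; apply: smooth_continuous; exact: smooth_bump.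
  - by apply: measurable_funM => //; exact: measurable_indic.
  - move=> x; apply: cvgM; first exact: cvg_cst.
    by rewrite indic_rect; apply: cvgM; exact: bump_cvg.
  - move=> n x; rewrite /tens normrM [X in _ * X <= _]normrM indic_rect.
    have h1 := ler_pM (normr_ge0 _) (normr_ge0 _) (HB n a b x.1) (HB n c d x.2).
    apply: le_trans (ler_wpM2l (normr_ge0 (h x)) h1) _.
    by rewrite le_eqVlt; apply/orP; left; apply/eqP; ring.
  - apply: rintZ; apply: Lfun2_mul_integrable; first exact: Lfun2_norm.
    exact: Lfun2_indic_rect.
have e : (fun n => \int[mu]_x (h x * tens (bump n a b) (bump n c d) x)) = fun=> 0.
  by apply/funext => n.
rewrite e in cv; rewrite Rintegral_mkcond.
have := cvg_unique _ cv (cvg_cst 0); move=> <- //.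
apply: eq_Rintegral => x _; rewrite /patch indicE.
by case: ifP => _; rewrite ?mulr1 ?mulr0.
Qed.

Lemma rect_setI (a b c d a' b' c' d' : R) : rect a b c d `&` rect a' b' c' d' =
  rect (Num.max a a') (Num.min b b') (Num.max c c') (Num.min d d').
Proof.
apply/seteqP; split => -[x y]; rewrite /rect /= !in_itv /= !gt_max !lt_min.
  by move=> [[/andP[-> ->] /andP[-> ->]] [/andP[-> ->] /andP[-> ->]]].
by move=> [/andP[/andP[-> ->] /andP[-> ->]] /andP[/andP[-> ->] /andP[-> ->]]].
Qed.

(** A square-integrable function is integrable only on sets of finite measure: the strip is cut at
    height [N] before [rect_ae0] applies, and [N] ranges over a countable set. *)
Lemma rect_ae0_strip h (a b : R) : h \in Lfun mu 2%:E ->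
  (forall a' b' c d, a <= a' -> b' <= b -> \int[mu]_(x in rect a' b' c d) h x = 0) ->
  {ae mu, forall x, a < x.1 < b -> h x = 0}.
Proof.
move=> ih h0.
have hN : forall N : nat, {ae mu, forall x, (h \_ (rect a b (- N%:R) N%:R)) x = 0}.
  move=> N; apply: rect_ae0.
    rewrite (_ : _ \_ _ = fun x => h x * \1_(rect a b (- N%:R) N%:R) x).
      by apply: Lfun2_mul_integrable => //; exact: Lfun2_indic_rect.
    by apply/funext => x; rewrite /patch indicE; case: ifP => _; rewrite ?mulr1 ?mulr0.
  move=> a' b' c d; rewrite -Rintegral_mkcondr rect_setI; apply: h0.
    by rewrite le_max lexx orbT.
  by rewrite ge_min lexx orbT.
have := ae_foralln hN; apply: filterS => x hx /andP[xa xb].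
pose N := (Num.truncn `|x.2|).+1.
have := hx N; rewrite patchE mem_set//; split => /=; rewrite in_itv /=; first by rewrite xa xb.
by rewrite -ltr_norml; exact: truncnS_gt.
Qed.

(** Fundamental lemma of the calculus of variations on a vertical strip. Only tensor products whose
    first factor vanishes near both ends are tested; this margin makes locality arguments
    possible. *)
Lemma fund_strip h (a b : R) : h \in Lfun mu 2%:E ->
  (forall p q, smooth p -> smooth q -> vanish_outside p -> vanish_outside q ->
    (exists2 e, 0 < e & forall t, t <= a + e \/ b - e <= t -> p t = 0) ->
    \int[mu]_x (h x * tens p q x) = 0) ->
  {ae mu, forall x, a < x.1 < b -> h x = 0}.
Proof.
move=> ih h0; apply: rect_ae0_strip => // a' b' c d aa bb.
apply: fund_rect => // n; apply: h0; try exact: smooth_bump; try exact: bump_vanish.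
exists n.+1%:R^-1; first by rewrite invr_gt0 ltr0n.
move=> t ht; apply: bump_out; move: ht; move: (n.+1%:R^-1) => r.
by case=> ht; [left|right]; lra.
Qed.

Lemma cfund_strip (h : R * R -> R[i]) (a b : R) : cL2 mu h ->
  (forall p q, smooth p -> smooth q -> vanish_outside p -> vanish_outside q ->
    (exists2 e, 0 < e & forall t, t <= a + e \/ b - e <= t -> p t = 0) ->
    cint (fun x => h x * (tens p q x)%:C) = 0) ->
  {ae mu, forall x, a < x.1 < b -> h x = 0}.
Proof.
move=> [i1 i2] h0.
have H1 : {ae mu, forall x, a < x.1 < b -> Rec (h x) = 0}.
  apply: fund_strip => // p q sp sq vp vq pe.
  have := congr1 (@Rec R) (h0 p q sp sq vp vq pe); rewrite /= /re => <-.
  by apply: eq_Rintegral => x _; rewrite RecM /= mulr0 subr0.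
have H2 : {ae mu, forall x, a < x.1 < b -> Imc (h x) = 0}.
  apply: fund_strip => // p q sp sq vp vq pe.
  have := congr1 (@Imc R) (h0 p q sp sq vp vq pe); rewrite /= /im => <-.
  by apply: eq_Rintegral => x _; rewrite ImcM /= mulr0 add0r.
by apply: ae_imply2 H1 H2 => x e1 e2 hx; apply: ReIm_eq; rewrite ?e1 ?e2.
Qed.

End Bump.

(** * The PML operator *)

Section Coefficients.
Context {R : realType}.
Implicit Types (s : R -> R) (v w g d : R * R -> R[i]).
Local Notation mu := (@leb2 R).

Lemma ccont_cmeas v : ccont v -> cmeas v.
Proof. by move=> [c1 c2]; split; exact: continuous_measurable2. Qed.

Lemma ccontM v w : ccont v -> ccont w -> ccont (fun x => v x * w x).
Proof.
move=> [v1 v2] [w1 w2]; split.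
  rewrite (_ : (fun x => _) = fun x => Rec (v x) * Rec (w x) - Imc (v x) * Imc (w x)).
    by move=> x; apply: cvgB; apply: cvgM; [exact: v1|exact: w1|exact: v2|exact: w2].
  by apply/funext => x; rewrite RecM.
rewrite (_ : (fun x => _) = fun x => Rec (v x) * Imc (w x) + Imc (v x) * Rec (w x)).
  by move=> x; apply: cvgD; apply: cvgM; [exact: v1|exact: w2|exact: v2|exact: w1].
by apply/funext => x; rewrite ImcM.
Qed.

Definition absorbing (s0 : R) s := continuous s /\ forall t, 0 <= s t <= s0.

Lemma sqr1_gt0 (t : R) : 0 < 1 + t ^+ 2.
Proof. by have := sqr_ge0 t; lra. Qed.

Lemma alpha_neq0 s t : alpha s t != 0.
Proof. by rewrite eq_complex /= oner_eq0. Qed.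

Lemma alphaV s t :
  (alpha s t)^-1 = (1 + s t ^+ 2)^-1 +i* - (s t / (1 + s t ^+ 2)).
Proof.
have h := lt0r_neq0 (sqr1_gt0 (s t)).
apply: (mulIf (alpha_neq0 s t)); rewrite mulVf ?alpha_neq0//.
by apply: ReIm_eq; rewrite !ReImE /=; field.
Qed.

Lemma nrm_alpha (s0 : R) s t : absorbing s0 s -> nrm (alpha s t) <= 1 + s0.
Proof.
by move=> [_ /(_ t)/andP[h0 h1]]; rewrite /nrm /= normr1 ger0_norm// lerD2l.
Qed.

Lemma nrm_alphaV (s0 : R) s t : absorbing s0 s -> nrm (alpha s t)^-1 <= 2.
Proof.
move=> [_ /(_ t)/andP[h0 h1]]; have hp := sqr1_gt0 (s t).
rewrite alphaV /nrm /= normrN !ger0_norm ?divr_ge0 ?invr_ge0 ?(ltW hp)//.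
(* What remains is [1 + s <= 2 (1 + s^2)], which holds uniformly in the absorption. *)
rewrite -[X in X + _]mul1r -mulrDl ler_pdivrMr//.
by have := sqr_ge0 (s t - 1); rewrite expr2; have := sqr_ge0 (s t); rewrite expr2; nra.
Qed.

Lemma ccont_fst (a b : R -> R) : continuous a -> continuous b ->
  ccont (fun x => a x.1 +i* b x.1).
Proof.
move=> ca cb; split => x /=.
  by apply: continuous_comp; [exact: cvg_fst|exact: ca].
by apply: continuous_comp; [exact: cvg_fst|exact: cb].
Qed.

Lemma ccont_snd (a b : R -> R) : continuous a -> continuous b ->
  ccont (fun x => a x.2 +i* b x.2).
Proof.
move=> ca cb; split => x /=.
  by apply: continuous_comp; [exact: cvg_snd|exact: ca].
by apply: continuous_comp; [exact: cvg_snd|exact: cb].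
Qed.

Lemma continuous_cst1 : continuous (fun _ : R => 1 : R).
Proof. by move=> x; exact: cvg_cst. Qed.

Lemma continuous_alphaV s : continuous s ->
  continuous (fun t => (1 + s t ^+ 2)^-1) /\
  continuous (fun t => - (s t / (1 + s t ^+ 2))).
Proof.
move=> cs.
have c1 : continuous (fun t => (1 + s t ^+ 2)^-1).
  move=> t; apply: cvgV; first exact: lt0r_neq0 (sqr1_gt0 _).
  apply: cvgD; first exact: cvg_cst.
  exact: continuous_sqr.
split => // t; apply: cvgN; apply: cvgM; [exact: cs|exact: c1].
Qed.

Lemma ccont_A11 s1 s2 : continuous s1 -> continuous s2 -> ccont (A11 s1 s2).
Proof.
move=> c1 c2; apply: ccontM; first exact: (ccont_snd continuous_cst1 c2).
have [i1 i2] := continuous_alphaV c1.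
have := ccont_fst i1 i2; congr ccont; apply/funext => x; exact/esym/alphaV.
Qed.

Lemma ccont_A22 s1 s2 : continuous s1 -> continuous s2 -> ccont (A22 s1 s2).
Proof.
move=> c1 c2; apply: ccontM; first exact: (ccont_fst continuous_cst1 c1).
have [i1 i2] := continuous_alphaV c2.
have := ccont_snd i1 i2; congr ccont; apply/funext => x; exact/esym/alphaV.
Qed.

Lemma ccont_J s1 s2 : continuous s1 -> continuous s2 -> ccont (J s1 s2).
Proof.
move=> c1 c2; apply: ccontM; first exact: (ccont_fst continuous_cst1 c1).
exact: (ccont_snd continuous_cst1 c2).
Qed.

Lemma J_neq0 s1 s2 x : J s1 s2 x != 0.
Proof. by rewrite mulf_neq0 ?alpha_neq0. Qed.

End Coefficients.

(** * Linearity and locality of the weak equation *)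

Section PMLEquation.
Context {R : realType} (chi : R -> R) (hchi : smooth_step chi).
Variables (k s0 : R) (s1 s2 : R -> R).
Hypotheses (hs1 : absorbing s0 s1) (hs2 : absorbing s0 s2).
Implicit Types (v w g d : R * R -> R[i]).
Local Notation mu := (@leb2 R).

Let c1 : continuous s1 := hs1.1.
Let c2 : continuous s2 := hs2.1.

Let s0_ge0 : 0 <= s0.
Proof. by have /andP[] := hs1.2 0; exact: le_trans. Qed.

Lemma cL2_A11 d : cL2 mu d -> cL2 mu (fun x => A11 s1 s2 x * d x).
Proof.
apply: (cL2M (c := (1 + s0) * 2)); first exact/ccont_cmeas/ccont_A11.
move=> x; apply: le_trans (nrmM _ _) _; apply: ler_pM; try exact: nrm_ge0.
  exact: nrm_alpha.
exact: nrm_alphaV hs1.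
Qed.

Lemma cL2_A22 d : cL2 mu d -> cL2 mu (fun x => A22 s1 s2 x * d x).
Proof.
apply: (cL2M (c := (1 + s0) * 2)); first exact/ccont_cmeas/ccont_A22.
move=> x; apply: le_trans (nrmM _ _) _; apply: ler_pM; try exact: nrm_ge0.
  exact: nrm_alpha.
exact: nrm_alphaV hs2.
Qed.

Lemma cL2_J d : cL2 mu d -> cL2 mu (fun x => J s1 s2 x * d x).
Proof.
apply: (cL2M (c := (1 + s0) * (1 + s0))); first exact/ccont_cmeas/ccont_J.
move=> x; apply: le_trans (nrmM _ _) _; apply: ler_pM; try exact: nrm_ge0.
  exact: nrm_alpha.
exact: nrm_alpha.
Qed.

Lemma cL2_offbox v (M : R) : ccont v -> (forall x, offbox M x -> v x = 0) -> cL2 mu v.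
Proof.
move=> [cv1 cv2] v0.
have H (f : R * R -> R) : continuous f -> (forall x, offbox M x -> f x = 0) -> f \in Lfun mu 2%:E.
  move=> cf f0; apply: Lfun2P; first exact: continuous_measurable2.
  apply: (@continuous_offbox_rint _ _ M).
    exact: continuous_sqr.
  by move=> x /f0 ->; rewrite expr0n.
by split; apply: H => // x /v0 ->.
Qed.

Lemma cL2_test phi (e : R * R) : (e = (@dir1 R) \/ e = (@dir2 R)) -> test_function phi ->
  cL2 mu (fun x => (phi x)%:C) /\ cL2 mu (fun x => ('D_e phi x)%:C).
Proof.
move=> he tphi; have [M phi0] := test_function_box tphi.
have [cphi _ _ cD1 cD2] := tphi.1 1%N.
split; apply: (cL2_offbox (M := M)).
- exact: ccont_real.
- by move=> x /phi0 ->.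
- by apply: ccont_real; case: he => ->.
- by move=> x ob; rewrite (derive_offbox e phi0).
Qed.

Lemma weak_partial_lin (c : R[i]) (e : R * R) w w' d d' :
  (e = (@dir1 R) \/ e = (@dir2 R)) ->
  cL2 mu w -> cL2 mu w' -> cL2 mu d -> cL2 mu d' ->
  weak_partial e w d -> weak_partial e w' d' ->
  weak_partial e (fun x => w x + c * w' x) (fun x => d x + c * d' x).
Proof.
move=> he iw iw' id id' wd wd' phi tphi.
have [i1 i2] := cL2_test he tphi.
have E (a b p : R * R -> R[i]) : cL2 mu a -> cL2 mu b -> cL2 mu p ->
    cint (fun x => (a x + c * b x) * p x) =
    cint (fun x => a x * p x) + c * cint (fun x => b x * p x).
  move=> ia ib ip; rewrite !cintE -cIZ; last exact: cL2_mul.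
  rewrite -cID; [|exact: cL2_mul|by apply: cableZ; exact: cL2_mul].
  by apply: cI_eq => x; rewrite mulrDl mulrA.
by rewrite !E// wd// wd'// mulrN opprD.
Qed.

Lemma H1_lin (c : R[i]) w w' d1 d1' d2 d2' :
  H1_grad w d1 d2 -> H1_grad w' d1' d2' ->
  H1_grad (fun x => w x + c * w' x) (fun x => d1 x + c * d1' x)
    (fun x => d2 x + c * d2' x).
Proof.
move=> [iw i1 i2 h1 h2] [iw' i1' i2' h1' h2'].
split; try by apply: cL2D => //; exact: cL2Z.
- by apply: weak_partial_lin => //; left.
- by apply: weak_partial_lin => //; right.
Qed.

Lemma cL2_lin (c : R[i]) w w' : cL2 mu w -> cL2 mu w' ->
  cL2 mu (fun x => w x + c * w' x).
Proof. by move=> iw iw'; apply: cL2D => //; exact: cL2Z. Qed.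

Lemma pml_eq_lin (c : R[i]) w w' g g' : pml_eq k s1 s2 w g -> pml_eq k s1 s2 w' g' ->
  pml_eq k s1 s2 (fun x => w x + c * w' x) (fun x => g x + c * g' x).
Proof.
move=> [ig [d1 [d2 [hw eqw]]]] [ig' [d1' [d2' [hw' eqw']]]].
split; first exact: cL2_lin.
exists (fun x => d1 x + c * d1' x), (fun x => d2 x + c * d2' x).
split; first exact: H1_lin.
move=> v e1 e2 hv.
have [iw i1 i2 _ _] := hw; have [iw' i1' i2' _ _] := hw'.
have [iv j1 j2 _ _] := hv.
have {}iv := cL2_conj iv; have {}j1 := cL2_conj j1; have {}j2 := cL2_conj j2.
have := eqw' _ _ _ hv; have := eqw _ _ _ hv; rewrite !cintE.
set a := cI _ _; set b := cI _ _; set r := cI _ _ => E.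
set a' := cI _ _; set b' := cI _ _; set r' := cI _ _ => E'.
have -> : cI mu (fun x => A11 s1 s2 x * (d1 x + c * d1' x) * (e1 x)^*
    + A22 s1 s2 x * (d2 x + c * d2' x) * (e2 x)^*) = a + c * a'.
  rewrite -cIZ -?cID.
  - by apply: cI_eq => x; ring.
  - by apply: cableD; apply: cL2_mul => //; [exact: cL2_A11|exact: cL2_A22].
  - apply: cableZ.
    by apply: cableD; apply: cL2_mul => //; [exact: cL2_A11|exact: cL2_A22].
  - by apply: cableD; apply: cL2_mul => //; [exact: cL2_A11|exact: cL2_A22].
have H (z z' : R * R -> R[i]) : cL2 mu z -> cL2 mu z' ->
    cI mu (fun x => J s1 s2 x * (z x + c * z' x) * (v x)^*) =
    cI mu (fun x => J s1 s2 x * z x * (v x)^*) +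
    c * cI mu (fun x => J s1 s2 x * z' x * (v x)^*).
  move=> iz iz'; have h := cL2_mul (cL2_J iz) iv; have h' := cL2_mul (cL2_J iz') iv.
  rewrite -cIZ// -?cID//; last exact: cableZ.
  by apply: cI_eq => x; ring.
rewrite !H// -/b -/b' -/r -/r'.
have -> : a + c * a' - (k ^+ 2)%:C * (b + c * b') =
  (a - (k ^+ 2)%:C * b) + c * (a' - (k ^+ 2)%:C * b') by ring.
by rewrite E E'; ring.
Qed.

Lemma pml_eq_ext w w' g g' : (forall x, w x = w' x) -> (forall x, g x = g' x) ->
  pml_eq k s1 s2 w g -> pml_eq k s1 s2 w' g'.
Proof. by move=> /funext -> /funext ->. Qed.

Lemma pml_eqD w w' g g' : pml_eq k s1 s2 w g -> pml_eq k s1 s2 w' g' ->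
  pml_eq k s1 s2 (fun x => w x + w' x) (fun x => g x + g' x).
Proof.
move=> h h'; apply: pml_eq_ext (pml_eq_lin 1 h h') => x; by rewrite mul1r.
Qed.

Lemma pml_eqB w w' g g' : pml_eq k s1 s2 w g -> pml_eq k s1 s2 w' g' ->
  pml_eq k s1 s2 (fun x => w x - w' x) (fun x => g x - g' x).
Proof.
move=> h h'; apply: pml_eq_ext (pml_eq_lin (-1) h h') => x; by rewrite mulN1r.
Qed.

Lemma derive1_gap (p : R -> R) (a b e : R) : 0 < e -> (forall t, t <= a + e \/ b - e <= t -> p t = 0) ->
  forall t, t <= a \/ b <= t -> derive1 p t = 0.
Proof.
move=> e0 p0 t [ta|tb].
  apply: (derive1_vanish (c := 0) (I := [set t | t < a + e])) => [|s /= sa|/=].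
  - exact: open_lt.
  - by apply: p0; left; exact: ltW.
  - by lra.
apply: (derive1_vanish (c := 0) (I := [set t | b - e < t])) => [|s /= sa|/=].
- exact: open_gt.
- by apply: p0; right; exact: ltW.
- by lra.
Qed.

(** For a test function supported inside the strip, [w] vanishes in the strip and the derivative of
    the test function vanishes off it, so that their product is identically 0. *)
Lemma weak_partial_local w d (e : R * R) (a b : R) :
  (e = (@dir1 R) \/ e = (@dir2 R)) -> cL2 mu d -> weak_partial e w d ->
  (forall x, a < x.1 < b -> w x = 0) ->
  {ae mu, forall x, a < x.1 < b -> d x = 0}.
Proof.
move=> he id wd w0; apply: (cfund_strip hchi) => // p q sp sq vp vq [r r0 pr].
have [M [p0 q0]] := vanish_both vp vq.
have tt := test_function_tens sp sq p0 q0.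
have := wd _ tt; move/(congr1 -%R); rewrite opprK => <-.
rewrite cintE (_ : (fun x => _) = fun=> 0) ?cI0 ?oppr0//.
apply/funext => x; have [xab|xab] := boolP (a < x.1 < b); first by rewrite w0// mul0r.
have xout : x.1 <= a \/ b <= x.1.
  by move: xab; rewrite negb_and -!leNgt => /orP.
suff -> : 'D_e (tens p q) x = 0 by rewrite mulr0.
case: he => ->.
  have [_ ->] := tens_derive1 q x sp.
  by rewrite /tens (derive1_gap r0 pr)// mul0r.
have [_ ->] := tens_derive2 p x sq.
by rewrite /tens pr ?mul0r//; case: xout => ?; [left|right]; lra.
Qed.

(* Restricted to the test functions supported in the strip, the weak form only
   sees the zero function. *)
Lemma pml_eq_local w g (a b : R) : pml_eq k s1 s2 w g ->
  (forall x, a < x.1 < b -> w x = 0) ->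
  {ae mu, forall x, a < x.1 < b -> g x = 0}.
Proof.
move=> [ig [d1 [d2 [[iw i1 i2 h1 h2] eqw]]]] w0.
have d10 := weak_partial_local (or_introl erefl) i1 h1 w0.
have d20 := weak_partial_local (or_intror erefl) i2 h2 w0.
suff : {ae mu, forall x, a < x.1 < b -> J s1 s2 x * g x = 0}.
  apply: ae_imply => x h /h /eqP; rewrite mulf_eq0 (negbTE (J_neq0 _ _ _)) /=.
  by move/eqP.
apply: (cfund_strip hchi); first exact: cL2_J.
move=> p q sp sq vp vq [r r0 pr].
have hv := H1_tens sp sq vp vq.
have [iv j1 j2 _ _] := hv.
have {}iv := cL2_conj iv; have {}j1 := cL2_conj j1; have {}j2 := cL2_conj j2.
have := eqw _ _ _ hv; rewrite !cintE.
have realC (y : R) : Num.conj (y%:C : R[i]) = y%:C by exact: conjc_real.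
have out (x : R * R) : ~~ (a < x.1 < b) -> x.1 <= a \/ b <= x.1.
  by rewrite negb_and -!leNgt => /orP.
rewrite cI_ae0; last first.
- apply: ae_imply2 d10 d20 => x; have [xab e1 e2|xab _ _] := boolP (a < x.1 < b).
    by rewrite e1// e2// !mulr0 !mul0r addr0.
  rewrite !realC /tens (derive1_gap r0 pr) ?pr ?mul0r ?mulr0 ?addr0//; last exact: out.
  by case: (out _ xab) => ?; [left|right]; lra.
- apply: cable_meas.
  by apply: cableD; [exact: cL2_mul (cL2_A11 i1) j1|exact: cL2_mul (cL2_A22 i2) j2].
rewrite (_ : cI mu (fun x => J s1 s2 x * w x * _) = 0); last first.
  rewrite (_ : (fun x => _) = fun=> 0) ?cI0//; apply/funext => x.
  have [xab|xab] := boolP (a < x.1 < b); first by rewrite w0// mulr0 mul0r.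
  rewrite /tens pr ?mul0r ?realC ?mulr0//.
  by case: (out _ xab) => ?; [left|right]; lra.
rewrite mulr0 subr0 => /(congr1 -%R); rewrite oppr0 opprK => ->.
by apply: cI_eq => x; rewrite realC.
Qed.

End PMLEquation.

(** * Test functions with quadratic decay *)

Section Envelope.
Context {R : realType}.
Local Notation leb := (@lebesgue_measure R).

(* The envelope dominating all the functions integrated over the line. *)
Definition env (t : R) : R := (1 + t ^+ 2)^-1.

Lemma env_gt0 t : 0 < env t.
Proof. by rewrite invr_gt0; have := sqr_ge0 t; lra. Qed.

Lemma env_le1 t : env t <= 1.
Proof. by rewrite invf_le1; have := sqr_ge0 t; lra. Qed.

Lemma continuous_env : continuous env.
Proof. exact: continuous_oneDsqrV. Qed.

Lemma measurable_env : measurable_fun setT env.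
Proof. exact: (continuous_measurable_fun continuous_env). Qed.

Lemma emeasurable_env : measurable_fun setT (fun t : R => (env t)%:E).
Proof. by have := measurable_env => /measurable_EFinP. Qed.

Lemma rint_env : rint leb env.
Proof.
have mE := emeasurable_env.
apply/integrableP; split => //.
under eq_integral do rewrite gee0_abs ?lee_fin ?(ltW (env_gt0 _))//.
rewrite ge0_symfun_integralT.
- have -> : [set x : R | 0 <= x] = `[0, +oo[%classic by rewrite set_itvcy.
  rewrite (_ : (\int[leb]_(x in _) _)%E = (pi / 2)%:E); first by rewrite -EFinM ltry.
  exact: integral0y_oneDsqr.
- by move=> x; exact/ltW/env_gt0.
- exact: continuous_env.
- by move=> x /=; rewrite /env sqrrN.
Qed.

Lemma Lfun2_env2 : (fun x : R * R => env x.1 * env x.2) \in Lfun leb2 2%:E.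
Proof.
have cE : continuous (fun x : R * R => env x.1 * env x.2).
  by apply: (continuous_tens (p := env) (q := env)); exact: continuous_env.
have mE := continuous_measurable2 cE.
apply: Lfun2P => //.
have m2 : measurable_fun setT (fun x : R * R => (env x.1 * env x.2) ^+ 2).
  by apply: continuous_measurable2; exact: continuous_sqr.
have : rint leb2 (fun x : R * R => env x.1 * env x.2).
  apply/(@integrable12ltyP _ _ _ _ R (@lebesgue_measure R) (@lebesgue_measure R)).
    exact/measurable_EFinP.
  have -> : (fun a : R => (\int[leb]_b `|(env (a, b).1 * env (a, b).2)%:E|)%E) =
      (fun a => ((env a)%:E * \int[leb]_b (env b)%:E)%E).
    apply/funext => a; rewrite -ge0_integralZl//.
    - by apply: eq_integral => b _ /=; rewrite ger0_norm// mulr_ge0// ltW// env_gt0.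
    - exact: emeasurable_env.
    - by move=> b _; rewrite lee_fin ltW// env_gt0.
    - by rewrite lee_fin ltW// env_gt0.
  have f1 : (\int[leb]_b (env b)%:E)%E \is a fin_num by apply: integrable_fin_num => //; exact: rint_env.
  rewrite -(fineK f1).
  rewrite ge0_integralZr//.
  - by rewrite -(fineK f1) -EFinM ltry.
  - exact: emeasurable_env.
  - by move=> b _; rewrite lee_fin ltW// env_gt0.
  - by rewrite lee_fin fine_ge0// integral_ge0// => b _; rewrite lee_fin ltW// env_gt0.
apply: le_integrable => //; first exact/measurable_EFinP.
move=> x _ /=; rewrite lee_fin.
have h1 := env_gt0 x.1; have h2 := env_gt0 x.2.
have l1 := env_le1 x.1; have l2 := env_le1 x.2.
rewrite !ger0_norm ?sqr_ge0 ?mulr_ge0 ?(ltW h1) ?(ltW h2)//.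
rewrite expr2 -[leRHS]mulr1 ler_pM2l ?mulr_gt0//.
by rewrite -[1]mulr1 ler_pM// ltW.
Qed.

End Envelope.

(** * Convolution on the line *)

Section OneDim.
Context {R : realType}.
Local Notation leb := (@lebesgue_measure R).
Implicit Types (f theta K : R -> R).

Lemma continuous_vanish_rint f (M : R) : continuous f -> (forall t, M < `|t| -> f t = 0) ->
  rint leb f.
Proof.
move=> cf f0; have mf := continuous_measurable_fun cf.
have mb : measurable `[-M, M]%classic by exact: measurable_itv.
have := @integrable_mkcond _ _ R leb `[-M, M]%classic (EFin \o f) mb => -[+ _].
have -> : ((EFin \o f) \_ `[-M, M]%classic) = (fun t => (f t)%:E).
  apply/funext => t; rewrite /patch; case: ifPn => //= /negP nt; rewrite f0//.
  rewrite ltNge; apply/negP => h; apply: nt; apply/mem_set.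
  by rewrite /= in_itv /= -ler_norml.
apply; apply: measurable_bounded_integrable => //.
- exact: lebesgue_measure_itv_lty.
- exact: measurable_funS mf.
- have [B B0 HB] := continuous_bounded_itv (-M) M cf.
  exists B; split; first exact: num_real.
  move=> c Bc t /=; rewrite in_itv/= => tM; apply: le_trans (HB _ tM) _; exact: ltW.
Qed.

Lemma kernel_bound f (a b c : R) : a <= b -> measurable_fun setT f ->
  (forall t, ~~ (a <= t <= b) -> f t = 0) -> (forall t, `|f t| <= c) ->
  `|\int[leb]_t f t| <= c * (b - a).
Proof.
move=> ab mf f0 fc.
have mI : measurable `[a, b]%classic by exact: measurable_itv.
have -> : \int[leb]_t f t = \int[leb]_(t in `[a, b]) f t.
  rewrite [RHS]Rintegral_mkcond; apply: eq_Rintegral => t _; rewrite /patch.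
  case: ifPn => // /negP nt; rewrite f0//; apply/negP => h; apply: nt.
  by apply/mem_set; rewrite /= in_itv.
have lt : (leb `[a, b]%classic < +oo)%E by exact: lebesgue_measure_itv_lty.
have i1 : leb.-integrable `[a, b]%classic (EFin \o f).
  apply: measurable_bounded_integrable => //; first exact: measurable_funS mf.
  exists c; split; first exact: num_real.
  by move=> d cd t /= _; apply: le_trans (fc t) _; exact: ltW.
apply: le_trans (le_normr_Rintegral _ i1) _ => //.
have : \int[leb]_(t in `[a, b]) `|f t| <= \int[leb]_(t in `[a, b]) (cst c t).
  apply: le_Rintegral => //.
  - exact: integrable_norm.
  - apply/integrableP; split; first exact/measurable_EFinP.
    rewrite (eq_integral (cst `|c|%:E))//.
    by rewrite integral_cst// lte_mul_pinfty.
move=> /le_trans; apply; rewrite Rintegral_cst//.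
have e : (@lebesgue_measure R [set` Interval (BLeft a) (BRight b)] = (b - a)%:E)%E.
  rewrite lebesgue_measure_itv /= lte_fin.
  by move: ab; rewrite le_eqVlt => /orP[/eqP ->|->]//=; rewrite ltxx subrr.
by rewrite (congr1 fine e).
Qed.

Definition conv K theta (t : R) : R := \int[leb]_u (theta u * K (t - u)).

Lemma continuous_refl K (t : R) : continuous K -> continuous (fun u => K (t - u)).
Proof.
move=> cK u; apply: (@continuous_comp _ _ _ (fun u => t - u) K); last exact: cK.
by apply: cvgB; [exact: cvg_cst|exact: cvg_id].
Qed.

Lemma continuous_conv_integrand K theta (t : R) : continuous theta -> continuous K ->
  continuous (fun u => theta u * K (t - u)).
Proof.
by move=> ct cK u; apply: cvgM; [exact: ct|exact: continuous_refl].
Qed.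

(** The derivative falls on the smooth kernel, so that [theta] need only be continuous. *)
Lemma conv_der K theta (M : R) t : continuous theta -> (forall u, M < `|u| -> theta u = 0) ->
  smooth K -> is_derive t (1 : R) (conv K theta) (conv (derive1 K) theta t).
Proof.
move=> ct t0 sK.
have cK := smooth_continuous sK; have cK' := smooth_continuous (smooth_derive1 sK).
(* This interval contains all [x - y] with [x] within 1 of [t] and [y] in the support of [theta]. *)
have [B B0 HB] := continuous_bounded_itv (t - 1 - `|M|) (t + 1 + `|M|) cK'.
pose f (x y : R) := theta y * K (x - y).
have df x y : is_derive x (1 : R) (f ^~ y) (theta y * derive1 K (x - y)).
  have d1 : is_derive x (1 : R) (fun x => x - y) 1.
    by apply: (is_derive_eq (der_sub (der_id x) (der_cst y x))); rewrite subr0.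
  have d2 := der_comp (f := K) (g := fun x => x - y) (smooth_derivable (x - y) sK) d1.
  apply: (is_derive_eq (der_mul (der_cst (theta y) x) d2)).
  by rewrite mul0r add0r mulr1.
have It : `]t - 1, t + 1[%classic t by rewrite /= in_itv/=; apply/andP; split; lra.
have H1 : forall x, `]t - 1, t + 1[%classic x -> leb.-integrable setT (EFin \o f x).
  move=> x _; apply: (@continuous_vanish_rint (f x) M).
    exact: continuous_conv_integrand.
  by move=> u /t0; rewrite /f => ->; rewrite mul0r.
have H2 : forall x y, `]t - 1, t + 1[%classic x -> setT y -> derivable (f ^~ y) x 1.
  by move=> x y _ _; have [] := df x y.
have iG : leb.-integrable setT (EFin \o (fun y => B * `|theta y|)).
  apply: rintZ; apply: (@continuous_vanish_rint _ M).
    by move=> u; apply: cvg_norm; exact: ct.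
  by move=> u /t0 ->; rewrite normr0.
have H3 : forall x y, `]t - 1, t + 1[%classic x -> setT y ->
    `|partial1of2 f x y| <= B * `|theta y|.
  move=> x y; rewrite /= in_itv/= => /andP[x1 x2] _.
  rewrite /partial1of2 (der_derive1 (df x y)) normrM mulrC.
  have [yM|yM] := ltP M `|y|; first by rewrite t0// normr0 !mulr0.
  apply: ler_wpM2r => //; apply: HB.
  have := ler_norm M; have := ler_norm y; have := ler_norm (- y); rewrite normrN.
  by move=> *; apply/andP; split; lra.
have G0 y : 0 <= B * `|theta y| by rewrite mulr_ge0.
split; first exact: (derivable_under_integral measurableT It H1 H2 G0 iG H3).
rewrite -derive1E (differentiation_under_integral measurableT It H1 H2 G0 iG H3).
by apply: eq_Rintegral => y _; rewrite /partial1of2 (der_derive1 (df t y)).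
Qed.

Lemma smooth_conv K theta (M : R) : continuous theta -> (forall u, M < `|u| -> theta u = 0) ->
  smooth K -> smooth (conv K theta).
Proof.
move=> ct t0 sK n; elim: n K sK => [|n IH] K sK; split => //.
- by move=> t; have [] := conv_der t ct t0 sK.
- by move=> t; have [] := conv_der t ct t0 sK.
rewrite (_ : derive1 _ = conv (derive1 K) theta).
  by apply: IH; exact: smooth_derive1.
by apply/funext => t; exact: der_derive1 (conv_der t ct t0 sK).
Qed.

(** The function [p u * K (t - u)] of [u] has compact support, so that its derivative integrates to
    0. Together with [conv_der] this makes convolution commute with differentiation. *)
Lemma conv_parts K (p p' : R -> R) (M t : R) : (forall u, is_derive u (1 : R) p (p' u)) ->
  continuous p' -> (forall u, M < `|u| -> p u = 0) -> smooth K ->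
  conv (derive1 K) p t = conv K p' t.
Proof.
move=> dp cp' p0 sK.
have cp : continuous p by move=> u; exact: der_continuous (dp u).
have p'0 u : M < `|u| -> p' u = 0.
  move=> uM; rewrite -(der_derive1 (dp u)).
  apply: (derive1_vanish (c := 0) (I := [set u | M < `|u|])) => //.
  have -> : [set u | M < `|u|] = (@Num.norm R R) @^-1` [set y | M < y] :> set R by [].
  by apply: open_comp => [x _|]; [exact: norm_continuous|exact: open_gt].
have cK := smooth_continuous sK; have cK' := smooth_continuous (smooth_derive1 sK).
have i1 : rint leb (fun u => p' u * K (t - u)).
  apply: (@continuous_vanish_rint _ M); first exact: continuous_conv_integrand.
  by move=> u /p'0 ->; rewrite mul0r.
have i2 : rint leb (fun u => p u * derive1 K (t - u)).
  apply: (@continuous_vanish_rint _ M); first exact: continuous_conv_integrand.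
  by move=> u /p0 ->; rewrite mul0r.
apply/esym/eqP; rewrite -subr_eq0 /conv -RintegralB//; apply/eqP.
have dF u : is_derive u (1 : R) (fun u => p u * K (t - u))
    (p' u * K (t - u) - p u * derive1 K (t - u)).
  have d1 : is_derive u (1 : R) (fun u => t - u) (- 1).
    by apply: (is_derive_eq (der_sub (der_cst t u) (der_id u))); rewrite sub0r.
  have d2 := der_comp (f := K) (g := fun u => t - u) (smooth_derivable (t - u) sK) d1.
  apply: (is_derive_eq (der_mul (dp u) d2)).
  by rewrite mulrN1 mulrN.
rewrite /Rintegral (_ : (\int[leb]_u _)%E = 0%E)//.
apply: (Rintegral_derive0 (M := M) dF).
- by move=> u; apply: cvgB; exact: continuous_conv_integrand.
- by move=> u /p0 ->; rewrite mul0r.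
- by move=> u uM; rewrite p'0// p0// !mul0r subr0.
Qed.

End OneDim.

(** * One-sided mollifiers *)

Section Mollify.
Context {R : realType} (chi : R -> R) (hchi : smooth_step chi).
Local Notation leb := (@lebesgue_measure R).
Implicit Types (theta : R -> R).

(** A smoothed Heaviside function passing from 0 to 1 on [[0, n.+1^-1]]. Its derivative [rho n] has
    mass 1 by the fundamental theorem of calculus, with no normalising constant. *)
Let Hn (n : nat) (s : R) : R := 1 - chi (n.+1%:R * s + 0).
Definition rho (n : nat) : R -> R := derive1 (Hn n).
Definition moll (n : nat) theta : R -> R := conv (rho n) theta.

Let smooth_Hn n : smooth (Hn n).
Proof.
move=> m; have -> : Hn n = fun s => 1 + (-1) * chi (n.+1%:R * s + 0).
  by apply/funext => s; rewrite mulN1r.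
apply: smn_add; first exact: smn_cst.
apply: smn_mul; first exact: smn_cst.
by apply: smooth_affine; exact: step_smooth.
Qed.

Lemma smooth_rho n : smooth (rho n).
Proof. exact: smooth_derive1. Qed.

Lemma rho_bound : exists2 B : R, 0 <= B & forall n t, `|rho n t| <= B * n.+1%:R.
Proof.
have [B B0 HB] := step_derive_bounded hchi; exists B => // n t.
have sc := step_smooth hchi.
pose N : R := n.+1%:R.
have d1 := der_affine N 0 t.
have d2 := der_comp (f := chi) (g := fun s => N * s + 0) (smooth_derivable _ sc) d1.
have d3 := der_sub (der_cst 1 t) d2.
rewrite /rho (der_derive1 d3) sub0r normrN normrM.
by rewrite (ger0_norm (ler0n _ _)) ler_wpM2r.
Qed.

Lemma rho_out n t : t < 0 \/ n.+1%:R^-1 < t -> rho n t = 0.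
Proof.
have n0 : 0 < n.+1%:R :> R by rewrite ltr0n.
case=> ht.
  apply: (derive1_vanish (c := 0) (I := [set t | t < 0])) => //.
  move=> s /= s0; rewrite /Hn (step_left hchi) ?subrr// addr0.
  by rewrite pmulr_rle0// ltW.
apply: (derive1_vanish (c := 1) (I := [set t | n.+1%:R^-1 < t])) => //.
move=> s /= s0; rewrite /Hn (step_right hchi) ?subr0// addr0.
by rewrite -[X in X <= _](mulfV (lt0r_neq0 n0)) ler_pM2l// ltW.
Qed.

Lemma rho_mass n t : \int[leb]_u rho n (t - u) = 1.
Proof.
have n0 : 0 < n.+1%:R^-1 :> R by rewrite invr_gt0 ltr0n.
have n1 : n.+1%:R^-1 <= 1 :> R by rewrite invf_le1 ?ltr0n// ler1n.
(* As a function of [u], [rho n (t - u)] is supported in [[t - 1, t]]; the margin 2 puts both ends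
   where [Hn n] is constant. *)
have lt : t - 2 < t + 2 by lra.
have := @continuous_FTC2 R (fun u => rho n (t - u)) (fun u => - Hn n (t - u)) (t - 2) (t + 2) lt _ _ _.
have d u : is_derive u (1 : R) (fun u => - Hn n (t - u)) (rho n (t - u)).
  have d1 : is_derive u (1 : R) (fun u => t - u) (- 1).
    by apply: (is_derive_eq (der_sub (der_cst t u) (der_id u))); rewrite sub0r.
  have d2 := der_comp (f := Hn n) (g := fun u => t - u) (smooth_derivable (t - u) (smooth_Hn n)) d1.
  have d3 := der_neg d2; rewrite mulrN1 opprK in d3; exact: d3.
have cont : continuous (fun u => - Hn n (t - u)).
  by move=> u; exact: der_continuous (d u).
move=> E; rewrite /Rintegral.
rewrite (_ : (\int[leb]_u _)%E = (1 : R)%:E)//.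
transitivity (\int[leb]_(u in `[(t - 2)%R, (t + 2)%R]) (rho n (t - u))%:E)%E.
  rewrite [RHS]integral_mkcond; apply: eq_integral => u _; rewrite /patch.
  case: ifPn => // /negP nu; rewrite rho_out//.
  apply: contrapT => h; apply: nu; apply/mem_set; rewrite /= in_itv/=.
  move/not_orP: h => -[/negP + /negP]; rewrite -!leNgt => h1 h2.
  by move: n1 h1 h2; move: (n.+1%:R^-1) => r *; apply/andP; split; lra.
rewrite E.
- have -> : t - (t - 2) = 2 by lra.
  have -> : t - (t + 2) = - 2 by lra.
  rewrite /Hn (step_left hchi) ?(step_right hchi).
  + by rewrite -EFinB; congr EFin; lra.
  + by rewrite addr0; have : 1 <= n.+1%:R :> R by [rewrite ler1n]; move: (n.+1%:R) => r *; lra.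
  + by rewrite addr0; have : 1 <= n.+1%:R :> R by [rewrite ler1n]; move: (n.+1%:R) => r *; lra.
- apply: continuous_subspaceT; apply: continuous_refl.
  exact: smooth_continuous (smooth_rho n).
- split.
  + by move=> u _; have [] := d u.
  + by apply: cvg_at_right_filter; exact: cont.
  + by apply: cvg_at_left_filter; exact: cont.
- by move=> u _; exact: der_derive1.
Qed.

Lemma moll_smooth n theta (M : R) : continuous theta ->
  (forall u, M < `|u| -> theta u = 0) -> smooth (moll n theta).
Proof. by move=> ct t0; apply: smooth_conv ct t0 _; exact: smooth_rho. Qed.

Lemma moll_derive n (p p' : R -> R) (M : R) : (forall u, is_derive u (1 : R) p (p' u)) ->
  continuous p' -> (forall u, M < `|u| -> p u = 0) ->
  derive1 (moll n p) = moll n p'.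
Proof.
move=> dp cp' p0; apply/funext => t.
have cp : continuous p by move=> u; exact: der_continuous (dp u).
rewrite (der_derive1 (conv_der t cp p0 (smooth_rho n))).
exact: (conv_parts t dp cp' p0 (smooth_rho n)).
Qed.

Lemma rho_support n (t u : R) : ~~ (t - n.+1%:R^-1 <= u <= t) -> rho n (t - u) = 0.
Proof.
move=> h; apply: rho_out; move: h; rewrite negb_and -!ltNge => /orP[]; move: (n.+1%:R^-1) => r h.
  by right; lra.
by left; lra.
Qed.

(** The height [B * n.+1] of the kernel and the length [n.+1^-1] of its support cancel, and
    mollifying enlarges the support of [theta] by at most 1. Both bounds are independent of [n]. *)
Lemma moll_bound theta (M : R) : continuous theta -> (forall u, M < `|u| -> theta u = 0) ->
  exists2 C : R, 0 <= C & forall n t, `|moll n theta t| <= C * \1_(`[-(M + 1), M + 1]%classic) t.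
Proof.
move=> ct t0; have [B B0 HB] := rho_bound.
have [T T0 HT] := continuous_bounded_itv (- M) M ct.
have {}HT u : `|theta u| <= T.
  have [h|h] := ltP M `|u|; first by rewrite t0// normr0.
  by apply: HT; rewrite -ler_norml.
exists (T * B); first by rewrite mulr_ge0.
move=> n t; have n0 : 0 < n.+1%:R :> R by rewrite ltr0n.
have n0' : 0 < n.+1%:R^-1 :> R by rewrite invr_gt0.
have n1 : n.+1%:R^-1 <= 1 :> R by rewrite invf_le1 ?ltr0n// ler1n.
rewrite indicE; have [tM|tM] := boolP (t \in _); last first.
  rewrite mulr0 /moll /conv.
  rewrite (_ : (fun u => _) = fun=> 0) ?Rintegral0//; last first.
    apply/funext => u; have [h|h] := boolP (t - n.+1%:R^-1 <= u <= t); last first.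
      by rewrite rho_support// mulr0.
    rewrite t0 ?mul0r//; move/negP: tM => tM; rewrite ltNge; apply/negP => uM; apply: tM.
    apply/mem_set; rewrite /= in_itv/=; move: uM h; rewrite ler_norml.
    move: n0' n1; move: (n.+1%:R^-1) => r ? ? /andP[? ?] /andP[? ?].
    by apply/andP; split; lra.
  by rewrite /Rintegral integral0 normr0.
rewrite mulr1.
have := @kernel_bound R (fun u => theta u * rho n (t - u)) (t - n.+1%:R^-1) t (T * (B * n.+1%:R)).
have -> : T * (B * n.+1%:R) * (t - (t - n.+1%:R^-1)) = T * B.
  by rewrite subKr -!mulrA mulfV ?mulr1// lt0r_neq0.
apply.
- by rewrite gerBl ltW.
- apply: continuous_measurable_fun; apply: continuous_conv_integrand => //.
  exact: smooth_continuous (smooth_rho n).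
- by move=> u h; rewrite rho_support// mulr0.
- by move=> u; rewrite normrM ler_pM.
Qed.

Lemma moll_cvg theta (M : R) t : continuous theta -> (forall u, M < `|u| -> theta u = 0) ->
  moll n theta t @[n --> \oo] --> theta t.
Proof.
move=> ct t0; have [B B0 HB] := rho_bound.
apply/cvgrPdist_le => /= e e0.
(* [B + 1] rather than [B], which may be 0. *)
have e1 : 0 < e / (B + 1) by rewrite divr_gt0//; lra.
have /cvgrPdist_le/(_ _ e1) := ct t.
move=> /nbhs_ballP[d /= d0 Hd].
near=> n.
have nd : n.+1%:R^-1 < d.
  rewrite invf_plt ?posrE ?ltr0n//; apply: lt_le_trans (_ : n%:R <= _); last by rewrite ler_nat.
  by near: n; exact: nbhs_infty_gtr.
have n0 : 0 < n.+1%:R :> R by rewrite ltr0n.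
have n0' : 0 < n.+1%:R^-1 :> R by rewrite invr_gt0.
have cr := smooth_continuous (smooth_rho n).
have i1 : rint leb (fun u => rho n (t - u)).
  apply: (@continuous_vanish_rint R _ (`|t| + n.+1%:R^-1)); first exact: continuous_refl.
  move=> u hu; apply: rho_support; apply/negP => /andP[h1 h2].
  move: n0' hu h1 h2; have := ler_norm t; have := ler_norm (- t); rewrite normrN.
  by move: (n.+1%:R^-1) => r; case: (ger0P u) => ? *; lra.
have i2 : rint leb (fun u => theta u * rho n (t - u)).
  apply: (@continuous_vanish_rint R _ M); first exact: continuous_conv_integrand.
  by move=> u /t0 ->; rewrite mul0r.
have -> : theta t - moll n theta t = \int[leb]_u (theta t * rho n (t - u) - theta u * rho n (t - u)).
  rewrite RintegralB//; last exact: rintZ.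
  by rewrite RintegralZl// rho_mass mulr1.
have bd := @kernel_bound R (fun u => theta t * rho n (t - u) - theta u * rho n (t - u))
  (t - n.+1%:R^-1) t (e / (B + 1) * (B * n.+1%:R)).
apply: (@le_trans _ _ (e / (B + 1) * (B * n.+1%:R) * (t - (t - n.+1%:R^-1)))).
  apply: bd.
  - by rewrite gerBl ltW.
  - apply: continuous_measurable_fun => u; apply: cvgB.
      by apply: cvgM; [exact: cvg_cst|exact: continuous_refl].
    exact: continuous_conv_integrand.
  - by move=> u h; rewrite rho_support// !mulr0 subr0.
  - move=> u; rewrite -mulrBl normrM.
    have [h|h] := boolP (t - n.+1%:R^-1 <= u <= t); last first.
      by rewrite rho_support// normr0 mulr0 !mulr_ge0// ?ler0n ?(ltW e0)// invr_ge0; lra.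
    apply: ler_pM => //; apply: Hd; rewrite /ball /=.
    have /andP[h1 h2] := h; rewrite ger0_norm ?subr_ge0//.
    by move: nd h1 h2; move: (n.+1%:R^-1) => r; lra.
have -> : e / (B + 1) * (B * n.+1%:R) * (t - (t - n.+1%:R^-1)) = e * (B / (B + 1)).
  by rewrite subKr -!mulrA mulfV ?lt0r_neq0// mulr1 [_^-1 * B]mulrC.
rewrite -[leRHS]mulr1 ler_pM2l// ler_pdivrMr; lra.
Unshelve. all: by end_near. Qed.

End Mollify.

(** * Weak derivatives against decaying functions of class C^1 *)

Section DecayingTest.
Context {R : realType} (chi : R -> R) (hchi : smooth_step chi).
Local Notation mu := (@leb2 R).
Variables (a b : R * R -> R).
Hypotheses (ca : continuous a) (cb : continuous b).
Hypothesis env_ab : (fun x => env (a x) * env (b x)) \in Lfun mu 2%:E.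
Implicit Types (p q f g : R -> R) (w d : R * R -> R[i]).

(** [a] and [b] stand for the two coordinates in either order, so that one argument covers both
    partial derivatives. *)
Definition ptens p q (x : R * R) : R := p (a x) * q (b x).

Lemma continuous_ptens p q : continuous p -> continuous q -> continuous (ptens p q).
Proof.
move=> cp cq x; apply: cvgM.
  by apply: (@continuous_comp _ _ _ a p); [exact: ca|exact: cp].
by apply: (@continuous_comp _ _ _ b q); [exact: cb|exact: cq].
Qed.

Lemma cL2_ptens p q (C C' : R) : continuous p -> continuous q ->
  (forall t, `|p t| <= C * env t) -> (forall t, `|q t| <= C' * env t) ->
  cL2 mu (fun x => (ptens p q x)%:C).
Proof.
move=> cp cq hp hq; apply: (cL2_dom _ (Lfun2Z (C * C') env_ab)).
  by apply: cmeas_real; apply: continuous_measurable2; exact: continuous_ptens.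
move=> x; rewrite nrm_real normrM.
apply: le_trans (ler_pM (normr_ge0 _) (normr_ge0 _) (hp (a x)) (hq (b x))) _.
by rewrite le_eqVlt; apply/orP; left; apply/eqP; ring.
Qed.

Lemma ptens_dct w (f_ g_ : nat -> R -> R) f g (C C' : R) : cL2 mu w ->
  (forall n, continuous (f_ n)) -> (forall n, continuous (g_ n)) ->
  continuous f -> continuous g ->
  (forall n t, `|f_ n t| <= C * env t) -> (forall n t, `|g_ n t| <= C' * env t) ->
  (forall t, f_ n t @[n --> \oo] --> f t) -> (forall t, g_ n t @[n --> \oo] --> g t) ->
  ccvg (fun n => cint (fun x => w x * (ptens (f_ n) (g_ n) x)%:C))
    (cint (fun x => w x * (ptens f g x)%:C)).
Proof.
move=> iw cf_ cg_ cf cg bf bg f_f g_g.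
apply: (@cI_dct _ _ _ mu _ _ (fun x => nrm (w x) * (C * C' * (env (a x) * env (b x))))).
- move=> n; apply: cmeasM; first exact: cL2_meas iw.
  by apply: cmeas_real; apply: continuous_measurable2; exact: continuous_ptens.
- apply: cmeasM; first exact: cL2_meas iw.
  by apply: cmeas_real; apply: continuous_measurable2; exact: continuous_ptens.
- move=> x; apply: ccvgM; first exact: ccvg_cst.
  by apply: ccvg_real; apply: cvgM; [exact: f_f|exact: g_g].
- move=> n x; apply: le_trans (nrmM _ _) _; apply: ler_wpM2l; first exact: nrm_ge0.
  rewrite nrm_real normrM.
  apply: le_trans (ler_pM (normr_ge0 _) (normr_ge0 _) (bf n (a x)) (bg n (b x))) _.
  by rewrite le_eqVlt; apply/orP; left; apply/eqP; ring.
- by apply: Lfun2_mul_integrable; [exact: cL2_nrm|exact: Lfun2Z].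
Qed.

Variables (w d : R * R -> R[i]).
Hypotheses (iw : cL2 mu w) (id : cL2 mu d).
Hypothesis wd : forall p q, smooth p -> smooth q -> vanish_outside p -> vanish_outside q ->
  cint (fun x => w x * (ptens (derive1 p) q x)%:C) = - cint (fun x => d x * (ptens p q x)%:C).

Lemma indic_le_env (K t : R) : \1_(`[- K, K]%classic) t <= (1 + K ^+ 2) * env t.
Proof.
rewrite indicE; have [tK|_] := boolP (t \in _); last first.
  by rewrite mulr_ge0 ?(ltW (env_gt0 _))// addr_ge0// sqr_ge0.
have {tK} : `|t| <= K by move/set_mem: tK; rewrite /= in_itv/= ler_norml.
move=> tK; rewrite /env ler_pdivlMr; last by have := sqr_ge0 t; lra.
rewrite mul1r lerD2l -real_normK ?num_real// ler_sqr ?nnegrE//.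
exact: le_trans tK.
Qed.

Lemma moll_env theta (M : R) : continuous theta -> (forall u, M < `|u| -> theta u = 0) ->
  exists C : R, forall n t, `|moll chi n theta t| <= C * env t.
Proof.
move=> ct t0; have [C C0 HC] := moll_bound hchi ct t0.
exists (C * (1 + (M + 1) ^+ 2)) => n t; apply: le_trans (HC n t) _.
by rewrite -mulrA; apply: ler_wpM2l => //; exact: indic_le_env.
Qed.

Lemma moll_vanish n theta (M : R) : continuous theta -> (forall u, M < `|u| -> theta u = 0) ->
  vanish_outside (moll chi n theta).
Proof.
move=> ct t0; have [C C0 HC] := moll_bound hchi ct t0.
exists (M + 1) => t ht; apply/eqP; rewrite -normr_le0; apply: le_trans (HC n t) _.
rewrite indicE; have [tK|_] := boolP (t \in _); last by rewrite mulr0.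
by move/set_mem: tK; rewrite /= in_itv/= -ler_norml leNgt ht.
Qed.

(** Mollified factors are admissible in [wd], and mollification commutes with the derivative of [p].
    The bounds by [env] do not depend on [n], so that both sides pass to the limit against [w] and
    [d] in L^2. *)
Lemma weak_compact p p' q (M : R) : (forall u, is_derive u (1 : R) p (p' u)) ->
  continuous p' -> continuous q ->
  (forall u, M < `|u| -> p u = 0) -> (forall u, M < `|u| -> q u = 0) ->
  cint (fun x => w x * (ptens p' q x)%:C) = - cint (fun x => d x * (ptens p q x)%:C).
Proof.
move=> dp cp' cq p0 q0.
have cp : continuous p by move=> u; exact: der_continuous (dp u).
have p'0 u : M < `|u| -> p' u = 0.
  move=> uM; rewrite -(der_derive1 (dp u)).
  apply: (derive1_vanish (c := 0) (I := [set u | M < `|u|])) => //.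
  have -> : [set u | M < `|u|] = (@Num.norm R R) @^-1` [set y | M < y] :> set R by [].
  by apply: open_comp => [x _|]; [exact: norm_continuous|exact: open_gt].
have [C HC] := moll_env cp p0; have [C' HC'] := moll_env cp' p'0; have [Cq HCq] := moll_env cq q0.
have cm theta n : continuous theta -> (forall u, M < `|u| -> theta u = 0) ->
    continuous (moll chi n theta).
  by move=> ct t0; exact: smooth_continuous (moll_smooth hchi n ct t0).
have L := ptens_dct iw (fun n => cm _ n cp' p'0) (fun n => cm _ n cq q0) cp' cq HC' HCq
  (fun t => moll_cvg hchi (t := t) cp' p'0) (fun t => moll_cvg hchi (t := t) cq q0).
have L' := ptens_dct id (fun n => cm _ n cp p0) (fun n => cm _ n cq q0) cp cq HC HCq
  (fun t => moll_cvg hchi (t := t) cp p0) (fun t => moll_cvg hchi (t := t) cq q0).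
apply: (ccvg_unique L).
rewrite (_ : (fun n => _) = fun n => - cint (fun x => d x * (ptens (moll chi n p) (moll chi n q) x)%:C)).
  exact: ccvgN.
apply/funext => n; rewrite -(moll_derive hchi n dp cp' p0) wd//.
- exact (moll_smooth hchi n cp p0).
- exact (moll_smooth hchi n cq q0).
- exact (moll_vanish n cp p0).
- exact (moll_vanish n cq q0).
Qed.

(** Plateau cutoff: 1 for [|t| <= m], 0 for [|t| >= m + 1]. The width of the transition does not
    depend on [m], hence neither does the bound on the derivative. *)
Definition kappa (m : nat) (t : R) : R := chi (1 * t + - m%:R) * chi (-1 * t + - m%:R).

Lemma smooth_kappa m : smooth (kappa m).
Proof. by apply: smooth_mul; apply: smooth_affine; exact: step_smooth. Qed.

Lemma kappa_in m t : `|t| < m%:R -> kappa m t = 1.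
Proof.
move=> tm; rewrite /kappa !(step_left hchi) ?mulr1//.
  by move: tm; rewrite ltr_norml => /andP[]; lra.
by move: tm; rewrite ltr_norml => /andP[]; lra.
Qed.

Lemma kappa_derive_in m t : `|t| < m%:R -> derive1 (kappa m) t = 0.
Proof.
move=> tm; apply: (derive1_vanish (c := 1) (I := [set t | `|t| < m%:R])) => //.
  have -> : [set u | `|u| < m%:R] = (@Num.norm R R) @^-1` [set y | y < m%:R] :> set R by [].
  by apply: open_comp => [x _|]; [exact: norm_continuous|exact: open_lt].
by move=> u /= um; exact: kappa_in.
Qed.

Lemma kappa_out m t : m%:R + 1 < `|t| -> kappa m t = 0.
Proof.
rewrite /kappa; case: (ger0P t) => t0 tm.
  by rewrite (step_right hchi) ?mul0r//; lra.
by rewrite [X in _ * X](step_right hchi) ?mulr0//; lra.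
Qed.

Lemma kappa_bound : exists B : R, (forall m t, `|kappa m t| <= B) /\
  (forall m t, `|derive1 (kappa m) t| <= B).
Proof.
have [B B1 HB] := step_bounded hchi; have [B' B'0 HB'] := step_derive_bounded hchi.
have B0 : 0 <= B by lra.
exists (B * B + 2 * (B * B')); split => m t.
  rewrite /kappa normrM -[leLHS]addr0 lerD// ?ler_pM//.
  by rewrite !mulr_ge0.
have sc := step_smooth hchi.
have d1 := der_comp (f := chi) (g := fun t => 1 * t + - m%:R) (smooth_derivable _ sc)
  (der_affine 1 (- m%:R) t).
have d2 := der_comp (f := chi) (g := fun t => -1 * t + - m%:R) (smooth_derivable _ sc)
  (der_affine (-1) (- m%:R) t).
rewrite (der_derive1 (der_mul d1 d2)).
apply: le_trans (ler_normD _ _) _.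
rewrite mulr1 mulrN1 mulrN normrN !normrM.
have h1 := ler_pM (normr_ge0 _) (normr_ge0 _) (HB' (1 * t + - m%:R)) (HB (-1 * t + - m%:R)).
have h2 := ler_pM (normr_ge0 _) (normr_ge0 _) (HB (1 * t + - m%:R)) (HB' (-1 * t + - m%:R)).
have h3 : 0 <= B * B by rewrite mulr_ge0.
by rewrite [B' * B]mulrC in h1; lra.
Qed.

Lemma near_norm_lt (t : R) : \forall m \near \oo, `|t| < m%:R.
Proof. by near=> m; near: m; exact: nbhs_infty_gtr. Unshelve. all: by end_near. Qed.

(** Truncation by [kappa m] reduces to compact support. The extra term [p * derive1 (kappa m)] is
    dominated by a multiple of [env] and is 0 at any given point once [m] is large. *)
Lemma weak_decaying p p' q (C : R) : (forall u, is_derive u (1 : R) p (p' u)) ->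
  continuous p' -> continuous q -> (forall t, `|p t| <= C * env t) ->
  (forall t, `|p' t| <= C * env t) -> (forall t, `|q t| <= C * env t) ->
  cint (fun x => w x * (ptens p' q x)%:C) = - cint (fun x => d x * (ptens p q x)%:C).
Proof.
move=> dp cp' cq bp bp' bq.
have cp : continuous p by move=> u; exact: der_continuous (dp u).
have [B [HB HB']] := kappa_bound.
have B0 : 0 <= B by apply: le_trans (HB 0%N 0).
pose pm m t := p t * kappa m t; pose qm m t := q t * kappa m t.
pose pm' m t := p' t * kappa m t + p t * derive1 (kappa m) t.
have ck m : continuous (kappa m) := smooth_continuous (smooth_kappa m).
have ck' m : continuous (derive1 (kappa m)) := smooth_continuous (smooth_derive1 (smooth_kappa m)).
have cpm m : continuous (pm m) by move=> t; apply: cvgM; [exact: cp|exact: ck].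
have cqm m : continuous (qm m) by move=> t; apply: cvgM; [exact: cq|exact: ck].
have cpm' m : continuous (pm' m).
  by move=> t; apply: cvgD; apply: cvgM; [exact: cp'|exact: ck|exact: cp|exact: ck'].
have bd (f g : R -> R) : (forall t, `|f t| <= C * env t) -> (forall t, `|g t| <= B) ->
    forall t, `|f t * g t| <= C * B * env t.
  move=> hf hg t; rewrite normrM mulrAC; exact: ler_pM.
have bpm m t : `|pm m t| <= C * B * env t by exact: bd.
have bqm m t : `|qm m t| <= C * B * env t by exact: bd.
have bpm' m t : `|pm' m t| <= 2 * (C * B) * env t.
  apply: le_trans (ler_normD _ _) _; rewrite -mulrA mulr_natl mulr2n.
  by apply: lerD; exact: bd.
have kc t : kappa m t @[m --> \oo] --> (1 : R).
  by apply: cvg_near_cst; apply: filterS (near_norm_lt t) => m; exact: kappa_in.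
have kc' t : derive1 (kappa m) t @[m --> \oo] --> (0 : R).
  by apply: cvg_near_cst; apply: filterS (near_norm_lt t) => m; exact: kappa_derive_in.
have cvp t : pm m t @[m --> \oo] --> p t.
  by rewrite -[X in _ --> X]mulr1; apply: cvgM; [exact: cvg_cst|exact: kc].
have cvq t : qm m t @[m --> \oo] --> q t.
  by rewrite -[X in _ --> X]mulr1; apply: cvgM; [exact: cvg_cst|exact: kc].
have cvp' t : pm' m t @[m --> \oo] --> p' t.
  rewrite -[p' t]addr0 -[X in _ --> X + _]mulr1 -[X in _ --> _ + X](mulr0 (p t)).
  by apply: cvgD; apply: cvgM; [exact: cvg_cst|exact: kc|exact: cvg_cst|exact: kc'].
have L := ptens_dct iw cpm' cqm cp' cq bpm' bqm cvp' cvq.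
have L' := ptens_dct id cpm cqm cp cq bpm bqm cvp cvq.
apply: (ccvg_unique L).
rewrite (_ : (fun n => _) = fun n => - cint (fun x => d x * (ptens (pm n) (qm n) x)%:C)).
  exact: ccvgN.
apply/funext => m; apply: (weak_compact (M := m%:R + 1)) => //.
- by move=> u; exact: der_mul (dp u) (smooth_derivable u (smooth_kappa m)).
- by move=> u /kappa_out h; rewrite /pm h mulr0.
- by move=> u /kappa_out h; rewrite /qm h mulr0.
Qed.

Definition cder (P : R -> R[i]) (u : R) (D : R[i]) : Prop :=
  is_derive u (1 : R) (fun t => Rec (P t)) (Rec D) /\
  is_derive u (1 : R) (fun t => Imc (P t)) (Imc D).

Definition ccont1 (P : R -> R[i]) :=
  continuous (fun t => Rec (P t)) /\ continuous (fun t => Imc (P t)).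

(** Splits a complex tensor product into four real ones, to which [weak_decaying] applies one by
    one. *)
Lemma cI_bilinear (v : R * R -> R[i]) (P Q : R -> R[i]) (C : R) : cL2 mu v ->
  ccont1 P -> ccont1 Q -> (forall t, nrm (P t) <= C * env t) ->
  (forall t, nrm (Q t) <= C * env t) ->
  cint (fun x => v x * (P (a x) * Q (b x))) =
    (cint (fun x => v x * (ptens (fun t => Rec (P t)) (fun t => Rec (Q t)) x)%:C)
     - cint (fun x => v x * (ptens (fun t => Imc (P t)) (fun t => Imc (Q t)) x)%:C))
    + 'i%C * (cint (fun x => v x * (ptens (fun t => Rec (P t)) (fun t => Imc (Q t)) x)%:C)
     + cint (fun x => v x * (ptens (fun t => Imc (P t)) (fun t => Rec (Q t)) x)%:C)).
Proof.
move=> iv [cP1 cP2] [cQ1 cQ2] bP bQ; rewrite !cintE.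
have bRe (S : R -> R[i]) : (forall t, nrm (S t) <= C * env t) ->
    forall t, `|Rec (S t)| <= C * env t.
  by move=> h t; apply: le_trans (h t); exact: Rec_le_nrm.
have bIm (S : R -> R[i]) : (forall t, nrm (S t) <= C * env t) ->
    forall t, `|Imc (S t)| <= C * env t.
  by move=> h t; apply: le_trans (h t); exact: Imc_le_nrm.
have i1 := cL2_mul iv (cL2_ptens cP1 cQ1 (bRe _ bP) (bRe _ bQ)).
have i2 := cL2_mul iv (cL2_ptens cP2 cQ2 (bIm _ bP) (bIm _ bQ)).
have i3 := cL2_mul iv (cL2_ptens cP1 cQ2 (bRe _ bP) (bIm _ bQ)).
have i4 := cL2_mul iv (cL2_ptens cP2 cQ1 (bIm _ bP) (bRe _ bQ)).
rewrite -cIN// -!cID//; last exact: cableN.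
rewrite -cIZ -?cID.
- apply: cI_eq => x; rewrite /ptens.
  case: (v x) => v1 v2; case: (P (a x)) => p1 p2; case: (Q (b x)) => q1 q2.
  by apply: ReIm_eq; rewrite !ReImE /=; ring.
- by apply: cableD => //; exact: cableN.
- by apply: cableZ; exact: cableD.
- exact: cableD.
Qed.

Lemma weak_decaying_complex (P P' Q : R -> R[i]) (C : R) :
  (forall u, cder P u (P' u)) -> ccont1 P' -> ccont1 Q ->
  (forall t, nrm (P t) <= C * env t) -> (forall t, nrm (P' t) <= C * env t) ->
  (forall t, nrm (Q t) <= C * env t) ->
  cint (fun x => w x * (P' (a x) * Q (b x))) = - cint (fun x => d x * (P (a x) * Q (b x))).
Proof.
move=> dP cP' cQ bP bP' bQ.
have cP : ccont1 P.
  by split => u; [exact: der_continuous (dP u).1|exact: der_continuous (dP u).2].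
have bRe (S : R -> R[i]) : (forall t, nrm (S t) <= C * env t) ->
    forall t, `|Rec (S t)| <= C * env t.
  by move=> h t; apply: le_trans (h t); exact: Rec_le_nrm.
have bIm (S : R -> R[i]) : (forall t, nrm (S t) <= C * env t) ->
    forall t, `|Imc (S t)| <= C * env t.
  by move=> h t; apply: le_trans (h t); exact: Imc_le_nrm.
have [cQ1 cQ2] := cQ; have [cP1 cP2] := cP'.
rewrite (cI_bilinear iw cP' cQ bP' bQ) (cI_bilinear id cP cQ bP bQ).
rewrite (weak_decaying (fun u => (dP u).1) cP1 cQ1 (bRe _ bP) (bRe _ bP') (bRe _ bQ)).
rewrite (weak_decaying (fun u => (dP u).2) cP2 cQ2 (bIm _ bP) (bIm _ bP') (bIm _ bQ)).
rewrite (weak_decaying (fun u => (dP u).1) cP1 cQ2 (bRe _ bP) (bRe _ bP') (bIm _ bQ)).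
rewrite (weak_decaying (fun u => (dP u).2) cP2 cQ1 (bIm _ bP) (bIm _ bP') (bRe _ bQ)).
by ring.
Qed.

End DecayingTest.

Section DecayingPartial.
Context {R : realType} (chi : R -> R) (hchi : smooth_step chi).
Local Notation mu := (@leb2 R).
Implicit Types (P Q : R -> R[i]) (w d : R * R -> R[i]).

Lemma continuous_fst2 : continuous (fun x : R * R => x.1).
Proof. by move=> x; exact: cvg_fst. Qed.

Lemma continuous_snd2 : continuous (fun x : R * R => x.2).
Proof. by move=> x; exact: cvg_snd. Qed.

Lemma Lfun2_env2_swap : (fun x : R * R => env x.2 * env x.1) \in Lfun mu 2%:E.
Proof.
rewrite (_ : (fun x => _) = fun x : R * R => env x.1 * env x.2).
  exact: Lfun2_env2.
by apply/funext => x; rewrite mulrC.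
Qed.

Lemma weak_partial1_decaying w d P (P' Q : R -> R[i]) (C : R) :
  cL2 mu w -> cL2 mu d -> weak_partial (@dir1 R) w d ->
  (forall u, cder P u (P' u)) -> ccont1 P' -> ccont1 Q ->
  (forall t, nrm (P t) <= C * env t) -> (forall t, nrm (P' t) <= C * env t) ->
  (forall t, nrm (Q t) <= C * env t) ->
  cint (fun x => w x * (P' x.1 * Q x.2)) = - cint (fun x => d x * (P x.1 * Q x.2)).
Proof.
move=> iw id wd; apply: (weak_decaying_complex hchi continuous_fst2 continuous_snd2 Lfun2_env2 iw id).
move=> p q sp sq vp vq; have [M [p0 q0]] := vanish_both vp vq.
rewrite -(wd _ (test_function_tens sp sq p0 q0)).
by apply: cI_eq => x; have [_ ->] := tens_derive1 q x sp.
Qed.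

Lemma weak_partial2_decaying w d P (P' Q : R -> R[i]) (C : R) :
  cL2 mu w -> cL2 mu d -> weak_partial (@dir2 R) w d ->
  (forall u, cder P u (P' u)) -> ccont1 P' -> ccont1 Q ->
  (forall t, nrm (P t) <= C * env t) -> (forall t, nrm (P' t) <= C * env t) ->
  (forall t, nrm (Q t) <= C * env t) ->
  cint (fun x => w x * (P' x.2 * Q x.1)) = - cint (fun x => d x * (P x.2 * Q x.1)).
Proof.
move=> iw id wd; apply: (weak_decaying_complex hchi continuous_snd2 continuous_fst2 Lfun2_env2_swap iw id).
move=> p q sp sq vp vq; have [M [p0 q0]] := vanish_both vp vq.
have := wd _ (test_function_tens sq sp q0 p0).
rewrite !cintE => E; transitivity (cI mu (fun x => w x * ('D_dir2 (tens q p) x)%:C)).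
  by apply: cI_eq => x; have [_ ->] := tens_derive2 q x sp; rewrite /tens /ptens mulrC [q _ * _]mulrC mulrC.
by rewrite E; congr (- _); apply: cI_eq => x; rewrite /tens /ptens [q _ * _]mulrC.
Qed.

End DecayingPartial.

(** * Complex Gaussians on the stretched contour *)

Section ComplexExp.
Context {R : realType}.
Implicit Types (z : R[i]) (f g : R -> R[i]).

Definition cexp z : R[i] := (expR (Rec z) * cos (Imc z)) +i* (expR (Rec z) * sin (Imc z)).

Lemma cexp0 : cexp 0 = 1.
Proof. by rewrite /cexp /= expR0 cos0 sin0 mulr1 mulr0. Qed.

Lemma nrm_cexp z : nrm (cexp z) <= 2 * expR (Rec z).
Proof.
rewrite /nrm /= !normrM (ger0_norm (expR_ge0 _)) -mulrDr mulrC ler_wpM2r ?expR_ge0//.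
have := cos_max (Imc z); have := sin_max (Imc z); lra.
Qed.

Lemma cder_eq f t d d' : cder f t d -> d = d' -> cder f t d'.
Proof. by move=> h <-. Qed.

Lemma cder_cst (c : R[i]) t : cder (fun=> c) t 0.
Proof. by split; exact: der_cst. Qed.

Lemma cder_add f g t d e : cder f t d -> cder g t e -> cder (fun t => f t + g t) t (d + e).
Proof.
move=> [f1 f2] [g1 g2]; split; rewrite ReImE.
  rewrite (_ : (fun t => _) = fun t => Rec (f t) + Rec (g t)); first exact: der_plus.
  by apply/funext => u; rewrite RecD.
rewrite (_ : (fun t => _) = fun t => Imc (f t) + Imc (g t)); first exact: der_plus.
by apply/funext => u; rewrite ImcD.
Qed.

Lemma cder_mul f g t d e : cder f t d -> cder g t e ->
  cder (fun t => f t * g t) t (d * g t + f t * e).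
Proof.
move=> [f1 f2] [g1 g2]; split; rewrite !ReImE.
  rewrite (_ : (fun t => _) = fun t => Rec (f t) * Rec (g t) - Imc (f t) * Imc (g t)).
    by apply: (is_derive_eq (der_sub (der_mul f1 g1) (der_mul f2 g2))); ring.
  by apply/funext => u; rewrite RecM.
rewrite (_ : (fun t => _) = fun t => Rec (f t) * Imc (g t) + Imc (f t) * Rec (g t)).
  by apply: (is_derive_eq (der_plus (der_mul f1 g2) (der_mul f2 g1))); ring.
by apply/funext => u; rewrite ImcM.
Qed.

Lemma cder_scale (c : R[i]) f t d : cder f t d -> cder (fun t => c * f t) t (c * d).
Proof. by move=> h; apply: (cder_eq (cder_mul (cder_cst c t) h)); rewrite mul0r add0r. Qed.

Lemma cder_cexp f t d : cder f t d -> cder (fun t => cexp (f t)) t (d * cexp (f t)).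
Proof.
move=> [f1 f2]; have e1 := der_comp (is_derive_expR (Rec (f t))) f1.
have c1 := der_comp (is_derive_cos (Imc (f t))) f2.
have s1 := der_comp (is_derive_sin (Imc (f t))) f2.
split; rewrite /= !ReImE /=.
  by apply: (is_derive_eq (der_mul e1 c1)); ring.
by apply: (is_derive_eq (der_mul e1 s1)); ring.
Qed.

Lemma cder_cont1 f (d : R -> R[i]) : (forall t, cder f t (d t)) -> ccont1 f.
Proof.
by move=> h; split => t; [exact: der_continuous (h t).1|exact: der_continuous (h t).2].
Qed.

Lemma cnorm2_gt0 z : z != 0 -> 0 < Rec z ^+ 2 + Imc z ^+ 2.
Proof.
case: z => a b; rewrite eq_complex /= => h; rewrite lt_neqAle addr_ge0 ?sqr_ge0// andbT eq_sym.
by rewrite paddr_eq0 ?sqr_ge0// !sqrf_eq0.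
Qed.

Lemma complexV z : z^-1 = (Rec z / (Rec z ^+ 2 + Imc z ^+ 2)) +i*
  - (Imc z / (Rec z ^+ 2 + Imc z ^+ 2)).
Proof. by case: z. Qed.

Lemma cder_inv f t d : f t != 0 -> cder f t d ->
  cder (fun t => (f t)^-1) t (- d * ((f t)^-1 * (f t)^-1)).
Proof.
move=> f0 [f1 f2]; have n0 := lt0r_neq0 (cnorm2_gt0 f0).
have dn : is_derive t (1 : R) (fun t => Rec (f t) ^+ 2 + Imc (f t) ^+ 2)
    (2 * (Rec (f t) * Rec d) + 2 * (Imc (f t) * Imc d)).
  rewrite (_ : (fun t => _) = fun t => Rec (f t) * Rec (f t) + Imc (f t) * Imc (f t)).
    by apply: (is_derive_eq (der_plus (der_mul f1 f1) (der_mul f2 f2))); ring.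
  by apply/funext => u; rewrite !expr2.
have di := is_deriveV (f := fun t => Rec (f t) ^+ 2 + Imc (f t) ^+ 2) n0 dn.
split.
  rewrite (_ : (fun t => _) = fun t => Rec (f t) * (Rec (f t) ^+ 2 + Imc (f t) ^+ 2)^-1).
    apply: (is_derive_eq (der_mul f1 di)); rewrite complexV !ReImE /= /GRing.scale /=.
    by field.
  by apply/funext => u; rewrite complexV.
rewrite (_ : (fun t => _) = fun t => - (Imc (f t) * (Rec (f t) ^+ 2 + Imc (f t) ^+ 2)^-1)).
  apply: (is_derive_eq (der_neg (der_mul f2 di))); rewrite complexV !ReImE /= /GRing.scale /=.
  by field.
by apply/funext => u; rewrite complexV.
Qed.

End ComplexExp.

(** * The stretched contour and its asymptotic line *)

Section Contour.
Context {R : realType}.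
Local Notation leb := (@lebesgue_measure R).
Implicit Types s S : R -> R.

(* [S] is a primitive of [s], so that [t +i* S t] is the stretched coordinate;
   it is not normalised by [S 0 = 0], since only differences matter. *)
Record contour (sig : R) s S (K : R) : Prop := Contour {
  contour_gt0 : 0 < sig;
  contour_abs : absorbing sig s;
  contour_der : forall t, is_derive t (1 : R) S (s t);
  contour_far : forall t, `|S t - sig * t| <= K }.

Lemma profile_absorbing (l lbar sig : R) s : pml_profile l lbar sig s -> absorbing sig s.
Proof.
move=> hs; split; last exact: pml_bounds hs.
by move=> t; exact: (der_continuous (derivable_der (@pml_derivable _ _ _ _ _ hs t))).
Qed.

(** The defect [sig - s] is nonnegative with compact support. Subtracting its integral over []-oo,
    t]] from [sig * t] gives a primitive of [s] whose distance to [sig * t] is at most the total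
    integral. *)
Lemma profile_contour (l lbar sig : R) s : 0 < sig -> pml_profile l lbar sig s ->
  exists S K, contour sig s S K.
Proof.
move=> sig0 hs; have [cs bs] := profile_absorbing hs.
pose tau t := sig - s t.
have ctau : continuous tau by move=> t; apply: cvgB; [exact: cvg_cst|exact: cs].
have tau0 t : 0 <= tau t by rewrite subr_ge0; have /andP[] := bs t.
have itau : rint leb tau.
  apply: (continuous_vanish_rint (M := lbar)) => // t lt.
  by rewrite /tau (pml_outer hs) ?subrr// ltW.
pose In t := \int[leb]_(u in `]-oo, t]%classic) tau u.
have iI t : leb.-integrable `]-oo, t]%classic (EFin \o tau).
  by apply: integrableS itau.
exists (fun t => sig * t - In t), (\int[leb]_u tau u); split => //.
- move=> t; have t1 : t < t + 1 by rewrite ltrDl.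
  have [dI I'] := @continuous_FTC1 R tau -oo%O t (t + 1) t1 (iI _) (ltNyr _) (ctau t).
  have d1 : is_derive t (1 : R) In (tau t) by split; [exact: dI|rewrite -I' derive1E].
  apply: (is_derive_eq (der_sub (der_mul (der_cst sig t) (der_id t)) d1)).
  by rewrite mul0r add0r mulr1 /tau; lra.
- move=> t; rewrite addrAC subrr sub0r normrN /In.
  rewrite ger0_norm; last by apply: Rintegral_ge0 => u _.
  rewrite Rintegral_mkcond; apply: le_Rintegral => //.
  + have mI : measurable `]-oo, t]%classic by exact: measurable_itv.
    have [+ _] := @integrable_mkcond _ _ R leb `]-oo, t]%classic (EFin \o tau) mI.
    by move=> /(_ (iI t)); rewrite restrict_EFin.
  + by move=> u _; rewrite /patch; case: ifP.
Qed.

End Contour.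

(** * Gaussians in the stretched coordinate *)

Section GaussianBounds.
Context {R : realType} (sig K : R) (s S : R -> R) (hc : contour sig s S K).

Definition zc (t : R) : R[i] := t +i* S t.
Definition gau (m : R[i]) (y t : R) : R[i] := cexp (- m * ((zc t - zc y) * (zc t - zc y))).

(** Mean value theorem with slopes in [[0, sig]]: every chord of the contour lies in the sector
    between 1 and [1 + i sig]. *)
Lemma contour_mean (x y : R) : exists2 th : R, 0 <= th <= sig & S x - S y = th * (x - y).
Proof.
have ab := contour_abs hc.
wlog yx : x y / y <= x.
  move=> W; have [yx|/ltW xy] := leP y x; first exact: W.
  have [th h e] := W _ _ xy; exists th => //.
  by rewrite -opprB e -mulrN opprB.
have [c _ e] := @MVT_segment R S s y x yx (fun t _ => contour_der hc t)
  (continuous_subspaceT (fun t => der_continuous (contour_der hc t))).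
by exists (s c); [exact: ab.2|].
Qed.

Lemma nrm_zcB t y : nrm (zc t - zc y) <= (1 + sig) * `|t - y|.
Proof.
have [th /andP[th0 th1] e] := contour_mean t y.
rewrite /nrm /= e normrM mulrDl mul1r lerD2l.
by rewrite ler_wpM2r// ger0_norm.
Qed.

Lemma cder_zc t : cder zc t (alpha s t).
Proof. by split => /=; [exact: der_id|exact: contour_der hc t]. Qed.

Lemma cder_zcB y t : cder (fun t => zc t - zc y) t (alpha s t).
Proof.
by apply: (cder_eq (cder_add (cder_zc t) (cder_cst (- zc y) t))); rewrite addr0.
Qed.

(** [gau1] and [gau2] are the first and second derivatives in the stretched variable;
    differentiation in [t] adds one factor [alpha]. *)
Definition gau1 m y t : R[i] := (- 2 * m) * (zc t - zc y) * gau m y t.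
Definition gau2 m y t : R[i] :=
  (4 * m * m * ((zc t - zc y) * (zc t - zc y)) - 2 * m) * gau m y t.

Lemma cder_gau m y t : cder (gau m y) t (alpha s t * gau1 m y t).
Proof.
have h := cder_zcB y t.
apply: (cder_eq (cder_cexp (cder_scale (- m) (cder_mul h h)))).
by rewrite /gau1 /gau; ring.
Qed.

Lemma cder_gau1 m y t : cder (gau1 m y) t (alpha s t * gau2 m y t).
Proof.
have h := cder_zcB y t.
apply: (cder_eq (cder_mul (cder_scale (- 2 * m) h) (cder_gau m y t))).
by rewrite /gau2 /gau1; ring.
Qed.

Lemma ccont1M (P Q : R -> R[i]) : ccont1 P -> ccont1 Q -> ccont1 (fun t => P t * Q t).
Proof.
move=> [v1 v2] [w1 w2]; split.
  rewrite (_ : (fun x => _) = fun x => Rec (P x) * Rec (Q x) - Imc (P x) * Imc (Q x)).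
    by move=> x; apply: cvgB; apply: cvgM; [exact: v1|exact: w1|exact: v2|exact: w2].
  by apply/funext => x; rewrite RecM.
rewrite (_ : (fun x => _) = fun x => Rec (P x) * Imc (Q x) + Imc (P x) * Rec (Q x)).
  by move=> x; apply: cvgD; apply: cvgM; [exact: v1|exact: w2|exact: v2|exact: w1].
by apply/funext => x; rewrite ImcM.
Qed.

Lemma ccont1_alpha : ccont1 (alpha s).
Proof. by split => t /=; [exact: cvg_cst|exact: (contour_abs hc).1]. Qed.

Lemma ccont1_zcB y : ccont1 (fun t => zc t - zc y).
Proof. exact: cder_cont1 (cder_zcB y). Qed.

Lemma ccont1_gau m y : ccont1 (gau m y).
Proof. exact: cder_cont1 (cder_gau m y). Qed.

Lemma ccont1_gau1 m y : ccont1 (gau1 m y).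
Proof. exact: cder_cont1 (cder_gau1 m y). Qed.

Lemma ccont1_cst (c : R[i]) : ccont1 (fun=> c).
Proof. exact: cder_cont1 (cder_cst c). Qed.

Lemma ccont1_add (P Q : R -> R[i]) : ccont1 P -> ccont1 Q -> ccont1 (fun t => P t + Q t).
Proof.
move=> [v1 v2] [w1 w2]; split.
  rewrite (_ : (fun x => _) = fun x => Rec (P x) + Rec (Q x)).
    by move=> x; apply: cvgD; [exact: v1|exact: w1].
  by apply/funext => x; rewrite RecD.
rewrite (_ : (fun x => _) = fun x => Imc (P x) + Imc (Q x)).
  by move=> x; apply: cvgD; [exact: v2|exact: w2].
by apply/funext => x; rewrite ImcD.
Qed.

Lemma ccont1_gau2 m y : ccont1 (gau2 m y).
Proof.
apply: ccont1M; last exact: ccont1_gau.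
apply: ccont1_add; last exact: ccont1_cst.
apply: ccont1M; first exact: ccont1_cst.
by apply: ccont1M; exact: ccont1_zcB.
Qed.

(* The loss [c] is needed because [S t - sig * t] is only bounded. *)
Definition decaying (m : R[i]) (lam c : R) := forall t y : R,
  lam * (t - y) ^+ 2 - c <= Rec (m * ((zc t - zc y) * (zc t - zc y))).

Lemma nrm_gau m lam c y t : decaying m lam c ->
  nrm (gau m y t) <= 2 * expR c * expR (- (lam * (t - y) ^+ 2)).
Proof.
move=> /(_ t y) h; apply: le_trans (nrm_cexp _) _.
rewrite -mulrA -expRD ler_wpM2l// ler_expR mulNr RecN; lra.
Qed.

(** Peetre's inequality; the identity in the proof displays the difference of the two sides as a sum
    of squares. *)
Lemma env_shift (y t : R) : env (t - y) <= 2 * (1 + y ^+ 2) * env t.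
Proof.
rewrite /env ler_pdivlMr; last by have := sqr_ge0 t; lra.
rewrite mulrC ler_pdivrMr; last by have := sqr_ge0 (t - y); lra.
have -> : 2 * (1 + y ^+ 2) * (1 + (t - y) ^+ 2) =
  1 + t ^+ 2 + ((t - 2 * y) ^+ 2 + 1 + 2 * (y * (t - y)) ^+ 2) by ring.
by rewrite lerDl !addr_ge0 ?sqr_ge0// mulr_ge0 ?sqr_ge0.
Qed.

(** Squaring [c (1 + u^2) <= 1 + lam u^2 / 2 <= exp(lam u^2 / 2)] gains two powers of [1 + u^2], one
    for the weight and one for [env]. *)
Lemma exp_sqr_env (lam : R) : 0 < lam -> exists C : R, forall u : R,
  (1 + u ^+ 2) * expR (- (lam * u ^+ 2)) <= C * env u.
Proof.
move=> l0; pose c := Num.min 1 (lam / 2).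
have c0 : 0 < c by rewrite lt_min ltr01 divr_gt0.
exists ((c ^+ 2)^-1) => u.
have u0 := sqr_ge0 u.
have h1 : c * (1 + u ^+ 2) <= expR (lam * u ^+ 2 / 2).
  apply: le_trans (expR_ge1Dx _); rewrite mulrDr mulr1 lerD//.
    by rewrite ge_min lexx.
  by rewrite mulrAC ler_wpM2r// ge_min lexx orbT.
have p0 : 0 < 1 + u ^+ 2 by lra.
rewrite expRN ler_pdivrMr ?expR_gt0// /env.
have e2 : expR (lam * u ^+ 2) = expR (lam * u ^+ 2 / 2) ^+ 2.
  by rewrite [RHS]expr2 -expRD -splitr.
have : (c * (1 + u ^+ 2)) ^+ 2 <= expR (lam * u ^+ 2).
  by rewrite e2 ler_sqr ?nnegrE ?expR_ge0// mulr_ge0// ltW.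
rewrite exprMn mulrC => h.
rewrite -invfM mulrC ler_pdivlMr ?mulr_gt0 ?exprn_gt0//.
by apply: le_trans h; rewrite le_eqVlt; apply/orP; left; apply/eqP; ring.
Qed.

(** The constant is chosen before [m], so that one envelope serves a whole piece of the path. The
    weight [1 + (t - y)^2] pays for the polynomial factors of the derivatives. *)
Lemma gau_envelope lam c y : 0 < lam -> exists C : R, forall m, decaying m lam c ->
  forall t, (1 + (t - y) ^+ 2) * nrm (gau m y t) <= C * env t.
Proof.
move=> l0; have [C HC] := exp_sqr_env l0.
have C0 : 0 <= C.
  have := HC 0; rewrite expr0n /= mulr0 oppr0 expR0 addr0 mul1r /env expr0n /= addr0 invr1 mulr1.
  by apply: le_trans.
exists (2 * expR c * C * (2 * (1 + y ^+ 2))) => m hm t.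
have h1 : 0 <= 1 + (t - y) ^+ 2 by have := sqr_ge0 (t - y); lra.
apply: le_trans (ler_wpM2l h1 (nrm_gau y t hm)) _.
have -> : 2 * expR c * C * (2 * (1 + y ^+ 2)) * env t =
  2 * expR c * (C * (2 * (1 + y ^+ 2) * env t)) by ring.
rewrite mulrCA ler_wpM2l ?mulr_ge0 ?expR_ge0//.
by apply: le_trans (HC _) _; rewrite ler_wpM2l//; exact: env_shift.
Qed.

End GaussianBounds.

(** * Tensor products as H^1 test functions *)

Section TensorTest.
Context {R : realType}.
Local Notation mu := (@leb2 R).
Implicit Types (P Q : R -> R[i]) (v : R * R -> R[i]).

Definition ctens P Q (x : R * R) : R[i] := P x.1 * Q x.2.

Lemma ccont_comp P (a : R * R -> R) : continuous a -> ccont1 P -> ccont (fun x => P (a x)).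
Proof.
move=> ca [c1 c2]; split => x.
  by apply: (@continuous_comp _ _ _ a (fun t => Rec (P t))); [exact: ca|exact: c1].
by apply: (@continuous_comp _ _ _ a (fun t => Imc (P t))); [exact: ca|exact: c2].
Qed.

Lemma ccont_ctens P Q : ccont1 P -> ccont1 Q -> ccont (ctens P Q).
Proof.
move=> cP cQ; apply: ccontM; apply: ccont_comp => //;
  [exact: continuous_fst2|exact: continuous_snd2].
Qed.

Lemma cL2_ctens P Q (C C' : R) : ccont1 P -> ccont1 Q ->
  (forall t, nrm (P t) <= C * env t) -> (forall t, nrm (Q t) <= C' * env t) ->
  cL2 mu (ctens P Q).
Proof.
move=> cP cQ bP bQ; apply: (cL2_dom _ (Lfun2Z (C * C') Lfun2_env2)).
  exact/ccont_cmeas/ccont_ctens.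
move=> x; apply: le_trans (nrmM _ _) _.
apply: le_trans (ler_pM (nrm_ge0 _) (nrm_ge0 _) (bP x.1) (bQ x.2)) _.
by rewrite le_eqVlt; apply/orP; left; apply/eqP; ring.
Qed.

Lemma H1_ctens P Q (P' Q' : R -> R[i]) (C : R) :
  (forall u, cder P u (P' u)) -> (forall u, cder Q u (Q' u)) ->
  ccont1 P' -> ccont1 Q' ->
  (forall t, nrm (P t) <= C * env t) -> (forall t, nrm (P' t) <= C * env t) ->
  (forall t, nrm (Q t) <= C * env t) -> (forall t, nrm (Q' t) <= C * env t) ->
  H1_grad (ctens P Q) (ctens P' Q) (ctens P Q').
Proof.
move=> dP dQ cP' cQ' bP bP' bQ bQ'.
have cP := cder_cont1 dP; have cQ := cder_cont1 dQ.
split; try by apply: cL2_ctens; eauto.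
- apply: weak_partial1; try exact: ccont_ctens.
  move=> x; have [h1 h2] := cder_mul (dP x.1) (cder_cst (Q x.2) x.1).
  rewrite mulr0 addr0 in h1 h2.
  by split; apply/is_derive_dir1.
- apply: weak_partial2; try exact: ccont_ctens.
  move=> x; have [h1 h2] := cder_mul (cder_cst (P x.1) x.2) (dQ x.2).
  rewrite mul0r add0r in h1 h2.
  by split; apply/is_derive_dir2.
Qed.

Lemma cI_conj v : cable mu v -> cI mu (fun x => Num.conj (v x)) = Num.conj (cI mu v).
Proof.
move=> [i1 i2]; apply: ReIm_eq; rewrite -[Num.conj (cI _ _)]/((cI mu v)^*)%C ?Rec_conj ?Imc_conj /=.
  by apply: eq_Rintegral => x _; rewrite -[Num.conj _]/((v x)^*)%C Rec_conj.
rewrite -mulN1r -RintegralZl//; apply: eq_Rintegral => x _.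
by rewrite -[Num.conj _]/((v x)^*)%C Imc_conj mulN1r.
Qed.

Lemma weak_partial_conj (e : R * R) v d : (e = (@dir1 R) \/ e = (@dir2 R)) ->
  cL2 mu v -> cL2 mu d -> weak_partial e v d ->
  weak_partial e (fun x => Num.conj (v x)) (fun x => Num.conj (d x)).
Proof.
move=> he iv id wd phi tphi; have [i1 i2] := cL2_test he tphi.
have E (a : R * R -> R[i]) (r : R * R -> R) : cL2 mu a -> cL2 mu (fun x => (r x)%:C) ->
    cint (fun x => Num.conj (a x) * (r x)%:C) = Num.conj (cint (fun x => a x * (r x)%:C)).
  move=> ia ir; rewrite !cintE -cI_conj; last exact: cL2_mul.
  apply: cI_eq => x; rewrite rmorphM; congr (_ * _).
  by apply: esym; exact: conjc_real.
by rewrite E// E// wd// rmorphN.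
Qed.

Lemma H1_conj v e1 e2 : H1_grad v e1 e2 ->
  H1_grad (fun x => Num.conj (v x)) (fun x => Num.conj (e1 x)) (fun x => Num.conj (e2 x)).
Proof.
move=> [iv i1 i2 h1 h2]; split; try exact: cL2_conj.
- by apply: weak_partial_conj => //; left.
- by apply: weak_partial_conj => //; right.
Qed.

End TensorTest.

Section GaussianEnvelope.
Context {R : realType} (sig K : R) (s S : R -> R) (hc : contour sig s S K).

Lemma env_le_scale (C C' : R) t : C <= C' -> C * env t <= C' * env t.
Proof. by move=> h; rewrite ler_wpM2r// ltW// env_gt0. Qed.

Lemma gau_bounds m lam c y : 0 < lam -> decaying S m lam c -> exists2 C : R, 0 <= C &
  [/\ forall t, nrm (gau S m y t) <= C * env t,
      forall t, nrm (gau1 S m y t) <= C * env t,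
      forall t, nrm (gau2 S m y t) <= C * env t &
   [/\ forall t, nrm (alpha s t * gau S m y t) <= C * env t,
      forall t, nrm (alpha s t * gau1 S m y t) <= C * env t &
      forall t, nrm (alpha s t * gau2 S m y t) <= C * env t]].
Proof.
move=> l0 hm; have [C /(_ _ hm) HC] := gau_envelope S c y l0.
have C0 : 0 <= C.
  have := HC y; rewrite subrr expr0n /= addr0 mul1r => /(le_trans (nrm_ge0 _)).
  by rewrite pmulr_lge0// env_gt0.
have sig0 := contour_gt0 hc.
(* Up to the weight [1 + (t - y)^2], [a] dominates 1 and the polynomial factors of both [gau1] and
   [gau2]. *)
pose a := nrm (- 2 * m) * (1 + sig) + (nrm (4 * m * m) * ((1 + sig) * (1 + sig)) + nrm (- (2 * m))) + 1.
have n1 := nrm_ge0 (- 2 * m); have n2 := nrm_ge0 (4 * m * m); have n3 := nrm_ge0 (- (2 * m)).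
have s1 : 0 <= 1 + sig by lra.
have p1 : 0 <= nrm (- 2 * m) * (1 + sig) by rewrite mulr_ge0.
have p2 : 0 <= nrm (4 * m * m) * ((1 + sig) * (1 + sig)) by rewrite !mulr_ge0.
have a1 : 1 <= a by rewrite /a; lra.
have a0 : 0 <= a by lra.
have gen (u : R[i]) t : nrm u <= a * (1 + (t - y) ^+ 2) -> nrm (u * gau S m y t) <= a * C * env t.
  move=> hu; apply: le_trans (nrmM _ _) _.
  apply: (@le_trans _ _ (a * (1 + (t - y) ^+ 2) * nrm (gau S m y t))).
    by rewrite ler_wpM2r// nrm_ge0.
  by rewrite -!mulrA ler_wpM2l.
have g0 t : nrm (gau S m y t) <= a * C * env t.
  rewrite -[gau _ _ _ _]mul1r; apply: gen; rewrite (nrm_real (1 : R)) normr1.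
  by apply: le_trans a1 _; rewrite ler_peMr//; have := sqr_ge0 (t - y); lra.
have absle t : `|t - y| <= 1 + (t - y) ^+ 2.
  rewrite -real_normK ?num_real//; have := sqr_ge0 (`|t - y| - 1); rewrite sqrrB1.
  have := normr_ge0 (t - y); have := sqr_ge0 `|t - y|; rewrite mulr2n; lra.
have g1 t : nrm (gau1 S m y t) <= a * C * env t.
  apply: gen; apply: le_trans (nrmM _ _) _.
  apply: le_trans (ler_wpM2l n1 (nrm_zcB hc t y)) _.
  rewrite mulrA; apply: ler_pM => //; rewrite /a; lra.
have g2 t : nrm (gau2 S m y t) <= a * C * env t.
  apply: gen; apply: le_trans (nrmD _ _) _.
  have h : nrm ((zc S t - zc S y) * (zc S t - zc S y)) <= (1 + sig) * (1 + sig) * (t - y) ^+ 2.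
    apply: le_trans (nrmM _ _) _.
    apply: le_trans (ler_pM (nrm_ge0 _) (nrm_ge0 _) (nrm_zcB hc t y) (nrm_zcB hc t y)) _.
    by rewrite -[(t - y) ^+ 2]real_normK ?num_real// expr2 le_eqVlt; apply/orP; left; apply/eqP; ring.
  have h' := le_trans (nrmM (4 * m * m) _) (ler_wpM2l n2 h).
  have q0 := sqr_ge0 (t - y).
  apply: (@le_trans _ _ (nrm (4 * m * m) * ((1 + sig) * (1 + sig) * (t - y) ^+ 2) + nrm (- (2 * m)))).
    by rewrite lerD2r.
  rewrite /a mulrA; move: p1 p2 n3 q0.
  move: (nrm (- 2 * m) * (1 + sig)) => A; move: (nrm (4 * m * m) * ((1 + sig) * (1 + sig))) => B.
  move: (nrm (- (2 * m))) ((t - y) ^+ 2) => D q *; nra.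
have ga (u : R[i]) t : nrm u <= a * C * env t -> nrm (alpha s t * u) <= (1 + sig) * (a * C) * env t.
  move=> hu; apply: le_trans (nrmM _ _) _; rewrite -mulrA; apply: ler_pM => //; try exact: nrm_ge0.
  exact: nrm_alpha (contour_abs hc).
have le t : a * C * env t <= (1 + sig) * (a * C) * env t.
  by apply: env_le_scale; rewrite ler_peMl ?mulr_ge0//; lra.
exists ((1 + sig) * (a * C)); first by rewrite !mulr_ge0.
split; [| | |split] => t; try exact: ga; exact: le_trans (le t).
Qed.

End GaussianEnvelope.

(** * The weak equation tested on Gaussians *)

Section GaussianTest.
Context {R : realType} (chi : R -> R) (hchi : smooth_step chi).
Variables (k sig K1 K2 : R) (s1 s2 S1 S2 : R -> R).
Hypotheses (hc1 : contour sig s1 S1 K1) (hc2 : contour sig s2 S2 K2).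
Variables (w g : R * R -> R[i]).
Hypotheses (hw : pml_eq k s1 s2 w g) (g0 : {ae (@leb2 R), forall x, g x = 0}).
Local Notation mu := (@leb2 R).

(** The factor [alpha] produced by differentiating along the contour cancels the denominator of
    [A11] or [A22]. Moving the derivative off [w] then yields a second [alpha], and the two gradient
    terms combine into [J w] against the stretched Laplacian of the Gaussian. *)
Lemma pml_gaussian m lam c (y1 y2 : R) : 0 < lam ->
  decaying S1 m lam c -> decaying S2 m lam c ->
  cint (fun x => J s1 s2 x * w x * (gau S1 m y1 x.1 * gau S2 m y2 x.2 *
    (4 * m * m * ((zc S1 x.1 - zc S1 y1) * (zc S1 x.1 - zc S1 y1) +
                  (zc S2 x.2 - zc S2 y2) * (zc S2 x.2 - zc S2 y2)) - 4 * m
     + (k ^+ 2)%:C))) = 0.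
Proof.
move=> l0 h1 h2.
have [C1 C10 [a0 a1 a2 [a3 a4 a5]]] := gau_bounds hc1 y1 l0 h1.
have [C2 C20 [b0 b1 b2 [b3 b4 b5]]] := gau_bounds hc2 y2 l0 h2.
pose C := C1 + C2.
have up1 (u : R -> R[i]) : (forall t, nrm (u t) <= C1 * env t) -> forall t, nrm (u t) <= C * env t.
  by move=> h t; apply: le_trans (h t) _; apply: env_le_scale; rewrite lerDl.
have up2 (u : R -> R[i]) : (forall t, nrm (u t) <= C2 * env t) -> forall t, nrm (u t) <= C * env t.
  by move=> h t; apply: le_trans (h t) _; apply: env_le_scale; rewrite lerDr.
have cA1 := ccont1_alpha hc1; have cA2 := ccont1_alpha hc2.
have cg1 := ccont1_gau hc1 m y1; have cg2 := ccont1_gau hc2 m y2.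
have cg11 := ccont1_gau1 hc1 m y1; have cg12 := ccont1_gau1 hc2 m y2.
have cg21 := ccont1_gau2 hc1 m y1; have cg22 := ccont1_gau2 hc2 m y2.
have [ig [d1 [d2 [[iw i1 i2 wd1 wd2] eqw]]]] := hw.
have hH := H1_ctens (cder_gau hc1 m y1) (cder_gau hc2 m y2)
  (ccont1M cA1 cg11) (ccont1M cA2 cg12) (up1 _ a0) (up1 _ a4) (up2 _ b0) (up2 _ b4).
(* The weak form conjugates its test function; inserting the conjugate makes the Gaussian itself
   appear. *)
have := eqw _ _ _ (H1_conj hH).
have [iv j1 j2 _ _] := hH.
rewrite !cintE.
have KK (z : R[i]) : Num.conj (Num.conj z) = z by exact: conjCK.
set E1 := cI _ _; set E2 := cI _ _; set E3 := cI _ _.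
have -> : E3 = 0.
  apply: cI_ae0.
    apply: cmeasM; last first.
      apply: cmeas_conj; apply: cmeas_conj; exact: cL2_meas iv.
    apply: cmeasM; last exact: cL2_meas ig.
    apply/ccont_cmeas/ccont_J; first exact: (contour_abs hc1).1.
    exact: (contour_abs hc2).1.
  by apply: ae_imply g0 => x ->; rewrite mulr0 mul0r.
rewrite oppr0.
have ab1 := contour_abs hc1; have ab2 := contour_abs hc2.
have cc1 := ab1.1; have cc2 := ab2.1.
have I1 : cL2 mu (ctens (gau1 S1 m y1) (fun t => alpha s2 t * gau S2 m y2 t)).
  exact: cL2_ctens (ccont1M cA2 cg2) a1 b3.
have I2 : cL2 mu (fun x => gau1 S2 m y2 x.2 * (alpha s1 x.1 * gau S1 m y1 x.1)).
  have := cL2_ctens (ccont1M cA1 cg1) cg12 a3 b1.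
  by congr cL2; apply/funext => x; rewrite /ctens mulrC.
have T1 := weak_partial1_decaying hchi iw i1 wd1 (cder_gau1 hc1 m y1)
  (ccont1M cA1 cg21) (ccont1M cA2 cg2) (up1 _ a1) (up1 _ a5) (up2 _ b3).
have T2 := weak_partial2_decaying hchi iw i2 wd2 (cder_gau1 hc2 m y2)
  (ccont1M cA2 cg22) (ccont1M cA1 cg1) (up2 _ b1) (up2 _ b5) (up1 _ a3).
(* The cancellation is [A11 * alpha s1 = alpha s2] and [A22 * alpha s2 = alpha s1]. *)
have -> : E1 = cint (fun x => d1 x * (gau1 S1 m y1 x.1 * (alpha s2 x.2 * gau S2 m y2 x.2))) +
   cint (fun x => d2 x * (gau1 S2 m y2 x.2 * (alpha s1 x.1 * gau S1 m y1 x.1))).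
  rewrite !cintE -cID; [|exact: cL2_mul i1 I1|exact: cL2_mul i2 I2].
  apply: cI_eq => x; rewrite !KK /A11 /A22 /ctens.
  have n1 := alpha_neq0 s1 x.1; have n2 := alpha_neq0 s2 x.2.
  by field; rewrite n1 n2.
have F (a b : R[i]) : a = - b -> b = - a by move=> ->; rewrite opprK.
rewrite (F _ _ T1) (F _ _ T2) !cintE -opprD -opprD => /eqP; rewrite oppr_eq0 => /eqP <-.
have M1 : cL2 mu (ctens (fun t => alpha s1 t * gau2 S1 m y1 t) (fun t => alpha s2 t * gau S2 m y2 t)).
  exact: cL2_ctens (ccont1M cA1 cg21) (ccont1M cA2 cg2) a5 b3.
have M2 : cL2 mu (fun x => alpha s2 x.2 * gau2 S2 m y2 x.2 * (alpha s1 x.1 * gau S1 m y1 x.1)).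
  have := cL2_ctens (ccont1M cA1 cg1) (ccont1M cA2 cg22) a3 b5.
  by congr cL2; apply/funext => x; rewrite /ctens mulrC.
have M3 : cable mu (fun x => J s1 s2 x * w x * Num.conj (Num.conj (ctens (gau S1 m y1) (gau S2 m y2) x))).
  by apply: cL2_mul; [exact: (cL2_J ab1 ab2 iw)|exact: cL2_conj (cL2_conj iv)].
rewrite -cID; [|exact: cL2_mul iw M1|exact: cL2_mul iw M2].
rewrite -cIZ// -cID; [|by apply: cableD; [exact: cL2_mul iw M1|exact: cL2_mul iw M2]|exact: cableZ].
by apply: cI_eq => x; rewrite KK /ctens /gau2 /J; ring.
Qed.

End GaussianTest.

Section DerivativeUnder.
Context {R : realType} d {Y : measurableType d} (mu : {measure set Y -> \bar R}).

Lemma Rintegral_der_under (f f' : R -> Y -> R) (T : R) (G : Y -> R) :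
  (forall r, `|r| < T -> rint mu (f r)) ->
  (forall r y, `|r| < T -> is_derive r (1 : R) (f ^~ y) (f' r y)) ->
  (forall r y, `|r| < T -> `|f' r y| <= G y) -> rint mu G ->
  forall r, `|r| < T ->
    is_derive r (1 : R) (fun r => \int[mu]_y f r y) (\int[mu]_y f' r y).
Proof.
move=> intf df bf iG r rT.
have inI x : `]- T, T[%classic x -> `|x| < T by rewrite /= in_itv/= ltr_norml.
have It : `]- T, T[%classic r by rewrite /= in_itv/= -ltr_norml.
have G0 y : 0 <= G y by exact: le_trans (normr_ge0 _) (bf r y rT).
have H1 : forall x, `]- T, T[%classic x -> mu.-integrable setT (EFin \o f x).
  by move=> x /inI; exact: intf.
have H2 : forall x y, `]- T, T[%classic x -> setT y -> derivable (f ^~ y) x 1.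
  by move=> x y /inI xT _; have [] := df x y xT.
have H3 : forall x y, `]- T, T[%classic x -> setT y -> `|partial1of2 f x y| <= G y.
  by move=> x y /inI xT _; rewrite /partial1of2 (der_derive1 (df x y xT)); exact: bf.
split; first exact: (derivable_under_integral measurableT It H1 H2 G0 iG H3).
rewrite -derive1E (differentiation_under_integral measurableT It H1 H2 G0 iG H3).
by apply: eq_Rintegral => y _; rewrite /partial1of2 (der_derive1 (df r y rT)).
Qed.

Lemma cI_der_under (h h' : R -> Y -> R[i]) (T : R) (G : Y -> R) :
  (forall r, `|r| < T -> cable mu (h r)) ->
  (forall r y, `|r| < T -> cder (h ^~ y) r (h' r y)) ->
  (forall r y, `|r| < T -> nrm (h' r y) <= G y) -> rint mu G ->
  forall r, `|r| < T -> cder (fun r => cI mu (h r)) r (cI mu (h' r)).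
Proof.
move=> ih dh bh iG r rT; split => /=.
  apply: (Rintegral_der_under (f := fun r y => Rec (h r y)) (f' := fun r y => Rec (h' r y)) (T := T) (G := G)) => //.
  - by move=> x xT; have [] := ih x xT.
  - by move=> x y xT; have [] := dh x y xT.
  - by move=> x y xT; apply: le_trans (bh x y xT); exact: Rec_le_nrm.
apply: (Rintegral_der_under (f := fun r y => Imc (h r y)) (f' := fun r y => Imc (h' r y)) (T := T) (G := G)) => //.
- by move=> x xT; have [] := ih x xT.
- by move=> x y xT; have [] := dh x y xT.
- by move=> x y xT; apply: le_trans (bh x y xT); exact: Imc_le_nrm.
Qed.

End DerivativeUnder.

(** * The path of complex Gaussian parameters *)

Section HeatParameter.
Context {R : realType} (sig eps : R) (sig0 : 0 < sig) (eps0 : 0 < eps).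

Definition alpha0 : R[i] := 1 +i* sig.
(** Four times the complex heat time. The path is even in [r] and keeps the Gaussians decaying for
    both signs of [r], so that two-sided derivatives can be used at [r = 0]. *)
Definition cpath (r : R) : R[i] := alpha0 * (eps +i* (4 * r ^+ 2)).
Definition mpath (r : R) : R[i] := (cpath r)^-1.

Let den (r : R) : R := eps ^+ 2 + (4 * r ^+ 2) ^+ 2.

Let den_gt0 r : 0 < den r.
Proof. by rewrite ltr_pwDl ?exprn_gt0 ?sqr_ge0. Qed.

Lemma cpath_neq0 r : cpath r != 0.
Proof.
by rewrite mulf_neq0// eq_complex /= ?oner_eq0// (gt_eqF eps0).
Qed.

Lemma mpathE r : mpath r =
  ((eps - sig * (4 * r ^+ 2)) / ((1 + sig ^+ 2) * den r)) +i*
  - ((sig * eps + 4 * r ^+ 2) / ((1 + sig ^+ 2) * den r)).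
Proof.
have h1 := lt0r_neq0 (sqr1_gt0 sig); have h2 := lt0r_neq0 (den_gt0 r).
apply: (mulIf (cpath_neq0 r)); rewrite mulVf ?cpath_neq0//.
by rewrite /den in h2 *; apply: ReIm_eq; rewrite !ReImE /=; field; rewrite h1 h2.
Qed.

Lemma nrm_mpath r : nrm (mpath r) <= 4 / eps.
Proof.
have a2 : nrm (alpha0^-1) <= 2.
  apply: (@nrm_alphaV R sig (fun=> sig) 0); split; first by move=> x; exact: cvg_cst.
  by move=> t; rewrite lexx ltW.
rewrite /mpath /cpath invfM; apply: le_trans (nrmM _ _) _.
(* One factor 2 for the inverse of [alpha0], one for that of [eps + 4 i r^2]. *)
have -> : 4 / eps = 2 * (2 / eps) by rewrite mulrA -natrM.
apply: ler_pM => //; try exact: nrm_ge0.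
rewrite complexV /= /nrm /= normrN.
have q0 : 0 <= 4 * r ^+ 2 by rewrite mulr_ge0// sqr_ge0.
have d0 := den_gt0 r; rewrite /den in d0.
rewrite !ger0_norm ?divr_ge0 ?(ltW eps0) ?(ltW d0)//.
rewrite -mulrDl ler_pdivrMr// mulrAC ler_pdivlMr//.
move: q0; move: (4 * r ^+ 2) => q q0.
have := sqr_ge0 (eps - q); rewrite !expr2; have := mulr_ge0 (ltW eps0) q0; nra.
Qed.

(** On the asymptotic line the rate of decay is [(eps + 4 sig r^2) / den r]. Half of the second term
    is given up, to absorb the cross term with the deviation from that line. *)
Definition lam (r : R) : R := (eps + sig * (4 * r ^+ 2) / 2) / den r.

Lemma lam_lower (r T : R) : `|r| <= T -> eps / (eps ^+ 2 + (4 * T ^+ 2) ^+ 2) <= lam r.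
Proof.
move=> rT; have r2 : r ^+ 2 <= T ^+ 2.
  by rewrite -real_normK ?num_real// ler_sqr ?nnegrE// (le_trans _ rT).
have d0 := den_gt0 r.
apply: (@le_trans _ _ (eps / den r)).
  have dT : 0 < eps ^+ 2 + (4 * T ^+ 2) ^+ 2 := den_gt0 T.
  rewrite ler_pM2l// lef_pV2 ?posrE//.
  have q0 (x : R) : 0 <= 4 * x ^+ 2 by rewrite mulr_ge0// sqr_ge0.
  by rewrite /den lerD2l ler_sqr ?nnegrE// ler_wpM2l.
rewrite ler_pM2r ?invr_gt0// lerDl divr_ge0// mulr_ge0 ?(ltW sig0)//.
by rewrite mulr_ge0// sqr_ge0.
Qed.

(** For large [r] the rate is bounded below only by a multiple of [r^-2]; the resulting growth of
    the envelope must be offset by [psi]. *)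
Lemma lam_far (r : R) : 1 <= r -> 2 * sig / (eps ^+ 2 + 16) / r ^+ 2 <= lam r.
Proof.
move=> r1; have d0 := den_gt0 r; rewrite /lam.
have r0 : 0 < r by lra.
have r2 : 1 <= r ^+ 2 by rewrite exprn_ege1.
have e2 : 0 < eps ^+ 2 + 16 by have := sqr_ge0 eps; lra.
have -> : 2 * sig / (eps ^+ 2 + 16) / r ^+ 2 = 2 * sig / ((eps ^+ 2 + 16) * r ^+ 2).
  by field; rewrite (lt0r_neq0 e2) (lt0r_neq0 r0).
rewrite ler_pdivrMr; last by rewrite mulr_gt0// exprn_gt0.
rewrite mulrAC ler_pdivlMr//.
have p0 : 0 <= eps * ((eps ^+ 2 + 16) * r ^+ 2).
  by rewrite mulr_ge0 ?(ltW eps0)// mulr_ge0 ?sqr_ge0// ltW.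
apply: (@le_trans _ _ (sig * (4 * r ^+ 2) / 2 * ((eps ^+ 2 + 16) * r ^+ 2))); last first.
  by rewrite [leRHS]mulrDl lerDr.
have -> : sig * (4 * r ^+ 2) / 2 * ((eps ^+ 2 + 16) * r ^+ 2) =
  2 * sig * ((eps ^+ 2 + 16) * (r ^+ 2 * r ^+ 2)) by field.
rewrite ler_pM2l ?mulr_gt0// /den [leRHS]mulrDl exprMn.
have -> : 4 ^+ 2 * (r ^+ 2) ^+ 2 = 16 * (r ^+ 2 * r ^+ 2) by ring.
rewrite lerD2r -[leLHS]mulr1 ler_pM2l ?exprn_gt0//.
by rewrite -[1]mulr1 ler_pM.
Qed.

(** [eta], the deviation of a chord from slope [sig], is at most [2 K] in absolute value. Hence the
    loss contains [4 K^2] and no [r]. *)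
Lemma mpath_decaying s S (K : R) r : contour sig s S K ->
  decaying S (mpath r) (lam r) (4 * K ^+ 2 * ((eps * sig)^-1 + eps^-1)).
Proof.
move=> hc t y; pose X := t - y; pose eta := sig * X - (S t - S y).
have eK : eta ^+ 2 <= 4 * K ^+ 2.
  have h1 := contour_far hc t; have h2 := contour_far hc y.
  have e1 : eta = (S y - sig * y) - (S t - sig * t) by rewrite /eta /X; ring.
  have h3 : `|eta| <= 2 * K.
    by rewrite e1; apply: le_trans (ler_normB _ _) _; lra.
  have -> : 4 * K ^+ 2 = (2 * K) ^+ 2 by ring.
  by rewrite -real_normK ?num_real// ler_sqr ?nnegrE// (le_trans _ h3).
have eY : S t - S y = sig * X - eta by rewrite /eta; ring.
rewrite mpathE !ReImE /= -/X eY /lam.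
have q0 : 0 <= 4 * r ^+ 2 by rewrite mulr_ge0// sqr_ge0.
have d0 := den_gt0 r; move: d0; rewrite /den; move: q0; move: (4 * r ^+ 2) => q q0 d0.
have A0 := sqr1_gt0 sig.
set H := 4 * K ^+ 2 in eK *.
(* Expansion around the asymptotic line; completing the square in [X] leaves, besides the decay,
   terms in [eta^2] only. *)
have id : (eps - sig * q) / ((1 + sig ^+ 2) * (eps ^+ 2 + q ^+ 2)) *
    (X * X - (sig * X - eta) * (sig * X - eta)) -
    - ((sig * eps + q) / ((1 + sig ^+ 2) * (eps ^+ 2 + q ^+ 2))) *
    (X * (sig * X - eta) + (sig * X - eta) * X) =
    ((eps + sig * q / 2) * X ^+ 2 + sig * q / 2 * (X - 2 * eta / sig) ^+ 2 - 2 * q * eta ^+ 2 / sig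
     - (eps - sig * q) * eta ^+ 2 / (1 + sig ^+ 2)) / (eps ^+ 2 + q ^+ 2).
  by field; rewrite (lt0r_neq0 d0) (lt0r_neq0 A0) (lt0r_neq0 sig0).
rewrite id ler_pdivlMr// mulrBl mulrAC divfK ?lt0r_neq0//.
have e0 := sqr_ge0 eta; have H0 : 0 <= H by lra.
have t1 : 0 <= sig * q / 2 * (X - 2 * eta / sig) ^+ 2.
  by rewrite mulr_ge0 ?sqr_ge0// !mulr_ge0// ltW.
(* From [2 q <= (eps^2 + q^2) / eps], which removes the dependence on [r]. *)
have t2 : 2 * q * eta ^+ 2 / sig <= H * (eps * sig)^-1 * (eps ^+ 2 + q ^+ 2).
  rewrite ler_pdivrMr//.
  have -> : H / (eps * sig) * (eps ^+ 2 + q ^+ 2) * sig = H * ((eps ^+ 2 + q ^+ 2) / eps).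
    by field; rewrite (lt0r_neq0 eps0) (lt0r_neq0 sig0).
  rewrite mulrC; apply: ler_pM => //; first by rewrite mulr_ge0.
  rewrite ler_pdivlMr//; have := sqr_ge0 (eps - q); rewrite !expr2; nra.
have t3 : (eps - sig * q) * eta ^+ 2 / (1 + sig ^+ 2) <= H * eps^-1 * (eps ^+ 2 + q ^+ 2).
  have u1 : (eps - sig * q) * eta ^+ 2 <= eps * H.
    have sq : 0 <= sig * q by rewrite mulr_ge0// ltW.
    have := mulr_ge0 sq e0; have : eps * eta ^+ 2 <= eps * H by rewrite ler_pM2l.
    rewrite mulrBl; lra.
  apply: (@le_trans _ _ (eps * H)).
    rewrite ler_pdivrMr//; apply: le_trans u1 _.
    have eH : 0 <= eps * H by rewrite mulr_ge0// ltW.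
    by rewrite -[leLHS]mulr1; apply: ler_wpM2l => //; rewrite lerDl sqr_ge0.
  rewrite mulrC -mulrA ler_wpM2l// mulrC ler_pdivlMr// -expr2 lerDl; exact: sqr_ge0.
rewrite mulrDr mulrDl; lra.
Qed.

Lemma cder_mpath r : cder mpath r (- (alpha0 * (0 +i* (8 * r))) * (mpath r * mpath r)).
Proof.
apply: cder_inv; first exact: cpath_neq0.
apply: cder_scale; split => /=; first exact: der_cst.
rewrite (_ : (fun t => _) = fun t => 4 * (t * t)).
  by apply: (is_derive_eq (der_mul (der_cst 4 r) (der_mul (der_id r) (der_id r)))); ring.
by apply/funext => t; rewrite expr2.
Qed.

End HeatParameter.

(** * A conserved quantity along the path *)

Section Evolution.
Context {R : realType} (chi : R -> R) (hchi : smooth_step chi).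
Variables (k sig K1 K2 : R) (s1 s2 S1 S2 : R -> R).
Hypotheses (hc1 : contour sig s1 S1 K1) (hc2 : contour sig s2 S2 K2) (k0 : 0 < k).
Variables (w g : R * R -> R[i]).
Hypotheses (hw : pml_eq k s1 s2 w g) (g0 : {ae (@leb2 R), forall x, g x = 0}).
Variables (eps y1 y2 : R) (eps0 : 0 < eps).
Local Notation mu := (@leb2 R).
Local Notation m := (mpath sig eps).

Let sig0 : 0 < sig := contour_gt0 hc1.
Let ab1 := contour_abs hc1.
Let ab2 := contour_abs hc2.
Let ic : R[i] := Complex 0 1.
Let a0 : R[i] := alpha0 sig.
Let G1 (r t : R) : R[i] := gau S1 (m r) y1 t.
Let G2 (r t : R) : R[i] := gau S2 (m r) y2 t.
Let ZZ1 (t : R) : R[i] := (zc S1 t - zc S1 y1) * (zc S1 t - zc S1 y1).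
Let ZZ2 (t : R) : R[i] := (zc S2 t - zc S2 y2) * (zc S2 t - zc S2 y2).
Let psi (r : R) : R[i] := cexp ((ic * a0 * (k ^+ 2)%:C) * (r * r)%:C).
Let Jw (x : R * R) : R[i] := J s1 s2 x * w x.
(* [psi] is damped as [exp(- sig * k^2 * r^2)], which beats the growth in [r] of
   the other factors. *)
Let hh (r : R) (x : R * R) : R[i] := Jw x * (psi r * m r * (G1 r x.1 * G2 r x.2)).
(** Since [m' = - 8 i alpha0 r m^2] and [psi' = 2 i alpha0 k^2 r psi], all terms of the
    [r]-derivative of [hh] share the factor [2 i alpha0 r]; the bracket left over is that of
    [pml_gaussian]. *)
Let dh (r : R) (x : R * R) : R[i] := (2 * ic * a0 * r%:C * psi r * m r) *
  (Jw x * (G1 r x.1 * G2 r x.2 *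
    (4 * m r * m r * (ZZ1 x.1 + ZZ2 x.2) - 4 * m r + (k ^+ 2)%:C))).

Let cc (K : R) : R := 4 * K ^+ 2 * ((eps * sig)^-1 + eps^-1).
Let c : R := cc K1 + cc K2.

Lemma decaying_le (S : R -> R) mm (l l' e e' : R) : l <= l' -> e' <= e -> decaying S mm l' e' ->
  decaying S mm l e.
Proof.
move=> ll ee h t y; apply: le_trans (h t y).
by apply: lerB => //; rewrite ler_wpM2r// sqr_ge0.
Qed.

Let cc_ge0 K : 0 <= cc K.
Proof.
have e1 := ltW eps0; have e2 := ltW sig0.
apply: mulr_ge0; first by rewrite mulr_ge0// sqr_ge0.
by rewrite addr_ge0// invr_ge0// mulr_ge0.
Qed.

Let dec1 r : decaying S1 (m r) (lam sig eps r) c.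
Proof.
by apply: (decaying_le _ _ (mpath_decaying sig0 eps0 r hc1)) => //; rewrite lerDl.
Qed.

Let dec2 r : decaying S2 (m r) (lam sig eps r) c.
Proof.
by apply: (decaying_le _ _ (mpath_decaying sig0 eps0 r hc2)) => //; rewrite lerDr.
Qed.

Let nrm_psi r : nrm (psi r) <= 2 * expR (- (sig * k ^+ 2 * r ^+ 2)).
Proof.
apply: le_trans (nrm_cexp _) _; rewrite ler_wpM2l// ler_expR !ReImE /=.
by rewrite le_eqVlt; apply/orP; left; apply/eqP; ring.
Qed.

Let nrm_psi2 r : nrm (psi r) <= 2.
Proof.
apply: le_trans (nrm_psi r) _; rewrite -[leRHS]mulr1 ler_wpM2l// -expR0 ler_expR oppr_le0.
by rewrite mulr_ge0 ?sqr_ge0// mulr_ge0 ?sqr_ge0// ltW.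
Qed.

Let cder_psi r : cder psi r (ic * a0 * (k ^+ 2)%:C * (2 * r%:C) * psi r).
Proof.
apply: cder_cexp; apply: cder_scale; split => /=.
  by apply: (is_derive_eq (der_mul (der_id r) (der_id r))); ring.
by apply: (is_derive_eq (der_cst 0 r)); ring.
Qed.

Let cder_hh r x : cder (hh ^~ x) r (dh r x).
Proof.
have dm := cder_mpath sig eps0 r.
have e1 := cder_cexp (cder_mul (cder_cst (- 1) r) (cder_mul dm (cder_cst (ZZ1 x.1) r))).
have e2 := cder_cexp (cder_mul (cder_cst (- 1) r) (cder_mul dm (cder_cst (ZZ2 x.2) r))).
have eG1 : (fun r => cexp (-1 * (m r * ZZ1 x.1))) = G1 ^~ x.1.
  by apply/funext => u; rewrite /G1 /gau mulN1r mulNr.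
have eG2 : (fun r => cexp (-1 * (m r * ZZ2 x.2))) = G2 ^~ x.2.
  by apply/funext => u; rewrite /G2 /gau mulN1r mulNr.
have f1 := congr1 (@^~ r) eG1; have f2 := congr1 (@^~ r) eG2; cbv beta in f1, f2.
rewrite eG1 f1 in e1; rewrite eG2 f2 in e2.
have H := cder_scale (Jw x) (cder_mul (cder_mul (cder_psi r) dm) (cder_mul e1 e2)).
apply: (cder_eq H); rewrite /dh -/a0.
have -> : 0 +i* (8 * r) = 8 * ic * r%:C by apply: ReIm_eq; rewrite !ReImE /=; ring.
ring.
Qed.

Let cL2_Jw : cL2 mu Jw.
Proof. by have [_ [d1 [d2 [[iw _ _ _ _] _]]]] := hw; exact (cL2_J ab1 ab2 iw). Qed.

Let env2 (x : R * R) : R := env x.1 * env x.2.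

Let env2_ge0 x : 0 <= env2 x.
Proof. by rewrite mulr_ge0// ltW// env_gt0. Qed.

(** Locally uniform domination, needed to differentiate under the integral; the factors [ZZ1] and
    [ZZ2] come from differentiating the exponents. *)
Let uniform (T : R) : exists2 C : R, 0 <= C & forall r, `|r| <= T -> forall t,
  [/\ nrm (G1 r t) <= C * env t, nrm (G2 r t) <= C * env t,
      nrm (ZZ1 t * G1 r t) <= C * env t & nrm (ZZ2 t * G2 r t) <= C * env t].
Proof.
pose l := eps / (eps ^+ 2 + (4 * T ^+ 2) ^+ 2).
have l0 : 0 < l by rewrite divr_gt0// ltr_pwDl ?exprn_gt0 ?sqr_ge0.
have [C1 HC1] := gau_envelope S1 c y1 l0.
have [C2 HC2] := gau_envelope S2 c y2 l0.
have d1 r : `|r| <= T -> decaying S1 (m r) l c.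
  by move=> rT; exact: decaying_le (lam_lower sig0 eps0 rT) (lexx _) (dec1 r).
have d2 r : `|r| <= T -> decaying S2 (m r) l c.
  by move=> rT; exact: decaying_le (lam_lower sig0 eps0 rT) (lexx _) (dec2 r).
(* Dominates both 1 and the factor [(1 + sig)^2] produced by applying [nrm_zcB] twice. *)
pose A := 1 + (1 + sig) * (1 + sig).
have p1 : 0 <= 1 + sig by have := sig0; lra.
have A1 : 0 <= A by rewrite addr_ge0// mulr_ge0.
pose C := `|C1| + `|C2|.
have gen (S : R -> R) (s : R -> R) K y (hc : contour sig s S K) C' mm t :
    C' <= C -> (1 + (t - y) ^+ 2) * nrm (gau S mm y t) <= C' * env t ->
    nrm (gau S mm y t) <= A * C * env t /\
    nrm ((zc S t - zc S y) * (zc S t - zc S y) * gau S mm y t) <= A * C * env t.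
  move=> CC h; have q0 := sqr_ge0 (t - y); have n0 := nrm_ge0 (gau S mm y t).
  have h' : (1 + (t - y) ^+ 2) * nrm (gau S mm y t) <= C * env t.
    by apply: le_trans h _; exact: env_le_scale.
  have A1' : 1 <= A by rewrite lerDl mulr_ge0.
  split.
    apply: (@le_trans _ _ (A * ((1 + (t - y) ^+ 2) * nrm (gau S mm y t)))).
      rewrite mulrA ler_peMl//; rewrite -[1]mulr1 ler_pM//; lra.
    by rewrite -mulrA ler_wpM2l.
  apply: le_trans (nrmM _ _) _.
  have hz : nrm ((zc S t - zc S y) * (zc S t - zc S y)) <= A * (1 + (t - y) ^+ 2).
    apply: le_trans (nrmM _ _) _.
    apply: le_trans (ler_pM (nrm_ge0 _) (nrm_ge0 _) (nrm_zcB hc t y) (nrm_zcB hc t y)) _.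
    apply: (@le_trans _ _ ((1 + sig) * (1 + sig) * (t - y) ^+ 2)).
      by rewrite -[(t - y) ^+ 2]real_normK ?num_real// expr2 le_eqVlt; apply/orP; left; apply/eqP; ring.
    apply: ler_pM => //; first by rewrite mulr_ge0.
      by rewrite lerDr.
    by rewrite lerDr.
  apply: le_trans (ler_wpM2r n0 hz) _.
  by rewrite -!mulrA ler_wpM2l.
exists (A * C); first by rewrite mulr_ge0// addr_ge0.
move=> r rT t.
have le1 : C1 <= C by rewrite (le_trans (ler_norm _))// lerDl.
have le2 : C2 <= C by rewrite (le_trans (ler_norm _))// lerDr.
have [u1 u2] := gen _ _ _ y1 hc1 _ _ t le1 (HC1 _ (d1 r rT) t).
by have [v1 v2] := gen _ _ _ y2 hc2 _ _ t le2 (HC2 _ (d2 r rT) t).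
Qed.

Let cL2_G r : cL2 mu (ctens (G1 r) (G2 r)).
Proof.
have [C C0 HC] := uniform `|r|.
apply: (cL2_ctens (C := C) (C' := C)).
- exact: ccont1_gau hc1 _ _.
- exact: ccont1_gau hc2 _ _.
- by move=> t; have [] := HC r (lexx _) t.
- by move=> t; have [] := HC r (lexx _) t.
Qed.

Let cable_hh r : cable mu (hh r).
Proof.
have := cableZ (psi r * m r) (cL2_mul cL2_Jw (cL2_G r)).
by congr cable; apply/funext => x; rewrite /hh /ctens; ring.
Qed.

Let dh_bound (T : R) : 0 <= T -> exists B : R, forall r x, `|r| <= T ->
  nrm (dh r x) <= nrm (Jw x) * (B * env2 x).
Proof.
move=> T0; have [C C0 HC] := uniform T.
pose M : R := 4 / eps.
have M0 : 0 <= M by rewrite divr_ge0// ltW.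
have nm r : nrm (m r) <= M := nrm_mpath sig0 eps0 r.
pose A := nrm (2 * ic * a0).
pose B1 := nrm (4 : R[i]) * M * M * (2 * (C * C)) + (nrm (4 : R[i]) * M + k ^+ 2) * (C * C).
exists (A * T * 2 * M * B1) => r x rT.
have [u1 u2 u3 u4] := HC r rT x.1; have [v1 v2 v3 v4] := HC r rT x.2.
rewrite /dh; apply: le_trans (nrmM _ _) _.
have e0 (t : R) := ltW (env_gt0 t).
have n4 := nrm_ge0 (4 : R[i]).
have hA : nrm (2 * ic * a0 * r%:C * psi r * m r) <= A * T * 2 * M.
  apply: le_trans (nrmM _ _) _; apply: ler_pM => //; try exact: nrm_ge0.
  apply: le_trans (nrmM _ _) _; apply: ler_pM => //; try exact: nrm_ge0.
  apply: le_trans (nrmM _ _) _; apply: ler_pM => //; try exact: nrm_ge0.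
  by rewrite nrm_real.
have hB : nrm (G1 r x.1 * G2 r x.2 * (4 * m r * m r * (ZZ1 x.1 + ZZ2 x.2) - 4 * m r + (k ^+ 2)%:C))
    <= B1 * env2 x.
  have -> : G1 r x.1 * G2 r x.2 * (4 * m r * m r * (ZZ1 x.1 + ZZ2 x.2) - 4 * m r + (k ^+ 2)%:C) =
    4 * m r * m r * (ZZ1 x.1 * G1 r x.1 * G2 r x.2 + G1 r x.1 * (ZZ2 x.2 * G2 r x.2)) +
    (- (4 * m r) + (k ^+ 2)%:C) * (G1 r x.1 * G2 r x.2) by ring.
  have gg (a b : R[i]) : nrm a <= C * env x.1 -> nrm b <= C * env x.2 -> nrm (a * b) <= C * C * env2 x.
    move=> ha hb; apply: le_trans (nrmM _ _) _.
    apply: le_trans (ler_pM (nrm_ge0 _) (nrm_ge0 _) ha hb) _.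
    by rewrite le_eqVlt; apply/orP; left; apply/eqP; rewrite /env2; ring.
  apply: le_trans (nrmD _ _) _; rewrite /B1 [leRHS]mulrDl; apply: lerD.
    apply: le_trans (nrmM _ _) _; rewrite -[leRHS]mulrA; apply: ler_pM; try exact: nrm_ge0.
      apply: le_trans (nrmM _ _) _; apply: ler_pM => //; try exact: nrm_ge0.
      by apply: le_trans (nrmM _ _) _; apply: ler_pM => //; try exact: nrm_ge0.
    have -> : 2 * (C * C) * env2 x = C * C * env2 x + C * C * env2 x by ring.
    by apply: le_trans (nrmD _ _) _; apply: lerD; exact: gg.
  apply: le_trans (nrmM _ _) _; rewrite -[leRHS]mulrA; apply: ler_pM; try exact: nrm_ge0.
    apply: le_trans (nrmD _ _) _; apply: lerD; last by rewrite nrm_real ger0_norm// sqr_ge0.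
    by rewrite nrmN; apply: le_trans (nrmM _ _) _; apply: ler_wpM2l.
  exact: gg.
apply: le_trans (ler_pM (nrm_ge0 _) (nrm_ge0 _) hA (nrmM _ _)) _.
have A0 : 0 <= A * T * 2 * M.
  have hA0 : 0 <= A := nrm_ge0 _.
  by apply: mulr_ge0 => //; apply: mulr_ge0 => //; apply: mulr_ge0.
apply: le_trans (ler_wpM2l A0 (ler_wpM2l (nrm_ge0 _) hB)) _.
by rewrite le_eqVlt; apply/orP; left; apply/eqP; ring.
Qed.

Let dh0 r : cI mu (dh r) = 0.
Proof.
have l0 : 0 < lam sig eps r.
  apply: lt_le_trans (lam_lower sig0 eps0 (lexx `|r|)).
  by rewrite divr_gt0// ltr_pwDl ?exprn_gt0 ?sqr_ge0.
have E := pml_gaussian hchi hc1 hc2 hw g0 y1 y2 l0 (dec1 r) (dec2 r).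
rewrite cintE in E; rewrite cIZ ?E ?mulr0//.
have [C C0 HC] := uniform `|r|.
have z1 : ccont1 ZZ1 by apply: ccont1M; exact: ccont1_zcB hc1 y1.
have z2 : ccont1 ZZ2 by apply: ccont1M; exact: ccont1_zcB hc2 y2.
have g1 := ccont1_gau hc1 (m r) y1; have g2 := ccont1_gau hc2 (m r) y2.
have i1 : cL2 mu (ctens (fun t => ZZ1 t * G1 r t) (G2 r)).
  apply: (cL2_ctens (C := C) (C' := C)) => //; first exact: ccont1M.
    by move=> t; have [] := HC r (lexx _) t.
  by move=> t; have [] := HC r (lexx _) t.
have i2 : cL2 mu (ctens (G1 r) (fun t => ZZ2 t * G2 r t)).
  apply: (cL2_ctens (C := C) (C' := C)) => //; first exact: ccont1M.
    by move=> t; have [] := HC r (lexx _) t.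
  by move=> t; have [] := HC r (lexx _) t.
have i3 := cL2_lin (- (4 * m r) + (k ^+ 2)%:C) (cL2Z (4 * m r * m r) (cL2D i1 i2)) (cL2_G r).
have := cL2_mul cL2_Jw i3.
by congr cable; apply/funext => x; rewrite /ctens; ring.
Qed.

Let F (r : R) : R[i] := cI mu (hh r).

Let F_cst r : F r = F 0.
Proof.
have dF u : cder F u 0.
  have [B HB] := dh_bound (addr_ge0 (normr_ge0 u) ler01).
  rewrite -(dh0 u).
  apply: (@cI_der_under _ _ _ mu hh dh (`|u| + 1) (fun x => nrm (Jw x) * (B * env2 x))).
  - by move=> v _; exact: cable_hh.
  - by move=> v x _; exact: cder_hh.
  - by move=> v x vT; apply: HB; exact: ltW.
  - by apply: Lfun2_mul_integrable; [exact: cL2_nrm|exact/Lfun2Z/Lfun2_env2].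
  - by rewrite ltrDl.
apply: ReIm_eq.
  by apply: (@is_derive_0_is_cst R (fun u => Rec (F u)) r 0) => u; have [] := dF u.
by apply: (@is_derive_0_is_cst R (fun u => Imc (F u)) r 0) => u; have [] := dF u.
Qed.

(** With a rate of order [r^-2], the inequality [exp(- v) <= 1 / (1 + v)] gives an envelope growing
    like [r^2] for each coordinate. *)
Let exp_far (S : R -> R) y r t : 1 <= r -> decaying S (m r) (lam sig eps r) c ->
  nrm (gau S (m r) y t) <= 2 * expR c *
    ((Num.min 1 (2 * sig / (eps ^+ 2 + 16)))^-1 * r ^+ 2 * (2 * (1 + y ^+ 2))) * env t.
Proof.
move=> r1 hd; set q := 2 * sig / _; set b := Num.min 1 q.
have q0 : 0 < q.
  by rewrite divr_gt0 ?mulr_gt0//; have := sqr_ge0 eps; lra.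
have b0 : 0 < b by rewrite lt_min ltr01.
have r2 : 1 <= r ^+ 2 by rewrite exprn_ege1.
have r20 : 0 < r ^+ 2 by lra.
apply: le_trans (nrm_gau y t hd) _; rewrite -[leRHS]mulrA.
rewrite ler_wpM2l ?mulr_ge0 ?expR_ge0//.
have qr : q / r ^+ 2 <= lam sig eps r := lam_far sig0 eps0 r1.
have X0 := sqr_ge0 (t - y).
have qr0 : 0 <= q / r ^+ 2 by apply: divr_ge0; exact: ltW.
apply: (@le_trans _ _ ((b^-1 * r ^+ 2) * env (t - y))); last first.
  rewrite -[leRHS]mulrA; apply: ler_wpM2l; last exact: env_shift.
  by rewrite mulr_ge0 ?invr_ge0 ?(ltW b0)// ltW.
rewrite /env expRN; apply: (@le_trans _ _ ((1 + q / r ^+ 2 * (t - y) ^+ 2)^-1)).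
  rewrite lef_pV2 ?posrE ?expR_gt0//.
    apply: le_trans (expR_ge1Dx _); rewrite lerD2l ler_wpM2r//.
  by rewrite ltr_pwDl// mulr_ge0.
have p0 : 0 < 1 + (t - y) ^+ 2 by lra.
have -> : b^-1 * r ^+ 2 * (1 + (t - y) ^+ 2)^-1 = (b / r ^+ 2 * (1 + (t - y) ^+ 2))^-1.
  have rn : r != 0 by rewrite lt0r_neq0//; lra.
  by field; rewrite rn (lt0r_neq0 p0) (lt0r_neq0 b0).
rewrite lef_pV2 ?posrE.
- rewrite mulrDr mulr1; apply: lerD.
    rewrite ler_pdivrMr// mul1r; apply: le_trans r2; by rewrite ge_min lexx.
  by rewrite ler_wpM2r// ler_wpM2r ?invr_ge0 ?(ltW r20)// ge_min lexx orbT.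
- by rewrite ltr_pwDl// mulr_ge0.
- by rewrite mulr_gt0// divr_gt0.
Qed.

(** The two envelopes cost [r^4], the factor [psi] gains [r^-6], and [m] is bounded. The constant
    value of [F] is thus arbitrarily small. *)
Let F0 : F 0 = 0.
Proof.
pose b := Num.min 1 (2 * sig / (eps ^+ 2 + 16)).
pose L y := 2 * expR c * (b^-1 * (2 * (1 + y ^+ 2))).
have kap0 : 0 < sig * k ^+ 2 by rewrite mulr_gt0// exprn_gt0.
have b0 : 0 < b.
  by rewrite lt_min ltr01 divr_gt0 ?mulr_gt0//; have := sqr_ge0 eps; lra.
have L0 y : 0 <= L y.
  apply: mulr_ge0; first by rewrite mulr_ge0// expR_ge0.
  apply: mulr_ge0; first by rewrite invr_ge0 ltW.
  by apply: mulr_ge0 => //; have := sqr_ge0 y; lra.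
pose A := 2 * (6 / (sig * k ^+ 2) ^+ 3) * (4 / eps) * (L y1 * L y2).
pose I := \int[mu]_x (nrm (Jw x) * env2 x).
have iI : rint mu (fun x => nrm (Jw x) * env2 x).
  by apply: Lfun2_mul_integrable; [exact: cL2_nrm|exact: Lfun2_env2].
have H r : 1 <= r -> nrm (F 0) <= 2 * (A * I) / r.
  move=> r1; rewrite -(F_cst r).
  have r0 : 0 < r by lra.
  have hb x : nrm (hh r x) <= A / r * (nrm (Jw x) * env2 x).
    rewrite /hh; apply: le_trans (nrmM _ _) _; rewrite [leRHS]mulrCA.
    apply: ler_wpM2l; first exact: nrm_ge0.
    (* The cubic term of the exponential series, [v^3 / 3! <= exp(v)] with [v = sig k^2 r^2], is the
       lowest power of [v] whose inverse beats [r^4]. *)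
    have hpsi : nrm (psi r) <= 2 * (6 / (sig * k ^+ 2) ^+ 3) / r ^+ 6.
      apply: le_trans (nrm_psi r) _; rewrite -[leRHS]mulrA ler_wpM2l//.
      have v0 : 0 <= sig * k ^+ 2 * r ^+ 2 by rewrite mulr_ge0 ?sqr_ge0// ltW.
      have v1 : 0 < sig * k ^+ 2 * r ^+ 2 by rewrite mulr_gt0// exprn_gt0.
      have -> : 6 / (sig * k ^+ 2) ^+ 3 / r ^+ 6 = ((sig * k ^+ 2 * r ^+ 2) ^+ 3 / 6)^-1.
        by field; rewrite (lt0r_neq0 r0) (lt0r_neq0 sig0) (lt0r_neq0 k0).
      rewrite expRN lef_pV2 ?posrE ?expR_gt0 ?divr_gt0 ?exprn_gt0//.
      have := expR_ge1Dxn 2 v0; rewrite (_ : (3`!)%:R = 6 :> R)//; lra.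
    apply: le_trans (nrmM _ _) _.
    have hm : nrm (psi r * m r) <= 2 * (6 / (sig * k ^+ 2) ^+ 3) / r ^+ 6 * (4 / eps).
      apply: le_trans (nrmM _ _) _; apply: ler_pM => //; try exact: nrm_ge0.
      exact: nrm_mpath.
    have hg : nrm (G1 r x.1 * G2 r x.2) <= L y1 * L y2 * r ^+ 4 * env2 x.
      apply: le_trans (nrmM _ _) _.
      apply: le_trans (ler_pM (nrm_ge0 _) (nrm_ge0 _) (exp_far y1 x.1 r1 (dec1 r)) (exp_far y2 x.2 r1 (dec2 r))) _.
      by rewrite le_eqVlt; apply/orP; left; apply/eqP; rewrite /L /b /env2; ring.
    apply: le_trans (ler_pM (nrm_ge0 _) (nrm_ge0 _) hm hg) _.
    have A0 : 0 <= A * env2 x.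
      apply: mulr_ge0; last exact: env2_ge0.
      apply: mulr_ge0; last exact: mulr_ge0.
      apply: mulr_ge0; last by rewrite divr_ge0// ltW.
      by apply: mulr_ge0 => //; rewrite divr_ge0// exprn_ge0// ltW.
    have -> : 2 * (6 / (sig * k ^+ 2) ^+ 3) / r ^+ 6 * (4 / eps) * (L y1 * L y2 * r ^+ 4 * env2 x) =
        A * env2 x / r ^+ 2.
      by rewrite /A; field; rewrite (lt0r_neq0 r0) (lt0r_neq0 sig0) (lt0r_neq0 k0) (lt0r_neq0 eps0).
    (* Since [r >= 1], the bound in [r^-2] may be weakened to [1 / r], which suffices. *)
    rewrite [leRHS](_ : _ = A * env2 x / r); last by ring.
    apply: ler_wpM2l => //; rewrite lef_pV2 ?posrE ?exprn_gt0// expr2 ler_peMl// ltW//.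
  have := nrm_cI_le (cable_meas (cable_hh r)) hb (rintZ (A / r) iI).
  rewrite RintegralZl// => h; apply: le_trans h _.
  by rewrite le_eqVlt; apply/orP; left; apply/eqP; rewrite -/I; ring.
have n0 : nrm (F 0) = 0.
  apply/eqP; rewrite eq_le nrm_ge0 andbT; apply/ler_addgt0Pl => e e0; rewrite addr0.
  (* Chosen so that the bound at [r = B] is at most [e]; the added 1 ensures [1 <= B]. *)
  pose B := `|2 * (A * I)| / e + 1.
  have B1 : 1 <= B by rewrite lerDr divr_ge0// ltW.
  apply: le_trans (H B B1) _.
  rewrite ler_pdivrMr; last by lra.
  apply: le_trans (ler_norm _) _.
  by rewrite /B mulrDr mulr1 [e * _]mulrC divfK ?lt0r_neq0// lerDl ltW.
move/eqP: n0; rewrite /nrm paddr_eq0// !normr_eq0 => /andP[/eqP h1 /eqP h2].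
exact: ReIm_eq.
Qed.

Lemma pml_gaussian_orthogonal :
  cint (fun x => J s1 s2 x * w x * (gau S1 (m 0) y1 x.1 * gau S2 (m 0) y2 x.2)) = 0.
Proof.
have psi0 : psi 0 = 1.
  by rewrite /psi mulr0 (_ : (0 : R)%:C = 0)// mulr0 cexp0.
have := F0; rewrite /F.
have -> : hh 0 = fun x => m 0 * (Jw x * ctens (G1 0) (G2 0) x).
  by apply/funext => x; rewrite /hh psi0 /ctens; ring.
rewrite cIZ; last exact: cL2_mul cL2_Jw (cL2_G 0).
move/eqP; rewrite mulf_eq0 invr_eq0 (negbTE (cpath_neq0 sig eps0 0)) /= => /eqP.
by rewrite cintE.
Qed.

End Evolution.

(** * Concentration of the Gaussians *)

Section ParametricIntegral.
Context {R : realType}.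
Local Notation leb := (@lebesgue_measure R).
Local Notation lebR := (g_sigma_algebraType (@measurable _ (ocitv_type R))).

Lemma continuous_param (f : R -> R -> R) (g : R -> R) :
  (forall x, rint leb (f x)) -> (forall t, continuous (f ^~ t)) ->
  (forall x t, `|f x t| <= g t) -> rint leb g ->
  continuous (fun x => \int[leb]_t f x t).
Proof.
move=> ifx cf bf ig x0.
have := @continuity_under_integral R _ _ leb f setT measurableT (x0 - 1) (x0 + 1)
  (fun x _ => ifx x) _ g ig _ x0.
apply.
- by apply: aeW => t _ x _; exact: cf.
- by move=> x _; apply: aeW => t _; exact: bf.
- by rewrite inE /= in_itv/=; apply/andP; split; lra.
Qed.

Lemma ccont1_param (f : R -> R -> R[i]) (g : R -> R) :
  (forall x, cable leb (f x)) -> (forall t, ccont1 (f ^~ t)) ->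
  (forall x t, nrm (f x t) <= g t) -> rint leb g ->
  ccont1 (fun x => cI leb (f x)).
Proof.
move=> mf cf bf ig; split => /=.
  apply: (continuous_param (f := fun x t => Rec (f x t)) (g := g)) => //.
  - by move=> x; have [] := mf x.
  - by move=> t; have [] := cf t.
  - by move=> x t; apply: le_trans (bf x t); exact: Rec_le_nrm.
apply: (continuous_param (f := fun x t => Imc (f x t)) (g := g)) => //.
- by move=> x; have [] := mf x.
- by move=> t; have [] := cf t.
- by move=> x t; apply: le_trans (bf x t); exact: Imc_le_nrm.
Qed.

Lemma Rintegral_affine (f : R -> R) (M c x : R) : 0 < c -> continuous f ->
  (forall y, M < `|y| -> f y = 0) ->
  \int[leb]_y f y = c * \int[leb]_t f (c * t + x).
Proof.
move=> c0 cf f0; pose L := `|M| + 1.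
have L0 : 0 < L by rewrite ltr_pwDr.
have cN0 := lt0r_neq0 c0.
pose a := (- L - x) / c; pose b := (L - x) / c.
have ab : a <= b by rewrite ler_pM2r ?invr_gt0//; lra.
have Fa : c * a + x = - L by rewrite /a mulrC divfK//; ring.
have Fb : c * b + x = L by rewrite /b mulrC divfK//; ring.
have dF t := der_affine c x t.
have eF : derive1 (fun t => c * t + x) = fun=> c.
  by apply/funext => t; exact: der_derive1 (dF t).
have := @integration_by_substitution_increasing R (fun t => c * t + x) f a b ab _ _ _ _ _ _.
rewrite Fa Fb eF => E.
have out y : ~~ (- L <= y <= L) -> f y = 0.
  move=> h; apply: f0; have := ler_norm M; move: h; rewrite -ler_norml -ltNge /L; lra.
have e1 : (\int[leb]_y (f y)%:E = \int[leb]_(y in `[(- L)%R, L]) (f y)%:E)%E.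
  rewrite [RHS]integral_mkcond; apply: eq_integral => y _; rewrite /patch.
  case: ifPn => // /negP ny; rewrite out//; apply/negP => h; apply: ny.
  by apply/mem_set; rewrite /= in_itv.
rewrite /Rintegral e1 E//.
- have cg : continuous (fun t => f (c * t + x)).
    move=> t; apply: (@continuous_comp _ _ _ (fun t => c * t + x) f); last exact: cf.
    exact: der_continuous (dF t).
  have ig : rint leb (fun t => f (c * t + x)).
    apply: (continuous_vanish_rint (M := (`|x| + L) / c)) => // t.
    rewrite ltr_pdivrMr// => ht; apply: f0.
    have := ler_norm M; have : `|c * t| <= `|c * t + x| + `|x|.
      by have := ler_normB (c * t + x) x; rewrite addrK.
    rewrite normrM (ger0_norm (ltW c0)) mulrC; move: ht; rewrite /L; lra.
  rewrite -/(Rintegral leb setT (fun t => f (c * t + x))) -RintegralZl// /Rintegral; congr fine.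
  rewrite [LHS]integral_mkcond; apply: eq_integral => t _; rewrite /patch.
  case: ifPn => [_|/negP nt]; first by rewrite /= mulrC.
  rewrite out ?mulr0//; apply/negP => h; apply: nt; apply/mem_set; rewrite /= in_itv/=.
  move: h; rewrite -Fa -Fb !lerD2r !ler_pM2l//.
- by move=> u v _ _ uv; rewrite ltrD2r ltr_pM2l.
- by move=> u _; exact: cvg_cst.
- exact: is_cvg_cst.
- exact: is_cvg_cst.
- split.
  + by move=> t _; have [] := dF t.
  + by apply: cvg_at_right_filter; exact: der_continuous (dF a).
  + by apply: cvg_at_left_filter; exact: der_continuous (dF b).
- exact: continuous_subspaceT.
Qed.

Lemma cI_affine (f : R -> R[i]) (M c x : R) : 0 < c -> ccont1 f ->
  (forall y, M < `|y| -> f y = 0) ->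
  cI leb f = c%:C * cI leb (fun t => f (c * t + x)).
Proof.
move=> c0 [cf1 cf2] f0; apply: ReIm_eq; rewrite !ReImE /= mul0r ?subr0 ?addr0.
  by apply: (Rintegral_affine (f := fun y => Rec (f y)) x c0 cf1) => y /f0 ->.
by apply: (Rintegral_affine (f := fun y => Imc (f y)) x c0 cf2) => y /f0 ->.
Qed.

(** By Tonelli, the separated bound [g x * D y] makes [H] integrable on the product, as the exchange
    requires. *)
Lemma Rintegral_fubini d {X : measurableType d} (mu : {sigma_finite_measure set X -> \bar R})
    (H : X * lebR -> R) (g : X -> R) (D : R -> R) :
  measurable_fun setT H -> (forall x, 0 <= g x) -> (forall y, 0 <= D y) ->
  (forall x y, `|H (x, y)| <= g x * D y) -> rint mu g -> rint leb D ->
  \int[mu]_x \int[leb]_y H (x, y) = \int[leb]_y \int[mu]_x H (x, y).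
Proof.
move=> mH g0 D0 bH ig iD.
have mg : measurable_fun setT (fun x => (g x)%:E) by have /measurable_int := ig.
have mD : measurable_fun setT (fun x => (D x)%:E) by have /measurable_int := iD.
have mE : measurable_fun setT (EFin \o H) by exact/measurable_EFinP.
have m1 x : measurable_fun setT (fun y => H (x, y)).
  exact: measurable_fun_pair2.
have m2 y : measurable_fun setT (fun x => H (x, y)).
  exact: measurable_fun_pair1.
have i1 x : leb.-integrable setT (EFin \o (fun y => H (x, y))).
  apply: le_integrable (rintZ (g x) iD) => //; first exact/measurable_EFinP.
  move=> y _ /=; rewrite lee_fin [leRHS]ger0_norm//; exact: mulr_ge0.
have i2 y : mu.-integrable setT (EFin \o (fun x => H (x, y))).
  apply: le_integrable (rintZ (D y) ig) => //; first exact/measurable_EFinP.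
  move=> x _ /=; rewrite lee_fin [leRHS]ger0_norm; last exact: mulr_ge0.
  by rewrite mulrC.
have iH : (mu \x leb)%E.-integrable setT (EFin \o H).
  apply/integrable12ltyP => //.
  apply: (@le_lt_trans _ _ (\int[mu]_x ((g x)%:E * (\int[leb]_y D y)%:E))%E).
    apply: ge0_le_integral => //.
    - by move=> x _; apply: integral_ge0.
    - have mA : measurable_fun setT (fun z => `|(EFin \o H) z|%E) by exact: measurableT_comp.
      exact: (@measurable_fun_fubini_tonelli_F _ _ _ _ _ leb _ mA (fun z => abse_ge0 _)).
    - by apply: emeasurable_funM => //; exact: measurable_cst.
    - move=> x _; rewrite /Rintegral fineK; last exact: integrable_fin_num.
      have D0' y : [set: lebR] y -> (0 <= (D y)%:E)%E by rewrite lee_fin.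
      rewrite -(ge0_integralZl_EFin leb measurableT D0' mD (g0 x)).
      apply: ge0_le_integral => //.
      + by apply: measurableT_comp => //; exact/measurable_EFinP.
      + exact: measurable_funeM.
      + by move=> y _; rewrite /= -EFinM lee_fin.
  rewrite ge0_integralZr//; last first.
  - by rewrite lee_fin Rintegral_ge0.
  - by move=> x _; rewrite lee_fin.
  have f1 : (\int[mu]_x (g x)%:E)%E \is a fin_num by exact: integrable_fin_num.
  by rewrite -(fineK f1) -EFinM ltry.
rewrite /Rintegral.
transitivity (fine (\int[mu]_x \int[leb]_y (EFin \o H) (x, y))%E).
  congr fine; apply: eq_integral => x _; rewrite fineK//; exact: (integrable_fin_num measurableT (i1 x)).
rewrite (Fubini iH); congr fine; apply: eq_integral => y _; rewrite fineK//.
exact: (integrable_fin_num measurableT (i2 y)).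
Qed.

Lemma cI_fubini d {X : measurableType d} (mu : {sigma_finite_measure set X -> \bar R})
    (H : X * lebR -> R[i]) (g : X -> R) (D : R -> R) :
  cmeas H -> (forall x, 0 <= g x) -> (forall y, 0 <= D y) ->
  (forall x y, nrm (H (x, y)) <= g x * D y) -> rint mu g -> rint leb D ->
  cI mu (fun x => cI leb (fun y => H (x, y))) = cI leb (fun y => cI mu (fun x => H (x, y))).
Proof.
move=> [m1 m2] g0 D0 bH ig iD; apply: ReIm_eq => /=.
  apply: (Rintegral_fubini (H := fun z => Rec (H z)) m1 g0 D0) ig iD => x y.
  by apply: le_trans (bH x y); exact: Rec_le_nrm.
apply: (Rintegral_fubini (H := fun z => Imc (H z)) m2 g0 D0) ig iD => x y.
by apply: le_trans (bH x y); exact: Imc_le_nrm.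
Qed.

End ParametricIntegral.

(** * The Gaussian integral with complex parameter *)

Section GaussianIntegral.
Context {R : realType} (chi : R -> R) (hchi : smooth_step chi).
Local Notation leb := (@lebesgue_measure R).
Local Notation lebR := (g_sigma_algebraType (@measurable _ (ocitv_type R))).

(** The compactly supported case applies to [F * kappa m], and the integrands are dominated by a
    fixed multiple of [env]. *)
Lemma Rintegral_derive_decaying (F f : R -> R) (C : R) :
  (forall t, is_derive t (1 : R) F (f t)) -> continuous f ->
  (forall t, `|F t| <= C * env t) -> (forall t, `|f t| <= C * env t) ->
  \int[leb]_t f t = 0.
Proof.
move=> dF cf bF bf; have [B [HB HB']] := kappa_bound hchi.
have cF : continuous F by move=> t; exact: der_continuous (dF t).
have ck m := smooth_continuous (smooth_kappa hchi m).
have ck' m := smooth_continuous (smooth_derive1 (smooth_kappa hchi m)).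
have L : (\int[leb]_t (f t * kappa chi m t + F t * derive1 (kappa chi m) t))%R @[m --> \oo]
    --> \int[leb]_t f t.
  apply: (@real_dct R _ _ leb (fun m t => f t * kappa chi m t + F t * derive1 (kappa chi m) t) f (fun t => 2 * (C * B) * env t)).
  - move=> m; apply: continuous_measurable_fun => t.
    by apply: cvgD; apply: cvgM; [exact: cf|exact: ck|exact: cF|exact: ck'].
  - exact: continuous_measurable_fun.
  - move=> t; apply: cvg_near_cst; apply: filterS (near_norm_lt t) => m tm.
    by rewrite (kappa_in hchi tm) (kappa_derive_in hchi tm) mulr1 mulr0 addr0.
  - move=> m t; apply: le_trans (ler_normD _ _) _; rewrite (normrM (f t)) (normrM (F t)).
    have h1 := ler_pM (normr_ge0 _) (normr_ge0 _) (bf t) (HB m t).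
    have h2 := ler_pM (normr_ge0 _) (normr_ge0 _) (bF t) (HB' m t).
    by apply: le_trans (lerD h1 h2) _; rewrite le_eqVlt; apply/orP; left; apply/eqP; ring.
  - by apply: rintZ; exact: rint_env.
rewrite (_ : (fun m => _) = fun=> 0) in L; first exact: (cvg_unique _ L (cvg_cst 0)).
apply/funext => m; rewrite /Rintegral (_ : (\int[leb]_t _)%E = 0%E)//.
apply: (Rintegral_derive0 (M := m%:R + 1) (F := fun t => F t * kappa chi m t)).
- by move=> t; exact: der_mul (dF t) (smooth_derivable t (smooth_kappa hchi m)).
- move=> t; apply: cvgD; apply: cvgM; [exact: cf|exact: ck|exact: cF|exact: ck'].
- by move=> t /(kappa_out hchi) ->; rewrite mulr0.
- move=> t tm; rewrite (kappa_out hchi tm) mulr0 add0r.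
  rewrite (derive1_vanish (c := 0) (I := [set u | m%:R + 1 < `|u|])) ?mulr0//.
    have -> : [set u | m%:R + 1 < `|u|] = (@Num.norm R R) @^-1` [set y | m%:R + 1 < y] :> set R by [].
    by apply: open_comp => [x _|]; [exact: norm_continuous|exact: open_gt].
  by move=> u /= /(kappa_out hchi).
Qed.

Lemma cI_derive_decaying (F f : R -> R[i]) (C : R) :
  (forall t, cder F t (f t)) -> ccont1 f ->
  (forall t, nrm (F t) <= C * env t) -> (forall t, nrm (f t) <= C * env t) ->
  cI leb f = 0.
Proof.
move=> dF [c1 c2] bF bf; apply: ReIm_eq => /=.
  apply: (Rintegral_derive_decaying (F := fun t => Rec (F t)) (C := C)) => // t.
  - by have [] := dF t.
  - by apply: le_trans (bF t); exact: Rec_le_nrm.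
  - by apply: le_trans (bf t); exact: Rec_le_nrm.
apply: (Rintegral_derive_decaying (F := fun t => Imc (F t)) (C := C)) => // t.
- by have [] := dF t.
- by apply: le_trans (bF t); exact: Imc_le_nrm.
- by apply: le_trans (bf t); exact: Imc_le_nrm.
Qed.

Definition gint (mu : R[i]) : R[i] := cI leb (fun t => cexp (- mu * (t * t)%:C)).

Lemma nrm_cexp_sqr (mu : R[i]) t : nrm (cexp (- mu * (t * t)%:C)) <= 2 * expR (- (Rec mu * t ^+ 2)).
Proof.
apply: le_trans (nrm_cexp _) _; rewrite ler_wpM2l// ler_expR !ReImE /=.
by rewrite mulr0 subr0 mulNr expr2.
Qed.

Lemma cder_sqr (t : R) : cder (fun t : R => (t * t)%:C) t (2 * t%:C).
Proof.
split => /=.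
  by apply: (is_derive_eq (der_mul (der_id t) (der_id t))); ring.
by apply: (is_derive_eq (der_cst 0 t)); ring.
Qed.

Lemma cder_real (t : R) : cder (fun t : R => t%:C) t 1.
Proof. by split => /=; [exact: der_id|exact: der_cst]. Qed.

Lemma cexp_sqr_env (p : R) : 0 < p -> exists C : R, forall mu t, Rec mu = p ->
  nrm (cexp (- mu * (t * t)%:C)) * (1 + t ^+ 2) <= C * env t.
Proof.
move=> p0; have [C HC] := exp_sqr_env p0; exists (2 * C) => mu t e.
rewrite mulrC; apply: le_trans (ler_wpM2l _ (nrm_cexp_sqr mu t)) _.
  by have := sqr_ge0 t; lra.
by rewrite e mulrCA -mulrA ler_wpM2l.
Qed.

Lemma ccont1_cexp_sqr (mu : R[i]) : ccont1 (fun t => cexp (- mu * (t * t)%:C)).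
Proof.
exact: cder_cont1 (fun t => cder_cexp (cder_scale (- mu) (cder_sqr t))).
Qed.

Lemma ccont1_cmeas (P : R -> R[i]) : ccont1 P -> cmeas (P : lebR -> R[i]).
Proof. by move=> [c1 c2]; split; exact: continuous_measurable_fun. Qed.

Lemma ccont1_cable (P : R -> R[i]) (G : R -> R) :
  ccont1 P -> (forall t, nrm (P t) <= G t) -> rint leb G -> cable leb P.
Proof. by move=> cP bP iG; exact: (@cable_dom R _ _ leb _ _ (ccont1_cmeas cP) bP iG). Qed.

(* [mu * gint mu ^+ 2] has zero derivative in [Im mu] because
   [gint mu = 2 * mu * \int t^2 exp(- mu t^2)], and [gint] is positive at real
   [mu]. *)
Lemma gint_neq0 (mu : R[i]) : 0 < Rec mu -> gint mu != 0.
Proof.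
case: mu => p q0 /= p0.
pose m (q : R) : R[i] := p +i* q.
pose e (q t : R) : R[i] := cexp (- m q * (t * t)%:C).
pose e' (q t : R) : R[i] := - Complex 0 1 * (t * t)%:C * e q t.
have [C HC] := cexp_sqr_env p0.
have be q t : nrm (e q t) * (1 + t ^+ 2) <= C * env t by apply: HC.
have t2 (t : R) := sqr_ge0 t.
have be0 q t : nrm (e q t) <= C * env t.
  by apply: le_trans (be q t); rewrite ler_peMr ?nrm_ge0// lerDl.
have C0 : 0 <= C by have := le_trans (nrm_ge0 _) (be0 0 0); rewrite pmulr_lge0// env_gt0.
have be2 q t : nrm ((t * t)%:C * e q t) <= C * env t.
  apply: le_trans (nrmM _ _) _; apply: le_trans (be q t); rewrite mulrC ler_wpM2l ?nrm_ge0//.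
  by rewrite nrm_real -expr2 ger0_norm// lerDr.
have be' q t : nrm (e' q t) <= C * env t.
  rewrite /e' -mulrA; apply: le_trans (nrmM _ _) _; rewrite nrmN.
  have -> : nrm (Complex 0 1 : R[i]) = 1 by rewrite /nrm /= normr0 normr1 add0r.
  by rewrite mul1r.
have ce q : ccont1 (e q) by exact: ccont1_cexp_sqr.
have csq : ccont1 (fun t : R => (t * t)%:C) by exact: cder_cont1 cder_sqr.
have cid1 : ccont1 (fun t : R => t%:C) by exact: cder_cont1 cder_real.
have ie q : cable leb (e q).
  by apply: (ccont1_cable (ce q) (be0 q)); apply: rintZ; exact: rint_env.
have i2 q : cable leb (fun t => (t * t)%:C * e q t).
  apply: (ccont1_cable _ (be2 q)); last by apply: rintZ; exact: rint_env.
  exact: ccont1M.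
pose B q := cI leb (fun t => (t * t)%:C * e q t).
have dm q : cder m q (Complex 0 1) by split => /=; [exact: der_cst|exact: der_id].
have dG q : cder (fun q => cI leb (e q)) q (- Complex 0 1 * B q).
  have -> : - Complex 0 1 * B q = cI leb (e' q).
    by rewrite /B -cIZ//; apply: cI_eq => t; rewrite /e' mulrA.
  apply: (@cI_der_under _ _ _ leb e e' (`|q| + 1) (fun t => C * env t)).
  - by move=> r _; exact: ie.
  - move=> r t _; have h := cder_cexp (cder_mul (cder_scale (-1) (dm r)) (cder_cst (t * t)%:C r)).
    rewrite (_ : e ^~ t = fun q => cexp (-1 * m q * (t * t)%:C)); last first.
      by apply/funext => u; rewrite /e mulN1r.
    by apply: (cder_eq h); rewrite /e' /e !mulN1r; ring.
  - by move=> r t _; exact: be'.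
  - by apply: rintZ; exact: rint_env.
  - by rewrite ltrDl.
(* [t * e q t] is a decaying primitive of [e q t - 2 m t^2 e q t], whose integral is therefore 0. *)
have parts q : cI leb (e q) = 2 * m q * B q.
  have h t : cder (fun t => t%:C * e q t) t (e q t - 2 * m q * ((t * t)%:C * e q t)).
    have h1 := cder_mul (cder_real t) (cder_cexp (cder_scale (- m q) (cder_sqr t))).
    apply: (cder_eq h1); rewrite -/(e q t).
    have -> : (t * t)%:C = t%:C * t%:C :> R[i] by apply: ReIm_eq; rewrite !ReImE /=; ring.
    by ring.
  pose A := 1 + nrm (2 * m q).
  have A1 : 1 <= A by rewrite lerDl nrm_ge0.
  have z : cI leb (fun t => e q t - 2 * m q * ((t * t)%:C * e q t)) = 0.
    apply: (cI_derive_decaying (F := fun t => t%:C * e q t) (C := A * C) h).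
    - have c2 : ccont1 (fun t => - (2 * m q) * ((t * t)%:C * e q t)).
        by apply: ccont1M; [exact: ccont1_cst|exact: ccont1M].
      have := ccont1_add (ce q) c2; congr ccont1; apply/funext => t; ring.
    - move=> t; apply: (@le_trans _ _ (C * env t)); last first.
        by apply: env_le_scale; rewrite ler_peMl.
      apply: le_trans (nrmM _ _) _; apply: le_trans (be q t).
      rewrite mulrC ler_wpM2l ?nrm_ge0// nrm_real.
      have := sqr_ge0 (`|t| - 1); rewrite sqrrB1 real_normK ?num_real// mulr2n.
      have := normr_ge0 t; have := t2 t; lra.
    - move=> t; apply: le_trans (nrmD _ _) _; rewrite nrmN -(mulrA A) [leRHS]mulrDl mul1r; apply: lerD.
        exact: be0.
      apply: le_trans (nrmM _ _) _; apply: ler_wpM2l; first exact: nrm_ge0.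
      exact: be2.
  move: z; rewrite cID//; last by apply: cableN; exact: cableZ.
  by rewrite cIN ?cIZ//; [move/eqP; rewrite subr_eq0 => /eqP|exact: cableZ].
have mn0 q : m q != 0 by rewrite eq_complex /= (gt_eqF p0).
pose Q q := m q * (cI leb (e q) * cI leb (e q)).
have dQ q : cder Q q 0.
  apply: (cder_eq (cder_mul (dm q) (cder_mul (dG q) (dG q)))).
  by rewrite parts; ring.
have Qc : Q q0 = Q 0.
  apply: ReIm_eq.
    by apply: (@is_derive_0_is_cst R (fun u => Rec (Q u)) q0 0) => u; have [] := dQ u.
  by apply: (@is_derive_0_is_cst R (fun u => Imc (Q u)) q0 0) => u; have [] := dQ u.
have Q0 : cI leb (e 0) != 0.
  rewrite eq_complex negb_and; apply/orP; left => /=.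
  have re0 : (fun t => Rec (e 0 t)) = fun t => expR (- (p * t ^+ 2)).
    by apply/funext => t; rewrite /e /m /cexp /= expr2 oppr0 !(mulr0, mul0r) addr0 cos0 mulr1 subr0 mulNr.
  (* On [[0, 1]] the real integrand is at least [exp(- p)], and elsewhere it is nonnegative. *)
  apply: lt0r_neq0; apply: (@lt_le_trans _ _ (expR (- p))); first exact: expR_gt0.
  have mI : measurable `[(0 : R), 1]%classic by exact: measurable_itv.
  have mu1 : fine (leb `[(0 : R), 1]%classic) = 1.
    have e1 : (@lebesgue_measure R [set` Interval (BLeft 0%R) (BRight 1%R)] = 1%:E)%E.
      by rewrite lebesgue_measure_itv /= lte_fin ltr01 oppr0 adde0.
    by rewrite (congr1 fine e1).
  have -> : expR (- p) = \int[leb]_(t in `[0, 1]) (cst (expR (- p)) t).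
    by rewrite Rintegral_cst// mu1 mulr1.
  rewrite Rintegral_mkcond; apply: le_Rintegral => //.
  - rewrite -restrict_EFin.
    have [+ _] := @integrable_mkcond _ _ R leb `[0, 1]%classic (EFin \o cst (expR (- p))) mI.
    apply; apply/integrableP; split; first exact/measurable_EFinP.
    rewrite (eq_integral (cst `|expR (- p)|%:E))//.
    rewrite integral_cst// lte_mul_pinfty//; exact: lebesgue_measure_itv_lty.
  - by have [] := ie 0.
  - move=> t _; have e1 : Rec (e 0 t) = expR (- (p * t ^+ 2)) by exact: (congr1 (@^~ t) re0).
    rewrite [leRHS]e1.
    rewrite /patch; case: ifPn => [/set_mem|_]; last exact: expR_ge0.
    rewrite /= in_itv/= => /andP[h0 h1]; rewrite ler_expR lerN2.
    rewrite -[leRHS]mulr1 ler_pM2l// -[1]mulr1 expr2; exact: ler_pM.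
apply/negP => /eqP g0.
have : Q q0 = 0 by rewrite /Q (_ : cI leb (e q0) = 0)// mul0r mulr0.
by rewrite Qc => /eqP; rewrite !mulf_eq0 (negbTE (mn0 0)) (negbTE Q0).
Qed.

End GaussianIntegral.

(** * Rescaled Gaussians and their limit *)

Section RescaledGaussian.
Context {R : realType} (sig K : R) (s S : R -> R) (hc : contour sig s S K).
Local Notation leb := (@lebesgue_measure R).
Local Notation lebR := (g_sigma_algebraType (@measurable _ (ocitv_type R))).

Let A : R := (1 + sig ^+ 2)^-1.

Let A_gt0 : 0 < A.
Proof. by rewrite invr_gt0 sqr1_gt0. Qed.

(* The path starts at [m(0) = N^2 / (1 + i sigma_0)] when [eps = N^-2],
   [N = n.+1]. *)
Definition heat (n : nat) : R[i] := mpath sig ((n.+1%:R ^+ 2)^-1) 0.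
(** This is [1 / (1 + i sig)], with real and imaginary parts written out. *)
Definition heat1 : R[i] := A +i* - (A * sig).

Lemma heatE n : heat n = heat1 * (n.+1%:R ^+ 2)%:C.
Proof.
have n0 : n.+1%:R != 0 :> R by rewrite pnatr_eq0.
have h1 := lt0r_neq0 (sqr1_gt0 sig).
rewrite /heat mpathE ?invr_gt0 ?exprn_gt0 ?(contour_gt0 hc)//.
move: (n.+1%:R) n0 => r r0.
by apply: ReIm_eq; rewrite !ReImE /= /A; field; rewrite ?h1 ?r0.
Qed.

Definition slope n (x t : R) : R := n.+1%:R * (S (n.+1%:R^-1 * t + x) - S x).

Lemma gau_rescale n x t :
  gau S (heat n) (n.+1%:R^-1 * t + x) x =
  cexp (- heat1 * ((t +i* slope n x t) * (t +i* slope n x t))).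
Proof.
have n0 : n.+1%:R != 0 :> R by rewrite pnatr_eq0.
rewrite /gau heatE /slope; move: (n.+1%:R) n0 => r r0; congr cexp.
rewrite !mulNr; congr (- _); rewrite -mulrA; congr (_ * _).
by apply: ReIm_eq; rewrite !ReImE /=; field.
Qed.

Lemma slope_mean n x t : exists2 th : R, 0 <= th <= sig & slope n x t = th * t.
Proof.
have [th h e] := contour_mean hc (n.+1%:R^-1 * t + x) x.
exists th => //; rewrite /slope e addrK.
have n0 : n.+1%:R != 0 :> R by rewrite pnatr_eq0.
by move: (n.+1%:R) n0 => r r0; field.
Qed.

(** For [0 <= th <= sig], [Re((1 + i th)^2 / (1 + i sig)) = A (1 + th (2 sig - th)) >= A]. At the
    start of the path the Gaussian decays along every chord, without any loss. *)
Lemma nrm_cexp_heat1 (t y : R) : (exists2 th : R, 0 <= th <= sig & y = th * t) ->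
  nrm (cexp (- heat1 * ((t +i* y) * (t +i* y)))) <= 2 * expR (- (A * t ^+ 2)).
Proof.
move=> [th /andP[th0 th1] ->]; apply: le_trans (nrm_cexp _) _.
rewrite ler_wpM2l// ler_expR !ReImE /=.
have -> : - A * (t * t - th * t * (th * t)) - - - (A * sig) * (t * (th * t) + th * t * t) =
  - (A * t ^+ 2) - A * t ^+ 2 * th * (2 * sig - th) by ring.
have h : 0 <= 2 * sig - th by lra.
by rewrite gerDl oppr_le0 mulr_ge0// mulr_ge0// mulr_ge0 ?sqr_ge0// ltW.
Qed.

(** The slope is a difference quotient of [u |-> S (u * t + x)] at 0, taken along the sequence
    [n.+1^-1]. *)
Lemma slope_cvg x t : slope n x t @[n --> \oo] --> s x * t.
Proof.
have dg : is_derive (0 : R) (1 : R) (fun u => S (u * t + x)) (s x * t).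
  have da := der_plus (der_mul (der_id (0 : R)) (der_cst t 0)) (der_cst x 0).
  have db : is_derive (0 * t + x) (1 : R) S (s x) by rewrite mul0r add0r; exact: contour_der hc x.
  by apply: (is_derive_eq (der_comp (f := S) (g := fun u => u * t + x) db da)); ring.
have [dd de] := dg; rewrite -de.
have /cvgr_dnbhsP H : h^-1 *: ((fun u : R => S (u * t + x)) (h *: (1 : R) + 0) - S (0 * t + x)) @[h --> 0^']
    --> 'D_1 (fun u : R => S (u * t + x)) (0 : R) by exact: dd.
have e : (fun n => slope n x t) = fun n => n.+1%:R^-1^-1 *: (S ((n.+1%:R^-1 *: (1 : R) + 0) * t + x) - S (0 * t + x)).
  by apply/funext => n; rewrite /slope invrK addr0 mul0r add0r /GRing.scale /= mulr1.
rewrite e; apply: H; split; last exact: cvg_harmonic.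
by move=> n; rewrite invr_eq0 pnatr_eq0.
Qed.

Lemma ccvg_cexp (u : nat -> R[i]) (l : R[i]) : ccvg u l -> ccvg (fun n => cexp (u n)) (cexp l).
Proof.
move=> [h1 h2]; have e : expR (Rec (u n)) @[n --> \oo] --> expR (Rec l).
  by apply: continuous_cvg => //; exact: continuous_expR.
split => /=; apply: cvgM => //.
- by apply: continuous_cvg => //; exact: continuous_cos.
- by apply: continuous_cvg => //; exact: continuous_sin.
Qed.

Lemma ccont1_cexp (P : R -> R[i]) : ccont1 P -> ccont1 (fun t => cexp (P t)).
Proof.
move=> [h1 h2]; have e : continuous (fun t => expR (Rec (P t))).
  by move=> t; apply: continuous_comp; [exact: h1|exact: continuous_expR].
split => t /=; apply: cvgM; try exact: e.
- by apply: (@continuous_comp _ _ _ (fun t => Imc (P t)) cos); [exact: h2|exact: continuous_cos].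
- by apply: (@continuous_comp _ _ _ (fun t => Imc (P t)) sin); [exact: h2|exact: continuous_sin].
Qed.

Definition heat_at (x : R) : R[i] := heat1 * (alpha s x * alpha s x).

Lemma gau_cvg x t : ccvg (fun n => gau S (heat n) (n.+1%:R^-1 * t + x) x)
  (cexp (- heat_at x * (t * t)%:C)).
Proof.
rewrite (_ : (fun n => _) = fun n => cexp (- heat1 * ((t +i* slope n x t) * (t +i* slope n x t)))).
  apply: ccvg_cexp.
  have -> : - heat_at x * (t * t)%:C = - heat1 * ((t +i* (s x * t)) * (t +i* (s x * t))).
    by rewrite /heat_at; apply: ReIm_eq; rewrite !ReImE /=; ring.
  apply: ccvgM; first exact: ccvg_cst.
  by apply: ccvgM; split => /=; [exact: cvg_cst|exact: slope_cvg|exact: cvg_cst|exact: slope_cvg].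
by apply/funext => n; exact: gau_rescale.
Qed.

Lemma Rec_heat_at x : A <= Rec (heat_at x).
Proof.
have /andP[s0 s1] := (contour_abs hc).2 x; rewrite !ReImE /=.
have -> : A * (1 * 1 - s x * s x) - - (A * sig) * (1 * s x + s x * 1) =
  A + A * s x * (2 * sig - s x) by ring.
have h : 0 <= 2 * sig - s x by lra.
by rewrite lerDl mulr_ge0// mulr_ge0// ltW.
Qed.

(** Two powers of [env]: in [superpose_bound] one is integrated over [t] and the other is traded for
    decay in [x]. *)
Lemma heat_bound : exists C : R, forall t,
  2 * expR (- (A * t ^+ 2)) <= C * env t * env t.
Proof.
have [C HC] := exp_sqr_env A_gt0; exists (2 * C) => t.
have t2 := sqr1_gt0 t; rewrite -!mulrA ler_wpM2l//.
have -> : expR (- (A * t ^+ 2)) = ((1 + t ^+ 2) * expR (- (A * t ^+ 2))) * env t.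
  by rewrite /env mulrAC divff ?mul1r// lt0r_neq0.
by rewrite mulrA; apply: ler_wpM2r; rewrite ?HC// ltW// env_gt0.
Qed.

(** Weight of the Dirac mass at [x] to which the Gaussians concentrate; it varies with [x] through
    the slope of the contour. *)
Definition amplitude (x : R) : R[i] := gint (heat_at x).

Lemma amplitude_neq0 (chi : R -> R) (hchi : smooth_step chi) x : amplitude x != 0.
Proof. by apply: (gint_neq0 hchi); exact: lt_le_trans (Rec_heat_at x). Qed.

Lemma nrm_heat x t : nrm (cexp (- heat_at x * (t * t)%:C)) <= 2 * expR (- (A * t ^+ 2)).
Proof.
apply: le_trans (nrm_cexp_sqr _ _) _; rewrite ler_wpM2l// ler_expR lerN2.
by rewrite ler_wpM2r ?sqr_ge0 ?Rec_heat_at.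
Qed.

Lemma env2_le_env (C t : R) : 0 <= C -> C * env t * env t <= C * env t.
Proof.
move=> C0; have e0 := ltW (env_gt0 t).
by rewrite -[leRHS]mulr1; apply: ler_wpM2l; [exact: mulr_ge0|exact: env_le1].
Qed.

Lemma amplitude_bounded : ccont1 amplitude /\ exists B : R, forall x, nrm (amplitude x) <= B.
Proof.
have [C HC] := heat_bound.
have C0 : 0 <= C.
  have := le_trans (mulr_ge0 (ler0n _ 2) (expR_ge0 _)) (HC 0).
  by rewrite -mulrA pmulr_lge0// mulr_gt0 ?env_gt0.
have b x t : nrm (cexp (- heat_at x * (t * t)%:C)) <= C * env t.
  by apply: le_trans (nrm_heat x t) _; apply: le_trans (HC t) _; exact: env2_le_env.
have iC : rint leb (fun t => C * env t) by apply: rintZ; exact: rint_env.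
have cx t : ccont1 (fun x => cexp (- heat_at x * (t * t)%:C)).
  rewrite (_ : (fun x => _) = fun x => cexp (- (t * t)%:C * heat1 * (alpha s x * alpha s x))).
    apply: ccont1_cexp; apply: ccont1M; first exact: ccont1_cst.
    by apply: ccont1M; exact: ccont1_alpha hc.
  by apply/funext => x; congr cexp; rewrite /heat_at; ring.
have ix x : cable leb (fun t => cexp (- heat_at x * (t * t)%:C)).
  exact: (ccont1_cable (ccont1_cexp_sqr _) (b x)).
split; first exact: (ccont1_param ix cx b iC).
exists (2 * \int[leb]_t (C * env t)) => x.
exact: (nrm_cI_le (cable_meas (ix x)) (b x) iC).
Qed.

Lemma gau_sym m x y : gau S m y x = gau S m x y.
Proof. by rewrite /gau; congr cexp; ring. Qed.

Lemma nrm_gau_rescale n x t :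
  nrm (gau S (heat n) (n.+1%:R^-1 * t + x) x) <= 2 * expR (- (A * t ^+ 2)).
Proof. by rewrite gau_rescale; apply: nrm_cexp_heat1; exact: slope_mean. Qed.

Lemma nrm_gau_heat n x y : nrm (gau S (heat n) y x) <= 2.
Proof.
(* This value of the rescaled variable puts the centre at [y]. *)
have := nrm_gau_rescale n x (n.+1%:R * (y - x)).
rewrite mulKf ?pnatr_eq0// subrK => h; apply: le_trans h _.
rewrite -[leRHS]mulr1 ler_wpM2l// -expR0 ler_expR oppr_le0.
by rewrite mulr_ge0 ?sqr_ge0// ltW.
Qed.

Lemma gau_heat_bound : exists2 C : R, 0 <= C &
  forall n x y, nrm (gau S (heat n) y x) <= (1 + y ^+ 2) * (C * env x).
Proof.
have [C HC] := heat_bound.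
have C0 : 0 <= C.
  have := le_trans (mulr_ge0 (ler0n _ 2) (expR_ge0 _)) (HC 0).
  by rewrite -mulrA pmulr_lge0// mulr_gt0 ?env_gt0.
exists (2 * C) => [|n x y]; first exact: mulr_ge0.
have := nrm_gau_rescale n x (n.+1%:R * (y - x)).
rewrite mulKf ?pnatr_eq0// subrK => h; apply: le_trans h _; apply: le_trans (HC _) _.
apply: le_trans (env2_le_env _ C0) _.
have -> : (1 + y ^+ 2) * (2 * C * env x) = C * (2 * (1 + y ^+ 2) * env x) by ring.
apply: ler_wpM2l => //; apply: le_trans (env_shift y x).
rewrite lef_pV2 ?posrE ?sqr1_gt0// lerD2l exprMn -[x - y]opprB sqrrN.
by rewrite ler_peMl ?sqr_ge0// exprn_ege1// ler1n.
Qed.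

Section Superposition.
Variables (p : R -> R) (M : R).
Hypotheses (cp : continuous p) (p0 : forall t, M < `|t| -> p t = 0).

Let p_bounded : exists2 B : R, 0 <= B & forall t, `|p t| <= B.
Proof.
have [B B0 HB] := continuous_bounded_itv (- `|M|) `|M| cp.
exists B => // t; have [tM|tM] := leP `|t| `|M|.
  by apply: HB; rewrite -ler_norml.
by rewrite p0 ?normr0//; apply: le_lt_trans tM; exact: ler_norm.
Qed.

(** The integral runs over the centres, with weight [p]. The factor [n.+1] normalises Gaussians of
    width of order [n.+1^-1]. *)
Definition superpose n (x : R) : R[i] :=
  n.+1%:R%:C * cI leb (fun y => (p y)%:C * gau S (heat n) y x).

Let ccp : ccont1 (fun y => (p y)%:C).
Proof. by split => //= t; exact: cvg_cst. Qed.

Let ccont1_integrand n x : ccont1 (fun y => (p y)%:C * gau S (heat n) y x).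
Proof.
apply: ccont1M => //; have := ccont1_gau hc (heat n) x; congr ccont1.
by apply/funext => y; rewrite gau_sym.
Qed.

Let r_gt0 (n : nat) : 0 < n.+1%:R^-1 :> R.
Proof. by rewrite invr_gt0. Qed.

Lemma superposeE n x : superpose n x =
  cI leb (fun t => (p (n.+1%:R^-1 * t + x))%:C * gau S (heat n) (n.+1%:R^-1 * t + x) x).
Proof.
rewrite /superpose (cI_affine (M := M) x (r_gt0 n) (ccont1_integrand n x)).
  rewrite mulrA; have -> : n.+1%:R%:C * (n.+1%:R^-1)%:C = 1 :> R[i].
    have n0 : n.+1%:R != 0 :> R by rewrite pnatr_eq0.
    by apply: ReIm_eq; rewrite !ReImE /=; move: (n.+1%:R) n0 => r r0; field.
  by rewrite mul1r.
by move=> y /p0 ->; rewrite mul0r.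
Qed.

Let ccont1_rescaled n x :
  ccont1 (fun t => (p (n.+1%:R^-1 * t + x))%:C * gau S (heat n) (n.+1%:R^-1 * t + x) x).
Proof.
have [h1 h2] := ccont1_integrand n x.
have ca : continuous (fun t : R => n.+1%:R^-1 * t + x).
  by move=> t; exact: der_continuous (der_affine _ _ _).
split => t.
  exact: (@continuous_comp _ _ _ _ (fun y => Rec ((p y)%:C * gau S (heat n) y x)) _ (ca t) (h1 _)).
exact: (@continuous_comp _ _ _ _ (fun y => Imc ((p y)%:C * gau S (heat n) y x)) _ (ca t) (h2 _)).
Qed.

Lemma superpose_cvg x : ccvg (fun n => superpose n x) ((p x)%:C * amplitude x).
Proof.
have [B B0 HB] := p_bounded; have [C HC] := heat_bound.
have C0 : 0 <= C.
  have := le_trans (mulr_ge0 (ler0n _ 2) (expR_ge0 _)) (HC 0).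
  by rewrite -mulrA pmulr_lge0// mulr_gt0 ?env_gt0.
under [X in ccvg X]eq_fun do rewrite superposeE.
have b t : nrm (cexp (- heat_at x * (t * t)%:C)) <= C * env t.
  by apply: le_trans (nrm_heat x t) _; apply: le_trans (HC t) _; exact: env2_le_env.
have iC : rint leb (fun t => C * env t) by apply: rintZ; exact: rint_env.
rewrite -cIZ; last exact: (ccont1_cable (ccont1_cexp_sqr _) b).
apply: (@cI_dct R _ _ leb _ _ (fun t => B * (C * env t))).
- by move=> n; exact: ccont1_cmeas.
- by apply: ccont1_cmeas; apply: ccont1M; [exact: ccont1_cst|exact: ccont1_cexp_sqr].
- move=> t; apply: ccvgM; last exact: gau_cvg.
  have h : n.+1%:R^-1 * t + x @[n --> \oo] --> x.
    rewrite -[X in _ --> X]add0r; apply: cvgD; last exact: cvg_cst.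
    by rewrite -(mul0r t); apply: cvgM; [exact: cvg_harmonic|exact: cvg_cst].
  apply: ccvg_real; apply: continuous_cvg; [exact: cp|exact: h].
- move=> n t; apply: le_trans (nrmM _ _) _; rewrite nrm_real; apply: ler_pM => //.
    exact: nrm_ge0.
  by apply: le_trans (nrm_gau_rescale n x t) _; apply: le_trans (HC t) _; exact: env2_le_env.
- exact: rintZ.
Qed.

(** A centre [x + t / N] in the support of [p] has absolute value at most [M]; a large [x] thus
    forces a large [t], and one of the two factors [env t] becomes a multiple of [env x]. *)
Lemma superpose_bound : exists C : R, forall n x, nrm (superpose n x) <= C * env x.
Proof.
have [B B0 HB] := p_bounded; have [C HC] := heat_bound.
have C0 : 0 <= C.
  have := le_trans (mulr_ge0 (ler0n _ 2) (expR_ge0 _)) (HC 0).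
  by rewrite -mulrA pmulr_lge0// mulr_gt0 ?env_gt0.
exists (2 * (\int[leb]_t env t * (B * C * (2 * (1 + M ^+ 2))))) => n x.
have ex := ltW (env_gt0 x).
have M0 : 0 <= 1 + M ^+ 2 := ltW (sqr1_gt0 M).
pose D := B * C * (2 * (1 + M ^+ 2) * env x).
rewrite superposeE; apply: le_trans (nrm_cI_le (mu := leb) (G := fun t => D * env t) _ _ _) _.
- exact: ccont1_cmeas.
- move=> t; have et := ltW (env_gt0 t).
  apply: le_trans (nrmM _ _) _; rewrite nrm_real.
  have [yM|yM] := ltP M `|n.+1%:R^-1 * t + x|.
    by rewrite p0// normr0 mul0r !mulr_ge0.
  apply: le_trans (ler_pM (normr_ge0 _) (nrm_ge0 _) (HB _) (nrm_gau_rescale n x t)) _.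
  apply: le_trans (ler_wpM2l B0 (HC t)) _.
  rewrite mulrA; apply: ler_wpM2r => //; rewrite /D (mulrA B) ler_wpM2l ?mulr_ge0//.
  move: yM; have := r_gt0 n; have : n.+1%:R^-1 <= 1 :> R by rewrite invf_le1// ler1n.
  move: (n.+1%:R^-1) => c c1 c0 yM; set y := c * t + x in yM *.
  (* Here [|x - y| = c |t| <= |t|], and [env_shift] then compares [env (x - y)] with [env x]. *)
  apply: (@le_trans _ _ (env (x - y))).
    rewrite lef_pV2 ?posrE ?sqr1_gt0// lerD2l /y opprD addrCA subrr addr0 sqrrN exprMn.
    by rewrite ler_piMl ?sqr_ge0// exprn_ile1// ltW.
  apply: le_trans (env_shift y x) _; rewrite ler_wpM2r// ler_wpM2l// lerD2l.
  by rewrite -[leLHS]real_normK ?num_real// ler_sqr ?nnegrE// (le_trans _ yM).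
- by apply: rintZ; exact: rint_env.
rewrite RintegralZl//; last exact: rint_env.
by rewrite le_eqVlt; apply/orP; left; apply/eqP; rewrite /D; ring.
Qed.

Let nrm_integrand n x y : nrm ((p y)%:C * gau S (heat n) y x) <= 2 * `|p y|.
Proof. by apply: le_trans (nrmM _ _) _; rewrite nrm_real mulrC ler_wpM2r// nrm_gau_heat. Qed.

Let rint_p2 : rint leb (fun y => 2 * `|p y|).
Proof. by apply/rintZ/rint_norm; exact: (continuous_vanish_rint cp p0). Qed.

(** With [n.+1] absorbed in the weight, the integral has the form handled by [cI_superpose]. *)
Lemma superpose_scale n x :
  superpose n x = cI leb (fun y => (n.+1%:R * p y)%:C * gau S (heat n) y x).
Proof.
rewrite /superpose -cIZ; last first.
  exact: (ccont1_cable (ccont1_integrand n x) (nrm_integrand n x) rint_p2).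
apply: cI_eq => y; rewrite mulrA; congr (_ * _).
by apply: ReIm_eq; rewrite !ReImE /=; ring.
Qed.

Lemma ccont1_superpose n : ccont1 (superpose n).
Proof.
apply: ccont1M; first exact: ccont1_cst.
apply: (ccont1_param _ _ (nrm_integrand n) rint_p2) => [x|y].
  exact: (ccont1_cable (ccont1_integrand n x) (nrm_integrand n x) rint_p2).
by apply: ccont1M; [exact: ccont1_cst|exact: ccont1_gau hc _ _].
Qed.

End Superposition.

End RescaledGaussian.

(** * Superposition of centres *)

Section PlanarSuperposition.
Context {R : realType}.
Local Notation leb := (@lebesgue_measure R).
Local Notation lebR := (g_sigma_algebraType (@measurable _ (ocitv_type R))).
Local Notation mu := (@lebesgue_measure R \x @lebesgue_measure R)%E.

Lemma cmeas_comp d d' (X : measurableType d) (Y : measurableType d') (h : Y -> R[i]) (a : X -> Y) :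
  cmeas h -> measurable_fun setT a -> cmeas (fun x => h (a x)).
Proof. by move=> [h1 h2] ma; split; [exact: (measurableT_comp h1 ma)|exact: (measurableT_comp h2 ma)]. Qed.

Lemma cmeas_cexp d (X : measurableType d) (h : X -> R[i]) : cmeas h -> cmeas (fun x => cexp (h x)).
Proof.
move=> [h1 h2]; have e : measurable_fun setT (fun x => expR (Rec (h x))).
  by apply: measurableT_comp h1; exact: measurable_expR.
have mc : measurable_fun setT (@cos R) by apply: continuous_measurable_fun; exact: continuous_cos.
have ms : measurable_fun setT (@sin R) by apply: continuous_measurable_fun; exact: continuous_sin.
by split => /=; apply: measurable_funM => //; [exact: (measurableT_comp mc h2)|exact: (measurableT_comp ms h2)].
Qed.

Lemma cmeas_gau d (X : measurableType d) (S : R -> R) (m : R[i]) (a b : X -> lebR) :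
  continuous S -> measurable_fun setT a -> measurable_fun setT b ->
  cmeas (fun x => gau S m (a x) (b x)).
Proof.
move=> cS ma mb; have mS : measurable_fun setT (S : lebR -> R) by exact: continuous_measurable_fun.
have mz c : measurable_fun setT c -> cmeas (fun x : X => zc S (c x)).
  by move=> mc; split => //=; exact: measurableT_comp.
apply: cmeas_cexp; apply: cmeasM; first exact: cmeas_cst.
have h : cmeas (fun x => zc S (b x) - zc S (a x)) by apply: cmeasD; [|apply: cmeasN]; exact: mz.
exact: cmeasM.
Qed.

Lemma leb2_sigma_finite : sigma_finite setT (@leb2 R).
Proof.
exists (fun n => rect (- n%:R) n%:R (- n%:R) n%:R) => [|n].
  apply/esym; rewrite -subTset => x _.
  pose n := (Num.truncn (`|x.1| + `|x.2|)).+1.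
  have xn : `|x.1| + `|x.2| < n%:R := truncnS_gt _.
  by exists n => //; split; rewrite /= in_itv/= -ltr_norml; apply: le_lt_trans xn; rewrite ?lerDl ?lerDr.
split; first exact: measurable_rect.
rewrite leb2X; try exact: measurable_itv.
have f1 : (@lebesgue_measure R `]- n%:R, n%:R[%classic) \is a fin_num.
  by rewrite ge0_fin_numE//; exact: lebesgue_measure_itv_lty.
by rewrite -(fineK f1) -EFinM ltry.
Qed.

(** Fubini carries orthogonality at every centre over to the weighted integral over centres. The
    growth [1 + y^2] of the bound is harmless because [p] has compact support. *)
Lemma cI_superpose (h : lebR * lebR -> R[i]) (k : lebR * lebR -> lebR -> R[i]) (p : R -> R)
    (M : R) (E : R * R -> R) :
  continuous p -> (forall t, M < `|t| -> p t = 0) -> cmeas h ->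
  cmeas (fun z : (lebR * lebR) * lebR => k z.1 z.2) ->
  (forall x y, nrm (k x y) <= (1 + y ^+ 2) * E x) -> rint mu (fun x => nrm (h x) * E x) ->
  (forall y, cI mu (fun x => h x * k x y) = 0) ->
  cI mu (fun x => h x * cI leb (fun y => (p y)%:C * k x y)) = 0.
Proof.
move=> cp p0 mh mk bk ihE k0.
have E0 x : 0 <= E x.
  by have := le_trans (nrm_ge0 _) (bk x 0); rewrite expr0n /= addr0 mul1r.
have sq1 (y : R) : 0 <= 1 + y ^+ 2 := ltW (sqr1_gt0 y).
have iD : rint leb (fun y => (1 + y ^+ 2) * `|p y|).
  apply: (continuous_vanish_rint (M := M)).
    move=> y; apply: cvgM; last by apply: cvg_norm; exact: cp.
    by apply: cvgD; [exact: cvg_cst|exact: exprn_continuous].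
  by move=> t /p0 ->; rewrite normr0 mulr0.
have mp : cmeas (fun y : lebR => (p y)%:C) by apply: cmeas_real; exact: continuous_measurable_fun.
have b x y : nrm ((p y)%:C * k x y) <= E x * ((1 + y ^+ 2) * `|p y|).
  apply: le_trans (nrmM _ _) _; rewrite nrm_real.
  have -> : E x * ((1 + y ^+ 2) * `|p y|) = `|p y| * ((1 + y ^+ 2) * E x) by ring.
  exact: ler_wpM2l.
have m1 x : cmeas (fun y => (p y)%:C * k x y).
  apply: cmeasM => //.
  exact: (cmeas_comp (a := fun y : lebR => (x, y)) mk (pair1_measurable x)).
have m2 y : cmeas (k ^~ y).
  exact: (cmeas_comp (a := fun x : lebR * lebR => (x, y)) mk (pair2_measurable y)).
have i1 x : cable leb (fun y => (p y)%:C * k x y) by exact: (@cable_dom R _ _ leb _ _ (m1 x) (b x) (rintZ (E x) iD)).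
have i2 y : cable mu (fun x => h x * k x y).
  apply: (cable_dom (G := fun x => (1 + y ^+ 2) * (nrm (h x) * E x))); last exact: rintZ.
    exact: cmeasM.
  move=> x; apply: le_trans (nrmM _ _) _; rewrite mulrCA ler_wpM2l ?nrm_ge0//.
under cI_eq do rewrite -cIZ//.
(* The planar measure is repackaged with its sigma-finiteness, in the form asked for by
   [cI_fubini]. *)
pose sf : {sigma_finite_measure set (lebR * lebR)%type -> \bar R} :=
  HB.pack mu (Measure_isSigmaFinite.Build _ _ _ mu leb2_sigma_finite).
rewrite (@cI_fubini R _ _ sf (fun z => h z.1 * ((p z.2)%:C * k z.1 z.2))
  (fun x => nrm (h x) * E x) (fun y => (1 + y ^+ 2) * `|p y|)) //.
- rewrite -[RHS](@cI0 _ _ _ leb); apply: cI_eq => y /=.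
  transitivity (cI mu (fun x => (p y)%:C * (h x * k x y))).
    by apply: cI_eq => x; ring.
  by rewrite cIZ// k0 mulr0.
- apply: cmeasM; first exact: (cmeas_comp mh measurable_fst).
  by apply: cmeasM => //; exact: (cmeas_comp mp measurable_snd).
- by move=> x; rewrite mulr_ge0 ?nrm_ge0.
- by move=> y; rewrite mulr_ge0.
- move=> x y /=; apply: le_trans (nrmM _ _) _; rewrite -mulrA ler_wpM2l ?nrm_ge0//.
Qed.

End PlanarSuperposition.

(** * Uniqueness for the homogeneous equation *)

Section Uniqueness.
Context {R : realType} (chi : R -> R) (hchi : smooth_step chi).
Variables (k sig K1 K2 : R) (s1 s2 S1 S2 : R -> R) (w g : R * R -> R[i]).
Hypotheses (hc1 : contour sig s1 S1 K1) (hc2 : contour sig s2 S2 K2) (k0 : 0 < k).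
Hypotheses (hw : pml_eq k s1 s2 w g) (g0 : {ae leb2, forall x, g x = 0}).
Local Notation leb := (@lebesgue_measure R).
Local Notation mu := (@leb2 R).

Let Jw (x : R * R) : R[i] := J s1 s2 x * w x.

Let cL2_Jw : cL2 mu Jw.
Proof.
have [_ [d1 [d2 [[iw _ _ _ _] _]]]] := hw.
exact: (cL2_J (contour_abs hc1) (contour_abs hc2) iw).
Qed.

Let rint_Jw_env (D : R) : rint mu (fun x => D * (nrm (Jw x) * (env x.1 * env x.2))).
Proof. by apply: rintZ; apply: Lfun2_mul_integrable; [exact: cL2_nrm|exact: Lfun2_env2]. Qed.

Let rint_weighted (h : R * R -> R[i]) (b : R * R -> R) (D : R) : cmeas h -> continuous b ->
  (forall x, 0 <= b x) ->
  (forall x, nrm (h x) * b x <= D * (nrm (Jw x) * (env x.1 * env x.2))) ->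
  rint mu (fun x => nrm (h x) * b x).
Proof.
move=> mh cb b0 bd.
have m : cmeas (fun x => (nrm (h x) * b x)%:C).
  by apply: cmeas_real; apply: measurable_funM; [exact: measurable_nrm|exact: continuous_measurable2].
have [] // := @cable_dom R _ _ mu _ _ m _ (rint_Jw_env D).
by move=> x; rewrite nrm_real ger0_norm// mulr_ge0// nrm_ge0.
Qed.

Let superpose_orthogonal (p q : R -> R) (M M' : R) n : continuous p -> continuous q ->
  (forall t, M < `|t| -> p t = 0) -> (forall t, M' < `|t| -> q t = 0) ->
  cI mu (fun x => Jw x * (superpose sig S1 p n x.1 * superpose sig S2 q n x.2)) = 0.
Proof.
move=> cp cq p0 q0.
have [C1 C10 H1] := gau_heat_bound hc1; have [C2 C20 H2] := gau_heat_bound hc2.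
have cS (s S : R -> R) K : contour sig s S K -> continuous S.
  by move=> hc t; exact: der_continuous (contour_der hc t).
have mJ := cL2_meas cL2_Jw.
have cN (r : R -> R) : continuous r -> continuous (fun y => n.+1%:R * r y).
  by move=> cr y; apply: cvgM; [exact: cvg_cst|exact: cr].
have N0 (r : R -> R) (L : R) : (forall t, L < `|t| -> r t = 0) ->
    forall t, L < `|t| -> n.+1%:R * r t = 0.
  by move=> r0 t /r0 ->; rewrite mulr0.
(* The centres are superposed one coordinate at a time: here over [y1], with [y2] fixed and its
   Gaussian counted in the other factor. *)
have e1 y2 : cI mu (fun x => Jw x * gau S2 (heat sig n) y2 x.2 * superpose sig S1 p n x.1) = 0.
  under cI_eq do rewrite (superpose_scale hc1 cp p0).
  apply: (cI_superpose (E := fun x => C1 * env x.1) (cN p cp) (N0 p M p0)).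
  - apply: cmeasM => //; apply: ccont_cmeas.
    by apply: (ccont_comp continuous_snd2); exact: ccont1_gau hc2 _ _.
  - apply: (cmeas_gau _ (cS _ _ _ hc1)) => //.
    exact: (measurableT_comp measurable_fst measurable_fst).
  - by move=> x y; exact: H1.
  - apply: (rint_weighted (D := (1 + y2 ^+ 2) * C2 * C1)).
    + apply: cmeasM => //; apply: ccont_cmeas.
      by apply: (ccont_comp continuous_snd2); exact: ccont1_gau hc2 _ _.
    + by move=> x; apply: cvgM; [exact: cvg_cst|apply: continuous_comp; [exact: continuous_fst2|exact: continuous_env]].
    + by move=> x; rewrite mulr_ge0// ltW// env_gt0.
    + move=> x; have h := H2 n x.2 y2.
      have e1 := ltW (env_gt0 x.1); have e2 := nrm_ge0 (Jw x).
      apply: le_trans (ler_wpM2r _ (nrmM _ _)) _; first exact: mulr_ge0.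
      apply: le_trans (ler_wpM2r _ (ler_wpM2l e2 h)) _; first exact: mulr_ge0.
      by rewrite le_eqVlt; apply/orP; left; apply/eqP; ring.
  - move=> y1; rewrite -[RHS](pml_gaussian_orthogonal hchi hc1 hc2 k0 hw g0 y1 y2 (eps := (n.+1%:R ^+ 2)^-1)).
      by rewrite cintE; apply: cI_eq => x; rewrite /heat /Jw; ring.
    by rewrite invr_gt0 exprn_gt0.
have [C HC] := superpose_bound hc1 cp p0.
transitivity (cI mu (fun x => Jw x * superpose sig S1 p n x.1 * superpose sig S2 q n x.2)).
  by apply: cI_eq => x; ring.
under cI_eq do rewrite (superpose_scale hc2 cq q0).
apply: (cI_superpose (E := fun x => C2 * env x.2) (cN q cq) (N0 q M' q0)).
- apply: cmeasM => //; apply: ccont_cmeas.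
  by apply: (ccont_comp continuous_fst2); exact: (ccont1_superpose hc1 cp p0).
- apply: (cmeas_gau _ (cS _ _ _ hc2)) => //.
  exact: (measurableT_comp measurable_snd measurable_fst).
- by move=> x y; exact: H2.
- apply: (rint_weighted (D := C * C2)).
  + apply: cmeasM => //; apply: ccont_cmeas.
    by apply: (ccont_comp continuous_fst2); exact: (ccont1_superpose hc1 cp p0).
  + by move=> x; apply: cvgM; [exact: cvg_cst|apply: continuous_comp; [exact: continuous_snd2|exact: continuous_env]].
  + by move=> x; rewrite mulr_ge0// ltW// env_gt0.
  + move=> x; have h := HC n x.1.
    have e2 := ltW (env_gt0 x.2); have e3 := nrm_ge0 (Jw x).
    apply: le_trans (ler_wpM2r _ (nrmM _ _)) _; first exact: mulr_ge0.
    apply: le_trans (ler_wpM2r _ (ler_wpM2l e3 h)) _; first exact: mulr_ge0.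
    by rewrite le_eqVlt; apply/orP; left; apply/eqP; ring.
- move=> y2; rewrite -[RHS](e1 y2); apply: cI_eq => x; ring.
Qed.

(** What is left of the integrand after concentration, apart from the test function: [w] times
    factors that never vanish. *)
Let h (x : R * R) : R[i] :=
  Jw x * (amplitude sig s1 x.1 * amplitude sig s2 x.2).

Let h_orthogonal p q : smooth p -> smooth q -> vanish_outside p -> vanish_outside q ->
  cint (fun x => h x * (tens p q x)%:C) = 0.
Proof.
move=> sp sq [M p0] [M' q0].
have cp := smooth_continuous sp; have cq := smooth_continuous sq.
have [c1 [B1 HB1]] := amplitude_bounded hc1; have [c2 [B2 HB2]] := amplitude_bounded hc2.
have [C1 HC1] := superpose_bound hc1 cp p0; have [C2 HC2] := superpose_bound hc2 cq q0.
have mJ := cL2_meas cL2_Jw.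
rewrite cintE; apply: ccvg_unique (ccvg_cst 0).
rewrite -(_ : (fun n => cI mu (fun x => Jw x * (superpose sig S1 p n x.1 * superpose sig S2 q n x.2)))
    = fun=> 0); last first.
  by apply/funext => n; exact: (superpose_orthogonal n cp cq p0 q0).
apply: (@cI_dct R _ _ mu _ _ (fun x => (C1 * C2) * (nrm (Jw x) * (env x.1 * env x.2)))).
- move=> n; apply: cmeasM => //; apply: ccont_cmeas.
  by apply: ccont_ctens; [exact: (ccont1_superpose hc1 cp p0)|exact: (ccont1_superpose hc2 cq q0)].
- apply: cmeasM; last by apply: ccont_cmeas; apply: ccont_real; exact: continuous_tens.
  by apply: cmeasM => //; apply: ccont_cmeas; exact: ccont_ctens.
- move=> x; rewrite (_ : h x * _ = Jw x * (((p x.1)%:C * amplitude sig s1 x.1) *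
      ((q x.2)%:C * amplitude sig s2 x.2))).
    apply: ccvgM; first exact: ccvg_cst.
    by apply: ccvgM; [exact: (superpose_cvg hc1 cp p0)|exact: (superpose_cvg hc2 cq q0)].
  rewrite /h /tens (_ : (p x.1 * q x.2)%:C = (p x.1)%:C * (q x.2)%:C); first by ring.
  by apply: ReIm_eq; rewrite !ReImE /=; ring.
- move=> n x; apply: le_trans (nrmM _ _) _; rewrite [leRHS]mulrCA ler_wpM2l ?nrm_ge0//.
  apply: le_trans (nrmM _ _) _.
  apply: le_trans (ler_pM (nrm_ge0 _) (nrm_ge0 _) (HC1 n x.1) (HC2 n x.2)) _.
  by rewrite le_eqVlt; apply/orP; left; apply/eqP; ring.
- exact: rint_Jw_env.
Qed.

(** The amplitudes are bounded, so that [h] is in L^2 and the fundamental lemma on the strips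
    [- n < x.1 < n] gives [h = 0] almost everywhere; neither [J] nor the amplitudes vanish. *)
Lemma pml_eq_unique : {ae mu, forall x, w x = 0}.
Proof.
have [c1 [B1 HB1]] := amplitude_bounded hc1; have [c2 [B2 HB2]] := amplitude_bounded hc2.
have ih : cL2 mu h.
  have -> : h = fun x => (amplitude sig s1 x.1 * amplitude sig s2 x.2) * Jw x.
    by apply/funext => x; rewrite /h mulrC.
  apply: (cL2M (c := B1 * B2)); last exact: cL2_Jw.
    by apply: ccont_cmeas; exact: ccont_ctens.
  move=> x; apply: le_trans (nrmM _ _) _; exact: (ler_pM (nrm_ge0 _) (nrm_ge0 _) (HB1 _) (HB2 _)).
have strip (n : nat) : {ae mu, forall x, - n%:R < x.1 < n%:R -> h x = 0}.
  by apply: (cfund_strip hchi ih) => p q sp sq vp vq _; exact: h_orthogonal.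
have := ae_foralln strip; apply: ae_imply => x hx.
have : h x = 0.
  apply: (hx (Num.truncn `|x.1|).+1); rewrite -ltr_norml; exact: truncnS_gt.
have a0 : amplitude sig s1 x.1 * amplitude sig s2 x.2 != 0.
  exact: (mulf_neq0 (amplitude_neq0 hc1 hchi x.1) (amplitude_neq0 hc2 hchi x.2)).
move/eqP; rewrite /h mulf_eq0 (negbTE a0) orbF /Jw mulf_eq0.
by rewrite (negbTE (J_neq0 s1 s2 x)) => /eqP.
Qed.

End Uniqueness.

(** * Layers and sweeps *)

Section NullSets.
Context {R : realType}.
Local Notation mu := (@leb2 R).

Lemma ae_off_line (c : R) : {ae mu, forall x, x.1 != c}.
Proof.
exists ([set c] `*` setT); split.
- by apply: measurableX => //; exact: measurable_set1.
- by rewrite leb2X// lebesgue_measure_set1 mul0e.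
- by move=> x /negP; rewrite negbK => /eqP <-.
Qed.

(** Otherwise a null set would contain an open square of side [2 e]. *)
Lemma continuous_ae0 (F : R * R -> R) (U : set (R * R)) x :
  {for x, continuous F} -> nbhs x U -> {ae mu, forall y, U y -> F y = 0} -> F x = 0.
Proof.
move=> cF xU [A [mA A0 sA]]; apply/eqP/negPn/negP => Fx.
have n1 : \forall y \near x, F y != 0 
  by apply: (cF [set z | z != 0]); apply: open_nbhs_nbhs; split => //; exact: open_neq.
have : nbhs x (U `&` [set y | F y != 0]) by exact: filterI.
rewrite -nbhs_ballE => -[e /= e0 xe].
have sub : rect (x.1 - e) (x.1 + e) (x.2 - e) (x.2 + e) `<=` A.
  move=> y [/= y1 y2]; apply: sA => /= Hy.
  have [Uy /eqP] : (U `&` [set y | F y != 0]) y; last by apply; exact: Hy.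
  apply: xe; split; rewrite /ball /= distrC ltr_distlC; move: y1 y2; rewrite !in_itv /=; lra.
have : (mu (rect (x.1 - e) (x.1 + e) (x.2 - e) (x.2 + e)) <= 0)%E.
  have := @le_measure _ _ _ (@lebesgue_measure R \x @lebesgue_measure R)%E
    _ _ (mem_set (measurable_rect _ _ _ _)) (mem_set mA) sub.
  by move=> /le_trans; apply; rewrite le_eqVlt; apply/orP; left; apply/eqP; exact: A0.
rewrite leb2X; try exact: measurable_itv.
rewrite !lebesgue_measure_itv /= !lte_fin !ltrBlDr -!addrA !ltrDl addr_gt0//.
rewrite -!EFinD -EFinM lee_fin.
have -> : (x.1 + e - (x.1 - e)) * (x.2 + e - (x.2 - e)) = 4 * e ^+ 2 by ring.
by rewrite leNgt mulr_gt0// exprn_gt0.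
Qed.

End NullSets.

(** * Locality on half-planes *)

Section HalfPlanes.
Context {R : realType} (chi : R -> R) (hchi : smooth_step chi).
Variables (k s0 : R) (s1 s2 : R -> R).
Hypotheses (hs1 : absorbing s0 s1) (hs2 : absorbing s0 s2).
Implicit Types (v w g h : R * R -> R[i]).
Local Notation mu := (@leb2 R).

(** Locality of the difference on the bounded strips [a < x.1 < n], over countably many [n]. *)
Lemma pml_eq_right w g w' g' (a : R) : pml_eq k s1 s2 w g -> pml_eq k s1 s2 w' g' ->
  (forall x, a < x.1 -> w x = w' x) -> {ae mu, forall x, a < x.1 -> g x = g' x}.
Proof.
move=> h h' ww; have hB := pml_eqB hs1 hs2 h h'.
have strip (n : nat) : {ae mu, forall x, a < x.1 < n%:R -> g x - g' x = 0}.
  by apply: (pml_eq_local hchi hs1 hs2 hB) => x /andP[/ww -> _]; rewrite subrr.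
apply: ae_imply (ae_foralln strip) => x hx xa; apply/eqP; rewrite -subr_eq0; apply/eqP.
apply: (hx (Num.truncn `|x.1|).+1); rewrite xa /=.
by apply: le_lt_trans (ler_norm _) _; exact: truncnS_gt.
Qed.

Lemma pml_eq_left w g w' g' (b : R) : pml_eq k s1 s2 w g -> pml_eq k s1 s2 w' g' ->
  (forall x, x.1 < b -> w x = w' x) -> {ae mu, forall x, x.1 < b -> g x = g' x}.
Proof.
move=> h h' ww; have hB := pml_eqB hs1 hs2 h h'.
have strip (n : nat) : {ae mu, forall x, - n%:R < x.1 < b -> g x - g' x = 0}.
  by apply: (pml_eq_local hchi hs1 hs2 hB) => x /andP[_ /ww ->]; rewrite subrr.
apply: ae_imply (ae_foralln strip) => x hx xb; apply/eqP; rewrite -subr_eq0; apply/eqP.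
apply: (hx (Num.truncn `|x.1|).+1); rewrite xb andbT ltrNl.
by apply: le_lt_trans (ler_norm _) _; rewrite normrN; exact: truncnS_gt.
Qed.

(** Any solution minus itself. *)
Lemma pml_eq_zero w g : pml_eq k s1 s2 w g -> pml_eq k s1 s2 (fun=> 0) (fun=> 0).
Proof.
by move=> h; apply: pml_eq_ext (pml_eqB hs1 hs2 h h) => x; rewrite subrr.
Qed.

End HalfPlanes.

(** * Geometry of the layers *)

Section Layers.
Context {R : realType} (l1 : R) (N : nat).
Hypotheses (l0 : 0 < l1) (N2 : (2 <= N)%N).
Local Notation zeta := (zeta l1 N).
Local Notation layer := (on_layer l1 N).
Implicit Types (h : R * R -> R[i]).

Lemma dzeta_gt0 : 0 < dzeta l1 N.
Proof. by rewrite divr_gt0 ?mulr_gt0// ltr0n; exact: leq_trans N2. Qed.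

Lemma zeta_le i j : (i <= j)%N -> zeta i <= zeta j.
Proof.
by move=> ij; rewrite lerD2l ler_wpM2r ?(ltW dzeta_gt0)// lerD2r ler_nat.
Qed.

Lemma OmegaE i x : (1 <= i <= N)%N ->
  Omega l1 N i x <-> ((i != 1%N -> zeta i < x.1) /\ (i != N -> x.1 < zeta i.+1)).
Proof.
move=> /andP[i1 iN]; rewrite /Omega.
case: eqP => [->|/eqP n1] /=.
  have -> : 1%N != N by rewrite neq_ltn N2.
  by split => [h|[_ h]]; [split|exact: h].
case: eqP => [->|/eqP nN] /=.
  by split => [h|[h _]]; [split|exact: h].
by split => [/andP[h1 h2]|[h1 h2]]; [split|rewrite h1// h2].
Qed.

Lemma layer_in i h x : Omega l1 N i x -> layer i h x = h x.
Proof. by move=> xi; rewrite /on_layer /patch mem_set. Qed.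

Lemma layer_out i h x : ~ Omega l1 N i x -> layer i h x = 0.
Proof. by move=> xi; rewrite /on_layer /patch memNset. Qed.

Lemma layer_right i h x : (1 <= i < N)%N -> zeta i.+1 <= x.1 -> layer i h x = 0.
Proof.
move=> /andP[i1 iN] xi; apply: layer_out => /OmegaE; rewrite i1 (ltnW iN) => /(_ isT) [_].
by rewrite neq_ltn iN => /(_ isT); rewrite ltNge xi.
Qed.

Lemma layer_left i h x : (1 < i <= N)%N -> x.1 <= zeta i -> layer i h x = 0.
Proof.
move=> /andP[i1 iN] xi; apply: layer_out => /OmegaE; rewrite (ltnW i1) iN => /(_ isT) [+ _].
by rewrite neq_ltn i1 orbT => /(_ isT); rewrite ltNge xi.
Qed.

(** Away from the interfaces, the partial sum up to [i < N] is the restriction of [h] to the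
    half-plane left of [zeta i.+1]. *)
Lemma sum_layers h x : (forall j, x.1 != zeta j) -> \sum_(1 <= j < N.+1) layer j h x = h x.
Proof.
move=> xj.
have part i : (1 <= i < N)%N ->
    \sum_(1 <= j < i.+1) layer j h x = if x.1 < zeta i.+1 then h x else 0.
  elim: i => [//|i IH] /andP[_ iN]; rewrite big_nat_recr//=.
  have [i0|i0] := posnP i.
    rewrite i0 big_geq// add0r; case: ifP => [xl|/negbT].
      by rewrite layer_in.
    by rewrite -leNgt => xr; rewrite layer_right// N2.
  rewrite IH ?i0 ?(ltnW iN)//; case: ltP => [x1|x1].
    rewrite layer_left ?addr0; [|by rewrite ltnS i0 ltnW|exact: ltW].
    by rewrite (lt_le_trans x1)// zeta_le.
  have {}x1 : zeta i.+1 < x.1 by rewrite lt_neqAle eq_sym xj.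
  rewrite add0r; case: ltP => [x2|x2].
    by rewrite layer_in//; apply: (proj2 (OmegaE x _)); [exact: ltnW|split].
  by rewrite layer_right.
have [M NM M1] : exists2 M, N = M.+1 & (1 <= M < N)%N.
  by case: N N2 => // M h1; exists M => //; rewrite -ltnS h1 /=.
rewrite big_nat_recr ?(ltnW N2)//=.
have := part M M1; rewrite -NM => ->.
case: ltP => [xl|xr]; first by rewrite layer_left ?addr0 ?leqnn ?N2// ltW.
rewrite add0r layer_in//; apply: (proj2 (OmegaE x _)); first by rewrite leqnn (ltnW N2).
by rewrite eqxx; split => // _; rewrite lt_neqAle eq_sym xj.
Qed.

End Layers.

(** * The two sweeps *)

Section Sweeps.
Context {R : realType} (chi : R -> R) (hchi : smooth_step chi).
Variables (k l1 s0 C : R) (s1 s2 : R -> R) (N : nat) (bp bm : nat -> R -> R).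
Variables (f : R * R -> R[i]) (fbarp psip up fbarm psim um : nat -> R * R -> R[i]).
Hypotheses (l0 : 0 < l1) (N2 : (2 <= N)%N).
Hypotheses (hs1 : absorbing s0 s1) (hs2 : absorbing s0 s2).
Hypothesis hcut : cutoffs l1 N bp bm C.
Hypothesis hstep1 : pstddm_step1 k l1 s1 s2 N f bp fbarp psip up.
Hypothesis hstep2 : pstddm_step2 k l1 s1 s2 N f bm fbarm psim um.
Local Notation mu := (@leb2 R).
Local Notation zeta := (zeta l1 N).
Local Notation layer := (on_layer l1 N).
Local Notation S := (pml_eq k s1 s2).

Lemma fbarp_right i x : (1 <= i < N)%N -> zeta i.+1 <= x.1 -> fbarp i x = 0.
Proof.
move=> iN xi; case: i iN xi => [//|[|i]] iN xi.
  by rewrite (step1_init hstep1) layer_right.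
by rewrite (step1_source hstep1) ?layer_right//; lia.
Qed.

Lemma fbarm_left i x : (1 < i <= N)%N -> x.1 <= zeta i -> fbarm i x = 0.
Proof.
move=> iN xi; have [e|ne] := eqVneq i N.
  by move: xi; rewrite e (step2_init hstep2) => xi; rewrite layer_left// leqnn N2.
by rewrite (step2_source hstep2) ?layer_left//; lia.
Qed.

(** The final solve of the forward sweep has the same form as those in its loop, with [i = N.-1]. *)
Lemma up_eq i : (1 <= i < N)%N -> S (up i) (fun x => - fbarp i x - layer i.+1 f x).
Proof.
move=> iN; have [e|ne] := eqVneq i N.-1.
  have -> : i.+1 = N by lia.
  by rewrite e; exact: step1_last hstep1.
by apply: (step1_solve hstep1); lia.
Qed.

(** [V] accumulates the truncated waves [cut bp j (up j.-1)] for [2 <= j <= i]. Each exchanges the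
    transferred source of one layer for that of the next, so that the sum of sources telescopes. *)
Lemma plus_correction i : (1 <= i < N)%N -> exists V G, [/\ S V G,
  {ae mu, forall x, G x = fbarp i x - \sum_(1 <= j < i.+1) layer j f x} &
  forall x, zeta i.+1 <= x.1 -> V x = 0].
Proof.
elim: i => [//|i IH] iN; have [i0|i0] := posnP i.
  exists (fun=> 0), (fun=> 0); split => //.
    exact: (pml_eq_zero hs1 hs2 (up_eq iN)).
  apply: aeW => x; rewrite i0 big_nat1 (step1_init hstep1) subrr//.
have [|V [G [hV hG V0]]] := IH; first lia.
have iN2 : (1 <= i <= N - 2)%N by lia.
have i1N : (1 <= i.+1 <= N)%N by lia.
have hu := step1_solve hstep1 iN2; have hp := step1_transfer hstep1 iN2.
exists (fun x => V x + Defs.cut bp i.+1 (up i) x), (fun x => G x + psip i.+1 x); split.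
- exact: (pml_eqD hs1 hs2 hV hp).
- have hr : {ae mu, forall x, zeta i.+2 < x.1 -> psip i.+1 x = 0}.
    apply: (pml_eq_right hchi hs1 hs2 hp (pml_eq_zero hs1 hs2 hp)) => x /ltW xi.
    by rewrite /Defs.cut; have [-> _ _ _] := cut_right hcut i1N xi; rewrite mul0r.
  have hl : {ae mu, forall x, x.1 < zeta i.+1 -> psip i.+1 x = - fbarp i x - layer i.+1 f x}.
    apply: (pml_eq_left hchi hs1 hs2 hp hu) => x /ltW xi.
    by rewrite /Defs.cut; have [-> _ _ _] := cut_left hcut i1N xi; rewrite mul1r.
  (* Off the two interfaces, [x] lies left of layer [i.+1], where [hl] applies, inside it, where
     [fbarp i.+1] contains [psip i.+1] by construction, or right of it, where [hr] applies. *)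
  apply: ae_imply2 (ae_off_line (zeta i.+2)) (ae_imply2 (fun x a b => conj a b) hr
    (ae_imply2 (fun x a b => conj a b) hl (ae_imply2 (fun x a b => conj a b) hG
      (ae_off_line (zeta i.+1))))).
  move=> x x2 [xr [xl [-> x1]]].
  rewrite [in RHS]big_nat_recr//= (step1_source hstep1)//.
  have [h1|h1] := ltP x.1 (zeta i.+1).
    rewrite xl// !(@layer_left R l1 N N2 i.+1) ?(ltW h1)//; try by lia.
    by ring.
  have {x1}h1 : zeta i.+1 < x.1 by rewrite lt_neqAle eq_sym x1.
  rewrite (fbarp_right _ (ltW h1)); last by lia.
  have [h2|h2] := ltP x.1 (zeta i.+2).
    rewrite !layer_in; try by apply/(OmegaE l1 N2 x i1N).
    by ring.
  have {x2}h2 : zeta i.+2 < x.1 by rewrite lt_neqAle eq_sym x2.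
  rewrite xr// !(@layer_right R l1 N N2 i.+1) ?(ltW h2)//; try by lia.
  by ring.
- move=> x xi; rewrite /Defs.cut V0; last by apply: le_trans xi; exact: zeta_le.
  by have [-> _ _ _] := cut_right hcut i1N xi; rewrite mul0r addr0.
Qed.

(** Mirror image of [plus_correction]; [n] counts layers from the right end, turning the backward
    sweep into an ascending induction. *)
Lemma minus_correction n : (n < N.-1)%N -> exists V G, [/\ S V G,
  {ae mu, forall x, G x = fbarm (N - n)%N x - \sum_((N - n)%N <= j < N.+1) layer j f x} &
  forall x, x.1 <= zeta (N - n) -> V x = 0].
Proof.
elim: n => [|n IH] nN.
  exists (fun=> 0), (fun=> 0); split => //.
    exact: (pml_eq_zero hs1 hs2 (step1_last hstep1)).
  by apply: aeW => x; rewrite subn0 big_nat1 (step2_init hstep2) subrr.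
have [|V [G [hV hG V0]]] := IH; first lia.
have [i ei] : exists i, i = (N - n.+1)%N by exists (N - n.+1)%N.
have ei1 : (N - n)%N = i.+1 by lia.
rewrite -ei; rewrite ei1 in hG V0.
have iN2 : (2 <= i <= N.-1)%N by lia.
have i1N : (1 <= i <= N)%N by lia.
have hu := step2_solve hstep2 iN2; have hp := step2_transfer hstep2 iN2.
exists (fun x => V x + Defs.cut bm i (um i) x), (fun x => G x + psim i x); split.
- exact: (pml_eqD hs1 hs2 hV hp).
- have hl : {ae mu, forall x, x.1 < zeta i -> psim i x = 0}.
    apply: (pml_eq_left hchi hs1 hs2 hp (pml_eq_zero hs1 hs2 hp)) => x /ltW xi.
    by rewrite /Defs.cut; have [_ -> _ _] := cut_left hcut i1N xi; rewrite mul0r.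
  have hr : {ae mu, forall x, zeta i.+1 < x.1 -> psim i x = - fbarm i.+1 x}.
    apply: (pml_eq_right hchi hs1 hs2 hp hu) => x /ltW xi.
    by rewrite /Defs.cut; have [_ -> _ _] := cut_right hcut i1N xi; rewrite mul1r.
  apply: ae_imply2 (ae_off_line (zeta i.+1)) (ae_imply2 (fun x a b => conj a b) hr
    (ae_imply2 (fun x a b => conj a b) hl (ae_imply2 (fun x a b => conj a b) hG
      (ae_off_line (zeta i))))).
  move=> x x2 [xr [xl [-> x1]]].
  rewrite [in RHS]big_ltn; last by lia.
  rewrite [in RHS](step2_source hstep2)//.
  have [h2|h2] := ltP (zeta i.+1) x.1.
    rewrite xr// !(@layer_right R l1 N N2 i) ?(ltW h2)//; try by lia.
    by ring.
  have {x2}h2 : x.1 < zeta i.+1 by rewrite lt_neqAle x2.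
  rewrite (fbarm_left _ (ltW h2)); last by lia.
  have [h1|h1] := ltP (zeta i) x.1.
    rewrite !layer_in; try by apply/(OmegaE l1 N2 x i1N).
    by ring.
  have {x1}h1 : x.1 < zeta i by rewrite lt_neqAle x1.
  rewrite xl// !(@layer_left R l1 N N2 i) ?(ltW h1)//; try by lia.
  by ring.
- move=> x xi; rewrite V0; last by apply: le_trans xi _; exact: zeta_le.
  by rewrite /Defs.cut; have [_ -> _ _] := cut_left hcut i1N xi; rewrite mul0r addr0.
Qed.

Hypotheses (hup0 : up 0%N = fun=> 0) (humN : um N = fun=> 0).

(** On the first layer the forward wave is 0 and carries no source: there [f_1] belongs to the
    source of [um 1]. Hence the exceptional case [i = 1], matched by the one in [minus_wave]. *)
Lemma plus_wave i : (1 <= i <= N)%N -> exists W G, [/\ S W G,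
  {ae mu, forall x, G x = if i == 1%N then 0 else - \sum_(1 <= j < i.+1) layer j f x} &
  forall x, Omega l1 N i x -> W x = up i.-1 x].
Proof.
case: i => [//|[|i]] iN.
  exists (fun=> 0), (fun=> 0); split => //=; last by move=> x _; rewrite hup0.
    exact: (pml_eq_zero hs1 hs2 (step1_last hstep1)).
  exact: aeW.
have iN' : (1 <= i.+1 < N)%N by lia.
have [V [G [hV hG V0]]] := plus_correction iN'.
exists (fun x => up i.+1 x + V x), (fun x => (- fbarp i.+1 x - layer i.+2 f x) + G x); split => //=.
- exact: (pml_eqD hs1 hs2 (up_eq iN') hV).
- by apply: ae_imply hG => x ->; rewrite [in RHS]big_nat_recr//=; ring.
- move=> x /(OmegaE l1 N2 x iN)[/(_ isT)/ltW xi _].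
  by rewrite V0// addr0.
Qed.

Lemma minus_wave i : (1 <= i <= N)%N -> exists W G, [/\ S W G,
  {ae mu, forall x, G x = - if i == 1%N then \sum_(1 <= j < N.+1) layer j f x
                            else \sum_(i.+1 <= j < N.+1) layer j f x} &
  forall x, Omega l1 N i x -> W x = um i x].
Proof.
move=> iN; have [e|ne] := eqVneq i N.
  exists (fun=> 0), (fun=> 0); split => //=; last by move=> x _; rewrite e humN.
    exact: (pml_eq_zero hs1 hs2 (step1_last hstep1)).
  apply: aeW => x; rewrite e gtn_eqF// big_geq ?oppr0//.
(* The correction starts at layer [i.+1], which is number [N - i.+1] from the right; its waves
   vanish on layer [i]. *)
have iN' : (N - i.+1 < N.-1)%N by lia.
have [V [G [hV hG V0]]] := minus_correction iN'.
have e : (N - (N - i.+1))%N = i.+1 by lia.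
rewrite e in hG V0.
have Vi x : Omega l1 N i x -> V x = 0.
  by move=> /(OmegaE l1 N2 x iN)[_ /(_ ne)/ltW]; exact: V0.
have [i1|i1] := eqVneq i 1%N.
  rewrite i1 in hG Vi *.
  exists (fun x => um 1%N x + V x), (fun x => (- layer 1 f x - fbarm 2%N x) + G x); split => //=.
  - exact: (pml_eqD hs1 hs2 (step2_last hstep2) hV).
  - by apply: ae_imply hG => x ->; rewrite [in RHS]big_ltn; [ring|lia].
  - by move=> x /Vi ->; rewrite addr0.
exists (fun x => um i x + V x), (fun x => - fbarm i.+1 x + G x); split => //=.
- by apply: (pml_eqD hs1 hs2 _ hV); apply: (step2_solve hstep2); lia.
- by apply: ae_imply hG => x ->; ring.
- by move=> x /Vi ->; rewrite addr0.
Qed.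

(** Uniqueness enters as a hypothesis, which separates the algebra of the sweeps from the
    analysis. *)
Lemma layer_decomposition (ut : R * R -> R[i]) i :
  (forall w g, S w g -> {ae mu, forall x, g x = 0} -> {ae mu, forall x, w x = 0}) ->
  S ut f -> (1 <= i <= N)%N ->
  {ae mu, forall x, Omega l1 N i x -> ut x = - (up i.-1 x + um i x)}.
Proof.
move=> uniq hut iN.
have [W [G [hW hG WE]]] := plus_wave iN; have [W' [G' [hW' hG' WE']]] := minus_wave iN.
have := uniq _ _ (pml_eqD hs1 hs2 hut (pml_eqD hs1 hs2 hW hW')).
have lines := ae_foralln (fun j => ae_off_line (zeta j)).
have z : {ae mu, forall x, f x + (G x + G' x) = 0}.
  apply: ae_imply2 lines (ae_imply2 (fun x a b => conj a b) hG hG') => x xz [-> ->].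
  (* For [i = 1] the backward source already contains all layers; otherwise the two sources split
     the layers between [i] and [i.+1]. *)
  rewrite -[f x](sum_layers l0 N2 f xz); case: ifP => i1; first by ring.
  rewrite (@big_cat_nat _ _ _ i.+1 1 N.+1)//=; [ring|lia].
move=> /(_ z); apply: ae_imply => x + xi; rewrite WE// WE'// => /eqP.
by rewrite addr_eq0 => /eqP.
Qed.

End Sweeps.

(** * From the cutoffs to the pointwise identity *)

Section CutoffStep.
Context {R : realType}.

(** The affine change of variable maps [[0, 1]] onto [[zeta 1, zeta 2]], the interval on which the
    first cutoff passes from 1 to 0. *)
Lemma cutoff_smooth_step (l1 C : R) N (bp bm : nat -> R -> R) : 0 < l1 -> (2 <= N)%N ->
  cutoffs l1 N bp bm C -> smooth_step (fun t => bp 1%N (dzeta l1 N * t + zeta l1 N 1)).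
Proof.
move=> l0 N2 hc; have N1 : (1 <= 1 <= N)%N := ltnW N2.
have d0 := dzeta_gt0 l0 N2; split.
- by apply: smooth_affine; apply: smoothP; exact: cut_smooth_p hc _ N1.
- move=> t t0; have [] // := cut_left hc N1 (t := dzeta l1 N * t + zeta l1 N 1).
  by rewrite gerDr pmulr_rle0.
- move=> t t1; have [] // := cut_right hc N1 (t := dzeta l1 N * t + zeta l1 N 1).
  have -> : zeta l1 N 2 = dzeta l1 N + zeta l1 N 1 by rewrite /zeta; ring.
  by rewrite lerD2r ler_peMr// ltW.
Qed.

Lemma nbhs_Omega (l1 : R) N i x : Omega l1 N i x -> nbhs x (Omega l1 N i).
Proof.
have oG (c : R) : open [set x : R * R | c < x.1].
  by apply: (@open_comp _ _ (@fst R R) [set t | c < t]) => [y _|]; [exact: continuous_fst2|exact: open_gt].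
have oL (c : R) : open [set x : R * R | x.1 < c].
  by apply: (@open_comp _ _ (@fst R R) [set t | t < c]) => [y _|]; [exact: continuous_fst2|exact: open_lt].
move=> xi; apply: open_nbhs_nbhs; split => //; rewrite /Omega.
case: ifP => _; first exact: oL.
case: ifP => _; first exact: oG.
rewrite (_ : [set y | _] = [set y | zeta l1 N i < y.1] `&` [set y | y.1 < zeta l1 N i.+1]).
  by apply: openI; [exact: oG|exact: oL].
by apply/seteqP; split => y /=; [move/andP|move=> [-> ->]].
Qed.

End CutoffStep.

Theorem theorem2p5 (R : realType) (k l1 l2 lbar1 lbar2 sigma0 C : R)
    (sigma1 sigma2 : R -> R) (N : nat) (bp bm : nat -> R -> R)
    (f ut : R * R -> R[i])
    (fbarp psip up fbarm psim um : nat -> R * R -> R[i])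
    (hk : 0 < k) (hl1 : 0 < l1) (hl2 : 0 < l2)
    (hlbar1 : l1 < lbar1) (hlbar2 : l2 < lbar2) (hsigma0 : 0 < sigma0)
    (hsigma1 : pml_profile l1 lbar1 sigma0 sigma1)
    (hsigma2 : pml_profile l2 lbar2 sigma0 sigma2)
    (hN : (2 <= N)%N)
    (hcut : cutoffs l1 N bp bm C)
    (hf : L2 f)
    (hsupp : {ae leb2, forall x, ~ (`|x.1| < l1 /\ `|x.2| < l2) -> f x = 0})
    (hut : pml_eq k sigma1 sigma2 ut f)
    (hstep1 : pstddm_step1 k l1 sigma1 sigma2 N f bp fbarp psip up)
    (hstep2 : pstddm_step2 k l1 sigma1 sigma2 N f bm fbarm psim um)
    (hup0 : up 0%N = fun=> 0) (humN : um N = fun=> 0) :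
  forall i, (1 <= i <= N)%N ->
    {ae leb2, forall x, Omega l1 N i x -> ut x = - (up i.-1 x + um i x)} /\
    (forall x, Omega l1 N i x ->
       continuous_at_point ut x -> continuous_at_point (up i.-1) x ->
       continuous_at_point (um i) x ->
       ut x = - (up i.-1 x + um i x)).
Proof.
move=> i iN; have hchi := cutoff_smooth_step hl1 hN hcut.
have hs1 := profile_absorbing hsigma1; have hs2 := profile_absorbing hsigma2.
have [S1 [K1 hc1]] := profile_contour hsigma0 hsigma1.
have [S2 [K2 hc2]] := profile_contour hsigma0 hsigma2.
have ae := layer_decomposition hchi hl1 hN hs1 hs2 hcut hstep1 hstep2 hup0 humN
  (fun w g hw g0 => pml_eq_unique hchi hc1 hc2 hk hw g0) hut iN.
split => // x xi [cr1 ci1] [cr2 ci2] [cr3 ci3].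
(* The layers are open, so that the difference of the two sides vanishes almost everywhere near [x];
   being continuous at [x], it vanishes there. *)
have nx := nbhs_Omega xi.
apply/eqP; rewrite -addr_eq0; apply/eqP/ReIm_eq; rewrite !ReImE.
  apply: (continuous_ae0 (F := fun y => re ut y + (re (up i.-1) y + re (um i) y)) _ nx).
    by apply: cvgD; [exact: cr1|apply: cvgD; [exact: cr2|exact: cr3]].
  by apply: ae_imply ae => y h yi; rewrite /re h// !ReImE addrC subrr.
apply: (continuous_ae0 (F := fun y => im ut y + (im (up i.-1) y + im (um i) y)) _ nx).
  by apply: cvgD; [exact: ci1|apply: cvgD; [exact: ci2|exact: ci3]].
by apply: ae_imply ae => y h yi; rewrite /im h// !ReImE addrC subrr.
Qed.
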